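(* There exist a globally hyperbolic, regularly localizable Lorentzian length space $(X,d,\ll,\leq,\tau)$ with timelike curvature bounded above by $-1$ and an achronal causal curve $\gamma\colon[0,\infty)\to X$ such that: 1. In this parametrization, $\gamma$ can be approximated uniformly on compact sets by affinely parametrized length-maximizing timelike geodesics, i.e. there is a sequence $(\gamma_n)_n$ of affinely parametrized timelike geodesics such that for every compact interval $[0,T]\subset[0,\infty)$ the curve $\gamma_n$ is defined on $[0,T]$ for all large $n$ and $\gamma_n\to\gamma$ uniformly on $[0,T]$ with respect to $d$. 2. $\gamma$ admits a reparametrization $\sigma\colon[0,a)\to X$ with $a<\infty$ such that $\sigma$ too can be approximated uniformly on compact sets (i.e. on compact intervals $[0,T]\subset[0,a)$, in the same sense) by affinely parametrized length-maximizing timelike geodesics.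
   Context: Lorentzian pre-length space: $(X,d,\ll,\leq,\tau)$ where $(X,d)$ is a metric space, $\leq$ is reflexive and transitive, $\ll$ is transitive and contained in $\leq$, and $\tau\colon X\times X\to[0,\infty]$ is lower semicontinuous with $\tau(x,z)\ge\tau(x,y)+\tau(y,z)$ for $x\le y\le z$, $\tau(x,y)=0$ if $x\not\le y$, and $\tau(x,y)>0\iff x\ll y$. Write $x<y$ for $x\le y$, $x\neq y$. $I^\pm,J^\pm$ are the chronological/causal futures and pasts, $J(x,y)=J^+(x)\cap J^-(y)$. A (future-directed) causal (resp. timelike) curve is a non-constant locally Lipschitz (w.r.t. $d$) curve $\gamma\colon I\to X$ with $\gamma(s)\le\gamma(t)$ (resp. $\gamma(s)\ll\gamma(t)$) for all $s<t$. A causal curve is achronal if no two of its points are $\ll$-related. Its length on $[a,b]$ is $L_\tau(\gamma)=\inf\sum_i\tau(\gamma(t_i),\gamma(t_{i+1}))$ over partitions of $[a,b]$; $L^d$ is the $d$-length. A timelike geodesic is a timelike curve $\gamma$ with $\tau(\gamma(s),\gamma(t))=L_\tau(\gamma|_{[s,t]})$ for all $s<t$ (so it is length-maximizing by definition); it is affinely parametrized if it is parametrized proportionally to $\tau$-arclength. $X$ is localizable if every $x\in X$ has an open neighbourhood $\Omega_x$ such that: (i) there is $C>0$ with $L^d(\gamma)\le C$ for all causal curves in $\Omega_x$; (ii) there is a continuous $\omega_x\colon\Omega_x\times\Omega_x\to[0,\infty)$ making $\Omega_x$ (with restricted $d,\ll,\le$) a Lorentzian pre-length space, and $I^\pm(y)\cap\Omega_x\ne\emptyset$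 for all $y\in\Omega_x$; (iii) for all $p<q$ in $\Omega_x$ there is a causal curve $\gamma_{p,q}$ from $p$ to $q$ in $\Omega_x$ of maximal $\tau$-length among causal curves in $\Omega_x$ from $p$ to $q$, and $L_\tau(\gamma_{p,q})=\omega_x(p,q)\le\tau(p,q)$. It is regularly localizable if moreover (iv) for $p\ll q$ in $\Omega_x$, $\gamma_{p,q}$ is timelike and strictly longer than any causal curve in $\Omega_x$ from $p$ to $q$ containing a null segment (a segment no two points of which are $\ll$-related). $X$ is a Lorentzian length space if it is locally causally closed (each point has a neighbourhood $U$ such that $\le$ is closed in $\overline U\times\overline U$), causally path connected ($x\ll y$, resp. $x<y$, implies the existence of a timelike, resp. causal, curve from $x$ to $y$), localizable, and $\tau(x,y)$ is the supremum of $L_\tau$ over causal curves from $x$ to $y$ ($0$ if there are none). It is globally hyperbolic if all $J(x,y)$ are compact and for every compact $K$ there is $C>0$ with $L^d(\gamma)\le C$ for all causal curves contained in $K$. Timelike curvature bounded above by $-1$: let $\bar\tau$ be the time separation of the model space $\mathbb L^2(-1)$, the universal cover of two-dimensional anti-de Sitter space of curvature $-1$, and $D=\pi$. Every point of $X$ has a neighbourhood $U$ such that: $(U\times U)\cap\tau^{-1}([0,D))$ is open in $U\times U$ and $\tau$ is continuous there; any $x\ll y$ in $U$ with $\tau(x,y)<D$ are joined by a maximizing causal curve in $U$; and for every timelike triangle $x\ll y\ll z$ in $U$ with $\tau(x,z)<D$ and sides realized by maximizing curves in $U$, every point $p$ on a side with opposite vertex $v$, and the comparison triangle $\bar x,\bar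 y,\bar z$ in $\mathbb L^2(-1)$ with the same side lengths and corresponding points $\bar p,\bar v$, one has $\tau(p,v)\ge\bar\tau(\bar p,\bar v)$ and $\tau(v,p)\ge\bar\tau(\bar v,\bar p)$. *)

(* Defs.v *)
From HB Require Import structures.
From mathcomp Require Import all_boot all_order all_algebra.
From mathcomp Require Import all_classical all_reals all_analysis.
Set Implicit Arguments.
Unset Strict Implicit.
Unset Printing Implicit Defensive.
Import Order.TTheory GRing.Theory Num.Theory.
Import numFieldNormedType.Exports.
Local Open Scope classical_set_scope.
Local Open Scope ring_scope.

(* Axioms of a Lorentzian pre-length space on the subset A of X, with the
   metric and the relations of X restricted to A.  The values of tau outside
   A `*` A play no role: in the subspace topology such points are isolated. *)
Record pre_length_on (R : realType) (X : metricType R) (A : set X)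
    (ll le : X -> X -> Prop) (tau : X -> X -> \bar R) : Prop := PreLengthOn {
  le_refl_on : forall x, A x -> le x x ;
  le_trans_on : forall x y z, A x -> A y -> A z -> le x y -> le y z -> le x z ;
  ll_trans_on : forall x y z, A x -> A y -> A z -> ll x y -> ll y z -> ll x z ;
  ll_le_on : forall x y, A x -> A y -> ll x y -> le x y ;
  tau_ge0_on : forall x y, A x -> A y -> (0 <= tau x y)%E ;
  tau_lsc_on : lower_semicontinuous
    ((fun p => tau p.1 p.2) : subspace (A `*` A) -> \bar R) ;
  tau_triangle_on : forall x y z, A x -> A y -> A z ->
    le x y -> le y z -> (tau x y + tau y z <= tau x z)%E ;
  tau_eq0_on : forall x y, A x -> A y -> ~ le x y -> tau x y = 0%E ;
  tau_gt0_on : forall x y, A x -> A y -> ((0 < tau x y)%E <-> ll x y) }.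

Record lorentzPreLengthSpace (R : realType) := LorentzPreLengthSpace {
  carrier :> metricType R ;
  chron : carrier -> carrier -> Prop ;
  caus : carrier -> carrier -> Prop ;
  tau : carrier -> carrier -> \bar R ;
  pre_lengthP : pre_length_on setT chron caus tau }.

Arguments chron {R l}.
Arguments caus {R l}.
Arguments tau {R l}.

Section Curves.
Context {R : realType} {X : lorentzPreLengthSpace R}.
Implicit Types (I J : interval R) (g : R -> X) (x y : X) (A : set X).

Definition scaus x y := caus x y /\ x <> y.

Definition diamond x y : set X := [set z | caus x z /\ caus z y].

(* A curve defined on an interval I is a total function R -> X considered on
   I only. *)
Definition locally_lipschitz_curve I g :=
  forall s, s \in I -> exists2 V : set R, nbhs s V & exists k : R,
    forall t u, t \in I -> u \in I -> V t -> V u ->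
      mdist (g t) (g u) <= k * `|t - u|.

Definition nonconstant I g := exists s t, [/\ s \in I, t \in I & g s <> g t].

(* All causal and timelike curves are future-directed. *)
Definition causal_curve I g :=
  [/\ nonconstant I g, locally_lipschitz_curve I g &
      forall s t, s \in I -> t \in I -> s < t -> caus (g s) (g t)].

Definition timelike_curve I g :=
  [/\ nonconstant I g, locally_lipschitz_curve I g &
      forall s t, s \in I -> t \in I -> s < t -> chron (g s) (g t)].

Definition achronal I g :=
  forall s t, s \in I -> t \in I -> ~ chron (g s) (g t).

Definition curve_in I g A := forall t, t \in I -> A (g t).

Definition chain_sum (f : X -> X -> \bar R) g (a : R) (s : seq R) : \bar R :=
  (\sum_(0 <= i < size s)
     f (g (nth a (a :: s) i)) (g (nth a (a :: s) i.+1)))%E.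

Definition tau_length g (a b : R) : \bar R :=
  ereal_inf [set chain_sum tau g a s | s in itv_partition a b].

(* For an interval that is not compact this is the supremum of the lengths
   over its compact subintervals. *)
Definition metric_length I g : \bar R :=
  ereal_sup [set l | exists a b s, [/\ a \in I, b \in I, itv_partition a b s &
    l = chain_sum (fun x y => (mdist x y)%:E) g a s]].

Definition causal_from_to (a b : R) g x y :=
  [/\ causal_curve `[a, b] g, g a = x & g b = y].

Definition timelike_from_to (a b : R) g x y :=
  [/\ timelike_curve `[a, b] g, g a = x & g b = y].

(* A segment of a curve is a nonconstant restriction to a compact subinterval,
   so that a causal curve which pauses need not contain a null segment. *)
Definition has_null_segment (a b : R) g :=
  exists s t, [/\ s \in `[a, b], t \in `[a, b],
    causal_curve `[s, t] g & achronal `[s, t] g].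

Definition timelike_geodesic I g :=
  timelike_curve I g /\
  forall s t, s \in I -> t \in I -> s < t ->
    tau (g s) (g t) = tau_length g s t.

Definition affinely_parametrized I g :=
  exists c : R, forall s t, s \in I -> t \in I -> s < t ->
    tau_length g s t = (c * (t - s))%:E.

Definition reparametrization J (sg : R -> X) I g :=
  causal_curve J sg /\
  exists phi : R -> R,
    [/\ {within [set` J], continuous phi},
        {in J &, {homo phi : s t / s < t}},
        phi @` [set` J] = [set` I] &
        {in J, forall s, sg s = g (phi s)}].

(* To be used with I of the form [0, a[ or [0, +oo[. *)
Definition geodesically_approximable I g :=
  exists (J : nat -> interval R) (gn : nat -> R -> X),
    (forall n, timelike_geodesic (J n) (gn n) /\
               affinely_parametrized (J n) (gn n)) /\
    forall T, 0 <= T -> [set` `[0, T]] `<=` [set` I] ->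
      (\forall n \near \oo, [set` `[0, T]] `<=` [set` J n]) /\
      {uniform [set` `[0, T]], gn @ \oo --> g}.

End Curves.

Section Spaces.
Context {R : realType} (X : lorentzPreLengthSpace R).

Definition locally_causally_closed :=
  forall x : X, exists2 U, nbhs x U &
    closed ([set p | caus p.1 p.2] :
              set (subspace (closure U `*` closure U))).

Definition causally_path_connected :=
  (forall x y : X, chron x y -> exists a b g, timelike_from_to a b g x y) /\
  (forall x y : X, scaus x y -> exists a b g, causal_from_to a b g x y).

Definition bounded_causal_lengths (A : set X) :=
  exists2 C : R, 0 < C & forall I g, causal_curve I g -> curve_in I g A ->
    (metric_length I g <= C%:E)%E.

Definition localizing (Om : set X) (om : X -> X -> R) :=
  [/\ bounded_causal_lengths Om,
      {within Om `*` Om, continuous (fun p : X * X => om p.1 p.2)},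
      pre_length_on Om chron caus (fun x y => (om x y)%:E) &
      forall y, Om y ->
        (exists2 z, Om z & chron y z) /\ (exists2 z, Om z & chron z y)].

Definition longest_in (Om : set X) (om : X -> X -> R) (p q : X) a b g :=
  [/\ causal_from_to a b g p q, curve_in `[a, b] g Om,
      forall a' b' h, causal_from_to a' b' h p q -> curve_in `[a', b'] h Om ->
        (tau_length h a' b' <= tau_length g a b)%E,
      tau_length g a b = (om p q)%:E &
      ((om p q)%:E <= tau p q)%E].

Definition localizable :=
  forall x : X, exists (Om : set X) (om : X -> X -> R),
    [/\ open Om, Om x, localizing Om om &
        forall p q, Om p -> Om q -> scaus p q ->
          exists a b g, longest_in Om om p q a b g].

Definition regularly_localizable :=
  forall x : X, exists (Om : set X) (om : X -> X -> R),
    [/\ open Om, Om x, localizing Om om &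
        forall p q, Om p -> Om q -> scaus p q ->
          exists a b g, longest_in Om om p q a b g /\
            (chron p q -> timelike_curve `[a, b] g /\
               forall a' b' h, causal_from_to a' b' h p q ->
                 curve_in `[a', b'] h Om -> has_null_segment a' b' h ->
                 (tau_length h a' b' < tau_length g a b)%E)].

Definition intrinsic_tau :=
  forall x y : X, tau x y =
    ereal_sup ([set 0%E] `|`
      [set l | exists a b g, causal_from_to a b g x y /\
                             l = tau_length g a b]).

Definition lorentzian_length_space :=
  [/\ locally_causally_closed, causally_path_connected,
      localizable & intrinsic_tau].

Definition globally_hyperbolic :=
  (forall x y : X, compact (diamond x y)) /\
  (forall K : set X, compact K -> bounded_causal_lengths K).

End Spaces.

(* The model space L^2(-1).  The map
     (t, r) |-> (cosh r * cos t, cosh r * sin t, sinh r)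
   is a universal covering of two-dimensional anti-de Sitter space, the quadric
   - x^2 - y^2 + z^2 = -1, and the metric - dx^2 - dy^2 + dz^2 pulls back to
   - (cosh r)^2 dt^2 + dr^2 on R^2.  The time orientation is given by d/dt. *)
Section ModelSpace.
Context {R : realType}.
Implicit Types (a b : R) (c : R -> R * R) (p q : R * R).

Definition cosh (r : R) : R := (expR r + expR (- r)) / 2.

Definition model_vt c : R -> R := derive1 (fun u => (c u).1).
Definition model_vr c : R -> R := derive1 (fun u => (c u).2).

(* Minus the square of the velocity. *)
Definition model_speed2 c (s : R) : R :=
  cosh (c s).2 ^+ 2 * model_vt c s ^+ 2 - model_vr c s ^+ 2.

(* Future-directed causal curves of class C^1; a C^1 map on [a, b] always
   extends to a C^1 map on R, and only its restriction to [a, b] is used. *)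
Definition model_causal_from_to a b c p q :=
  [/\ a < b,
      (forall s, derivable (fun u => (c u).1) s 1 /\
                 derivable (fun u => (c u).2) s 1),
      continuous (model_vt c) /\ continuous (model_vr c),
      forall s, s \in `[a, b] -> 0 < model_vt c s /\ 0 <= model_speed2 c s &
      c a = p /\ c b = q].

Definition model_length a b c : \bar R :=
  (\int[lebesgue_measure]_(s in `[a, b]) (Num.sqrt (model_speed2 c s))%:E)%E.

Definition model_tau p q : \bar R :=
  ereal_sup ([set 0%E] `|`
    [set l | exists a b c, model_causal_from_to a b c p q /\
                           l = model_length a b c]).

(* The point m lies on a side (maximizing causal curve) from p to q. *)
Definition on_model_side p q (m : R * R) :=
  exists a b c, [/\ model_causal_from_to a b c p q,
    model_length a b c = model_tau p q &
    exists2 s, s \in `[a, b] & c s = m].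

End ModelSpace.

Section CurvatureBound.
Context {R : realType} {X : lorentzPreLengthSpace R}.

Definition maximizing_in (U : set X) (x y : X) a b g :=
  [/\ causal_from_to a b g x y, curve_in `[a, b] g U &
      tau_length g a b = tau x y].

(* Comparison for the points of the side g : [a, b] -> X from x to y, with
   opposite vertex v; x', y', v' are the comparison vertices. *)
Definition side_comparison (x v : X) a b (g : R -> X) (x' y' v' : R * R) :=
  forall s p', s \in `[a, b] -> on_model_side x' y' p' ->
    model_tau x' p' = tau x (g s) ->
    (model_tau p' v' <= tau (g s) v)%E /\ (model_tau v' p' <= tau v (g s))%E.

Definition triangle_comparison (U : set X) :=
  forall x y z : X, U x -> U y -> U z ->
    chron x y -> chron y z -> (tau x z < pi%:E)%E ->
  forall a1 b1 g1 a2 b2 g2 a3 b3 g3,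
    maximizing_in U x y a1 b1 g1 -> maximizing_in U y z a2 b2 g2 ->
    maximizing_in U x z a3 b3 g3 ->
  forall x' y' z' : R * R,
    model_tau x' y' = tau x y -> model_tau y' z' = tau y z ->
    model_tau x' z' = tau x z ->
    [/\ side_comparison x z a1 b1 g1 x' y' z',
        side_comparison y x a2 b2 g2 y' z' x' &
        side_comparison x y a3 b3 g3 x' z' y'].

End CurvatureBound.

(* Here pi is the constant D attached to L^2(-1). *)
Definition timelike_curvature_le_m1 (R : realType)
    (X : lorentzPreLengthSpace R) :=
  forall x : X, exists U : set X,
    [/\ nbhs x U,
        open ([set p | (tau p.1 p.2 < pi%:E)%E] : set (subspace (U `*` U))),
        {within (U `*` U) `&` [set p | (tau p.1 p.2 < pi%:E)%E],
           continuous (fun p : X * X => tau p.1 p.2)},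
        forall y z, U y -> U z -> chron y z -> (tau y z < pi%:E)%E ->
          exists a b g, maximizing_in U y z a b g &
        triangle_comparison U].

(* Main.v *)
Require Import Defs.
From HB Require Import structures.
From mathcomp Require Import all_boot all_order all_algebra.
From mathcomp Require Import all_classical all_reals all_analysis.
From mathcomp Require Import measurable_realfun.
From mathcomp Require Import ring lra.
Set Implicit Arguments.
Unset Strict Implicit.
Unset Printing Implicit Defensive.
Import Order.TTheory GRing.Theory Num.Theory.
Import numFieldNormedType.Exports.
Local Open Scope classical_set_scope.
Local Open Scope ring_scope.

(* The space is the plane of points (x, v).  Its half planes v >= 0 and v < 0
   carry the flat metrics du dv and dU dv, where u = e^x and U = -1/u, so they
   are glued along the null line v = 0 by a map u |-> -1/u that does not respect
   the affine parameters.  The half line x >= 0 of v = 0 is the achronal curve.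
   From above it is a limit of geodesics parametrized by u - 1, which has an
   infinite range; from below, of geodesics parametrized by U + 1, whose range
   is [0, 1).

   The time separation of p <= q is the minimum over y of the separations in
   the Minkowski planes obtained by replacing the gluing map by its affine
   tangent map at x = y, and also the maximum of the lengths of the paths that
   are straight in both half planes and cross v = 0 at x = y.  The minimum
   gives the reverse triangle inequality, the maximum the maximizing curves.

   In the tangent plane that is optimal for a side of a triangle, the signed
   squared separation from the opposite vertex obeys Stewart's formula with an
   inequality.  A Sturm comparison along the side turns this bound into the one
   by triangles of anti-de Sitter space.  There, the model separation is acos of
   the bilinear form of the quadric as long as it is less than pi: acos is a
   calibration, and past this range geodesics can be extended to causal curves
   of length close to pi. *)

(** In the coordinate [x] the two affine parameters form the symmetric pair [e^x], [-e^(-x)]. Hence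
    [(x, v) |-> (-x, -v)] is a time reversal of the whole space, and it halves the case analysis of
    the comparison. What makes the gluing work is convexity. Relative to a tangent point [y], the
    upper parameter [e^(x-y) - 1] lies above [x - y] and the lower one [1 - e^(y-x)] below it, both
    by [1 + t <= e^t]. Causal curves cross the line only from below to above, so every tangent plane
    overestimates separations across it. Minimum and maximum then agree as in a linear duality: the
    reversed Schwarz inequality bounds each broken path by each tangent plane, and equality holds at
    the [y] for which the broken path is straight in its own tangent plane. The obstacle in the
    comparison is that two tangent planes compete: one is optimal for the side of the triangle, the
    other for a point of that side and the opposite vertex. They agree affinely on each half plane
    but not across the line, so the crossing point needs an inequality of its own. *)

Section RealContinuity.
Variables (R : realType) (T : topologicalType).
Implicit Types (f g : T -> R) (x : T).

Lemma ct_cst (c : R) x : continuous_at x (fun _ => c).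
Proof. exact: cvg_cst. Qed.

Lemma ctD f g x : continuous_at x f -> continuous_at x g ->
  continuous_at x (fun x => f x + g x).
Proof. exact: cvgD. Qed.

Lemma ctN f x : continuous_at x f -> continuous_at x (fun x => - f x).
Proof. exact: cvgN. Qed.

Lemma ctM f g x : continuous_at x f -> continuous_at x g ->
  continuous_at x (fun x => f x * g x).
Proof. exact: cvgM. Qed.

Lemma ct_comp (h : R -> R) f x : {for f x, continuous h} -> continuous_at x f ->
  continuous_at x (fun x => h (f x)).
Proof. by move=> ch cf; exact: continuous_comp. Qed.

Lemma ct_norm f x : continuous_at x f -> continuous_at x (fun x => `|f x|).
Proof. by apply: ct_comp; exact: norm_continuous. Qed.

Lemma ct_expR f x : continuous_at x f -> continuous_at x (fun x => expR (f x)).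
Proof. by apply: ct_comp; exact: continuous_expR. Qed.

Lemma ct_sqrt f x : continuous_at x f -> continuous_at x (fun x => Num.sqrt (f x)).
Proof. by apply: ct_comp; exact: sqrt_continuous. Qed.

Lemma ct_cos f x : continuous_at x f -> continuous_at x (fun x => cos (f x)).
Proof. by apply: ct_comp; exact: continuous_cos. Qed.

Lemma ct_sin f x : continuous_at x f -> continuous_at x (fun x => sin (f x)).
Proof. by apply: ct_comp; exact: continuous_sin. Qed.

Lemma ct_atan f x : continuous_at x f -> continuous_at x (fun x => atan (f x)).
Proof. by apply: ct_comp; exact: continuous_atan. Qed.

Lemma ct_max f g x : continuous_at x f -> continuous_at x g ->
  continuous_at x (fun x => Num.max (f x) (g x)).
Proof.
move=> cf cg.
have E (a b : R) : Num.max a b = (a + b + `|a - b|) * 2^-1.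
  by case: (leP a b) => h; [rewrite ler0_norm|rewrite gtr0_norm]; lra.
rewrite [X in continuous_at _ X](_ : _ = fun x => (f x + g x + `|f x - g x|) * 2^-1).
  by apply: ctM; [apply: ctD; [exact: ctD|apply: ct_norm; apply: ctD => //; exact: ctN]
                 |exact: ct_cst].
by apply/funext => t; rewrite E.
Qed.

Lemma ct_min f g x : continuous_at x f -> continuous_at x g ->
  continuous_at x (fun x => Num.min (f x) (g x)).
Proof.
move=> cf cg.
rewrite [X in continuous_at _ X](_ : _ = fun x => - Num.max (- f x) (- g x)).
  by apply: ctN; apply: ct_max; exact: ctN.
by apply/funext => t; rewrite oppr_max !opprK.
Qed.

End RealContinuity.

Lemma ct_id (R : realType) (x : R) : continuous_at x (fun x : R => x).
Proof. exact: cvg_id. Qed.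

(** Leaves are closed from the context, so the continuity of the non-elementary parts is put there
    first. The [change] eta-expands a bare function so that the patterns apply to it. *)
Ltac ct_real := lazymatch goal with
  | |- continuous_at _ (fun x => @?f x + @?g x) => apply: ctD; ct_real
  | |- continuous_at _ (fun x => - @?f x) => apply: ctN; ct_real
  | |- continuous_at _ (fun x => @?f x * @?g x) => apply: ctM; ct_real
  | |- continuous_at _ (fun x => @?f x ^+ 2) => apply: (@ctM _ _ f f); ct_real
  | |- continuous_at _ (fun x => expR (@?f x)) => apply: ct_expR; ct_real
  | |- continuous_at _ (fun x => cos (@?f x)) => apply: ct_cos; ct_real
  | |- continuous_at _ (fun x => sin (@?f x)) => apply: ct_sin; ct_real
  | |- continuous_at _ (fun x => atan (@?f x)) => apply: ct_atan; ct_real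
  | |- continuous_at _ (fun x => `|@?f x|) => apply: ct_norm; ct_real
  | |- continuous_at _ (fun x => Num.sqrt (@?f x)) => apply: ct_sqrt; ct_real
  | |- continuous_at _ (fun x => Num.max (@?f x) (@?g x)) => apply: ct_max; ct_real
  | |- continuous_at _ (fun x => Num.min (@?f x) (@?g x)) => apply: ct_min; ct_real
  | |- continuous_at _ (fun x => _) =>
      first [exact: ct_cst | exact: ct_id | assumption | idtac]
  | |- continuous_at ?y ?f =>
      first [assumption | change (continuous_at y (fun x => f x)); ct_real]
  end.

(** * The reverse triangle inequality in null coordinates *)

Section ReversedSchwarz.
Variable R : realType.
Implicit Types a b c d : R.

(** A squared separation in the Minkowski plane is the product of two null increments, so this is
    the reverse triangle inequality. In terms of the four square roots, the defect of the squares is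
    [(x * t - z * y) ^ 2]. *)
Lemma sqrt_mulD_le a b c d : 0 <= a -> 0 <= b -> 0 <= c -> 0 <= d ->
  Num.sqrt (a * b) + Num.sqrt (c * d) <= Num.sqrt ((a + c) * (b + d)).
Proof.
move=> a0 b0 c0 d0.
rewrite !sqrtrM // ?addr_ge0 //.
rewrite -(sqr_sqrtr a0) -(sqr_sqrtr b0) -(sqr_sqrtr c0) -(sqr_sqrtr d0).
move: (sqrtr_ge0 a) (sqrtr_ge0 b) (sqrtr_ge0 c) (sqrtr_ge0 d).
move: (Num.sqrt a) (Num.sqrt b) (Num.sqrt c) (Num.sqrt d) => x y z t x0 y0 z0 t0.
rewrite !sqrtr_sqr !ger0_norm // -sqrtrM ?addr_ge0 ?sqr_ge0 //.
rewrite -[leLHS]ger0_norm ?addr_ge0 ?mulr_ge0 // -sqrtr_sqr ler_sqrt; last first.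
  by rewrite mulr_ge0 ?addr_ge0 ?sqr_ge0.
rewrite -subr_ge0.
have -> : (x ^+ 2 + z ^+ 2) * (y ^+ 2 + t ^+ 2) - (x * y + z * t) ^+ 2
  = (x * t - z * y) ^+ 2 by ring.
exact: sqr_ge0.
Qed.

Lemma sqrt_mulD_eq a b c d : 0 <= a -> 0 <= b -> 0 <= c -> 0 <= d ->
  a * d = c * b ->
  Num.sqrt (a * b) + Num.sqrt (c * d) = Num.sqrt ((a + c) * (b + d)).
Proof.
move=> a0 b0 c0 d0 e.
apply/eqP; rewrite -(@eqrXn2 _ 2) ?addr_ge0 ?sqrtr_ge0 //; apply/eqP.
rewrite sqrrD !sqr_sqrtr ?mulr_ge0 ?addr_ge0 //.
rewrite -sqrtrM ?mulr_ge0 //.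
have -> : a * b * (c * d) = (c * b) ^+ 2 by rewrite expr2 -{1}e; ring.
rewrite mulr2n sqrtr_sqr ger0_norm ?mulr_ge0 //.
by rewrite mulrDl !mulrDr e; ring.
Qed.

(** The square that measures the defect has to vanish. This rigidity is what puts the points of a
    maximizer on a chart segment. *)
Lemma eq_sqrt_mulD a b c d : 0 <= a -> 0 <= b -> 0 <= c -> 0 <= d ->
  Num.sqrt ((a + c) * (b + d)) <= Num.sqrt (a * b) + Num.sqrt (c * d) ->
  a * d = c * b.
Proof.
move=> a0 b0 c0 d0.
rewrite -(@ler_pXn2r _ 2) ?nnegrE ?addr_ge0 ?sqrtr_ge0 //.
rewrite sqrrD !sqr_sqrtr ?mulr_ge0 ?addr_ge0 //.
rewrite !sqrtrM //.
have := sqr_sqrtr a0; have := sqr_sqrtr b0; have := sqr_sqrtr c0; have := sqr_sqrtr d0.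
move: (Num.sqrt a) (Num.sqrt b) (Num.sqrt c) (Num.sqrt d) => x y z t <- <- <- <- h.
have h2 : (x * t - z * y) ^+ 2 <= 0 by lra.
have {h2} : x * t - z * y = 0 by apply/eqP; rewrite -sqrf_eq0 eq_le h2 sqr_ge0.
by move/subr0_eq => h2; rewrite -!exprMn h2.
Qed.

End ReversedSchwarz.

(** * The glued plane *)

Definition plane (R : realType) : Type := (R * R)%type.
HB.instance Definition _ (R : realType) := PseudoMetric.copy (plane R) (R * R)%type.

Section PlaneMetric.
Variable R : realType.

Definition pdist (p q : plane R) : R := Num.max `|p.1 - q.1| `|p.2 - q.2|.

Lemma pdist_ge0 p q : 0 <= pdist p q.
Proof. by rewrite le_max normr_ge0. Qed.

Lemma pdist_eq0 p q : pdist p q = 0 -> p = q.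
Proof.
move=> h; have : pdist p q <= 0 by rewrite h.
rewrite ge_max !normr_le0 !subr_eq0 => /andP[/eqP h1 /eqP h2].
by case: p q h1 h2 {h} => [? ?] [? ?] /= -> ->.
Qed.

Lemma ball_pdist (p : plane R) (d : R) : ball p d = [set q | pdist p q < d].
Proof.
apply/seteqP; split => q /=; rewrite gt_max.
  by case=> /= h1 h2; apply/andP; split; [exact: h1|exact: h2].
by move=> /andP[h1 h2]; split.
Qed.

HB.instance Definition _ := PseudoMetric_isMetric.Build R (plane R)
  pdist_ge0 pdist_eq0 ball_pdist.
End PlaneMetric.

(** * The time separation as a minimum over tangent planes *)

Section TimeSeparation.
Variable R : realType.
Implicit Types (p q m : plane R) (y z : R).

Definition ple p q := (p.1 <= q.1) && (p.2 <= q.2).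
Definition plt p q := (p.1 < q.1) && (p.2 < q.2).

(** Truncation at 0 splits the increase of [v] between the half planes, so that one formula for
    [sep2] covers all positions of [p] and [q]. *)
Definition dlow p q : R := Num.min q.2 0 - Num.min p.2 0.
Definition dupp p q : R := Num.max q.2 0 - Num.max p.2 0.

(* The squared separation when the half planes are glued by the affine map
   tangent to [u |-> - 1 / u] at [x = y]. *)
Definition sep2 y p q : R := (dlow p q * expR (- y) + dupp p q * expR y) *
  (expR (y - p.1) + expR (q.1 - y) - 2).

(** The infimum runs over all real [y], also outside [[p.1, q.1]]: each tangent plane gives an upper
    bound at once, and only the optimal [y] has to be located. *)
Definition ptau p q : R :=
  if ple p q then inf (range (fun y => Num.sqrt (sep2 y p q))) else 0.

(* The length of the path through [(y, 0)] that is straight in both half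
   planes. *)
Definition via y p q : R := Num.sqrt (dlow p q * (expR (- p.1) - expR (- y))) +
  Num.sqrt (dupp p q * (expR q.1 - expR y)).

Lemma ple_refl p : ple p p. Proof. by rewrite /ple !lexx. Qed.

Lemma ple_trans m p q : ple p m -> ple m q -> ple p q.
Proof.
by move=> /andP[a b] /andP[c d]; rewrite /ple (le_trans a c) (le_trans b d).
Qed.

Lemma plt_ple p q : plt p q -> ple p q.
Proof. by move=> /andP[a b]; rewrite /ple !ltW. Qed.

Lemma plt_trans m p q : plt p m -> plt m q -> plt p q.
Proof.
by move=> /andP[a b] /andP[c d]; rewrite /plt (lt_trans a c) (lt_trans b d).
Qed.

Lemma plt_ple_trans m p q : plt p m -> ple m q -> plt p q.
Proof.
by move=> /andP[a b] /andP[c d]; rewrite /plt (lt_le_trans a c) (lt_le_trans b d).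
Qed.

Lemma ple_plt_trans m p q : ple p m -> plt m q -> plt p q.
Proof.
by move=> /andP[a b] /andP[c d]; rewrite /plt (le_lt_trans a c) (le_lt_trans b d).
Qed.

Lemma dlow_ge0 p q : ple p q -> 0 <= dlow p q.
Proof.
by move=> /andP[_ h]; rewrite subr_ge0 le_min !ge_min h lexx orbT.
Qed.

Lemma dupp_ge0 p q : ple p q -> 0 <= dupp p q.
Proof.
by move=> /andP[_ h]; rewrite subr_ge0 ge_max !le_max h lexx orbT.
Qed.

Lemma sep2_ge0 y p q : ple p q -> 0 <= sep2 y p q.
Proof.
move=> h; have [/andP[h1 _]] : ple p q by [].
rewrite /sep2; apply: mulr_ge0.
  by rewrite addr_ge0 ?mulr_ge0 ?dlow_ge0 ?dupp_ge0 ?expR_ge0.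
have e1 := expR_ge1Dx (y - p.1); have e2 := expR_ge1Dx (q.1 - y).
by lra.
Qed.

(** The weights [expR (- z)] and [expR z] turn the radicands into products of increments in the
    tangent plane at [z]. After the reversed Schwarz inequality it remains that
    [expR (z - y) + expR (y - z) >= 2]. *)
Lemma via_le_sep2 y z p q : ple p q -> p.1 <= y <= q.1 ->
  via y p q <= Num.sqrt (sep2 z p q).
Proof.
move=> h /andP[y1 y2].
have e1 : 0 <= expR (- p.1) - expR (- y) by rewrite subr_ge0 ler_expR lerN2.
have e2 : 0 <= expR q.1 - expR y by rewrite subr_ge0 ler_expR.
have K : expR z * expR (- z) = 1 by rewrite -expRD subrr expR0.
have -> : via y p q =
   Num.sqrt (dlow p q * expR (- z) * (expR z * (expR (- p.1) - expR (- y)))) +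
   Num.sqrt (dupp p q * expR z * (expR (- z) * (expR q.1 - expR y))).
  congr (Num.sqrt _ + Num.sqrt _).
    by rewrite -[RHS]mulrA (mulrA (expR (- z)) (expR z)) (mulrC (expR (- z)) (expR z)) K mul1r.
  by rewrite -[RHS]mulrA (mulrA (expR z) (expR (- z))) K mul1r.
apply: le_trans (sqrt_mulD_le _ _ _ _) _;
  rewrite ?mulr_ge0 ?dlow_ge0 ?dupp_ge0 ?expR_ge0 //.
rewrite ler_sqrt ?sep2_ge0 // ler_wpM2l //.
  by rewrite addr_ge0 ?mulr_ge0 ?dlow_ge0 ?dupp_ge0 ?expR_ge0.
have e3 := expR_ge1Dx (z - y); have e4 := expR_ge1Dx (y - z).
by rewrite !mulrBr -!expRD (addrC (-z) q.1) (addrC (-z) y); lra.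
Qed.

(** The last equation is the equality case of the reversed Schwarz inequality: the broken path is
    straight in the tangent plane at [y]. Its right side vanishes at [y = p.1] and its left side at
    [y = q.1], so the intermediate value theorem applies. *)
Lemma exists_via_eq p q : ple p q -> exists y,
  [/\ p.1 <= y <= q.1, via y p q = Num.sqrt (sep2 y p q) &
    dlow p q * expR (- y) * (expR (q.1 - y) - 1) =
    dupp p q * expR y * (expR (y - p.1) - 1)].
Proof.
move=> h; have [/andP[h1 _]] : ple p q by [].
have h1' := h1.
pose f y := dlow p q * expR (- y) * (expR (q.1 - y) - 1) -
    dupp p q * expR y * (expR (y - p.1) - 1).
have cf : {within `[p.1, q.1], continuous f}.
  have cf (y : R) : continuous_at y f by rewrite /f; ct_real.
  exact: (continuous_subspaceT cf).
have f1 : 0 <= f p.1.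
  rewrite /f subrr expR0 subrr mulr0 subr0 !mulr_ge0 ?dlow_ge0 ?expR_ge0 //.
  by rewrite subr_ge0 -expR0 ler_expR subr_ge0.
have f2 : f q.1 <= 0.
  rewrite /f subrr expR0 subrr mulr0 sub0r oppr_le0 !mulr_ge0 ?dupp_ge0 ?expR_ge0 //.
  by rewrite subr_ge0 -expR0 ler_expR subr_ge0.
have [y yI fy] : exists2 y, y \in `[p.1, q.1] & f y = 0.
  by apply: (IVT h1 cf); rewrite ge_min le_max f1 f2 /= orbT.
move: yI; rewrite in_itv /= => yI.
move/subr0_eq: fy => fy.
exists y; split => //.
case/andP: yI => y1 y2.
rewrite /sep2 (_ : expR (y - p.1) + expR (q.1 - y) - 2 =
   (expR (y - p.1) - 1) + (expR (q.1 - y) - 1)); last by ring.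
rewrite -sqrt_mulD_eq ?mulr_ge0 ?dlow_ge0 ?dupp_ge0 ?expR_ge0 //;
  try by rewrite subr_ge0 -expR0 ler_expR subr_ge0.
congr (Num.sqrt _ + Num.sqrt _).
  rewrite -[RHS]mulrA; congr (_ * _); rewrite mulrBr mulr1 -expRD; congr (expR _ - _); ring.
rewrite -[RHS]mulrA; congr (_ * _); rewrite mulrBr mulr1 -expRD; congr (expR _ - _); ring.
Qed.

Lemma ptau_ge0 p q : 0 <= ptau p q.
Proof.
rewrite /ptau; case: ifP => // h; apply: lb_le_inf.
  by exists (Num.sqrt (sep2 0 p q)), 0.
by move=> _ [y _ <-]; exact: sqrtr_ge0.
Qed.

Lemma ptau_le_sep2 z p q : ple p q -> ptau p q <= Num.sqrt (sep2 z p q).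
Proof.
move=> h; rewrite /ptau h; apply: ge_inf; last by exists z.
by exists 0 => _ [y _ <-]; exact: sqrtr_ge0.
Qed.

Lemma via_le_ptau y p q : ple p q -> p.1 <= y <= q.1 -> via y p q <= ptau p q.
Proof.
move=> h hy; rewrite /ptau h; apply: lb_le_inf.
  by exists (Num.sqrt (sep2 0 p q)), 0.
by move=> _ [z _ <-]; exact: via_le_sep2.
Qed.

Lemma ptau_via p q y : ple p q -> p.1 <= y <= q.1 ->
  via y p q = Num.sqrt (sep2 y p q) -> ptau p q = Num.sqrt (sep2 y p q).
Proof.
move=> h hy e; apply/eqP; rewrite eq_le ptau_le_sep2 //= -e.
exact: via_le_ptau.
Qed.

Lemma ptauN p q : ~~ ple p q -> ptau p q = 0.
Proof. by rewrite /ptau => /negbTE ->. Qed.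

End TimeSeparation.

(** * Null charts of the tangent planes *)

Section Charts.
Variable R : realType.
Implicit Types (p q m : plane R) (y z : R).

(* Null coordinates of the tangent plane at [x = y].  They are affine in both
   half planes and agree along [v = 0] only to first order at [(y, 0)]. *)
Definition cha y p : R :=
  if 0 <= p.2 then expR (p.1 - y) - 1 else 1 - expR (y - p.1).
Definition chb y p : R := if 0 <= p.2 then p.2 * expR y else p.2 * expR (- y).
Definition csep2 y p q : R := (cha y q - cha y p) * (chb y q - chb y p).

Lemma csep2C y p q : csep2 y p q = csep2 y q p.
Proof. by rewrite /csep2; ring. Qed.

Lemma csep2_cross y p q : p.2 < 0 -> 0 <= q.2 -> csep2 y p q = sep2 y p q.
Proof.
move=> p0 q0; rewrite /csep2 /sep2 /cha /chb q0 (leNgt 0 p.2) p0 /= /dlow /dupp.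
rewrite (min_r q0) (min_l (ltW p0)) (max_l q0) (max_r (ltW p0)).
by ring.
Qed.

Lemma csep2_above y p q : 0 <= p.2 -> 0 <= q.2 ->
  csep2 y p q = (expR q.1 - expR p.1) * (q.2 - p.2).
Proof.
move=> p0 q0; rewrite /csep2 /cha /chb p0 q0.
have K : expR (- y) * expR y = 1 by rewrite -expRD addNr expR0.
rewrite !expRD; set e := expR (- y) in K *.
rewrite (_ : _ * _ = (expR q.1 - expR p.1) * (q.2 - p.2) * (e * expR y)); last by ring.
by rewrite K mulr1.
Qed.

Lemma csep2_below y p q : p.2 < 0 -> q.2 < 0 ->
  csep2 y p q = (expR (- p.1) - expR (- q.1)) * (q.2 - p.2).
Proof.
move=> p0 q0; rewrite /csep2 /cha /chb !leNgt p0 q0 /=.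
have K : expR (- y) * expR y = 1 by rewrite -expRD addNr expR0.
rewrite !expRD; set e := expR (- y) in K *.
rewrite (_ : _ * _ = (expR (- p.1) - expR (- q.1)) * (q.2 - p.2) * (e * expR y));
  last by ring.
by rewrite K mulr1.
Qed.

(** Across the line [1 + t <= e^t] even gives [cha y q - cha y p >= q.1 - p.1]. The crossing is from
    below to above because [v] does not decrease. *)
Lemma cha_le y p q : ple p q -> cha y p <= cha y q.
Proof.
move=> /andP[h1 h2]; rewrite /cha; case: (leP 0 p.2) => p0.
  by rewrite (le_trans p0 h2) lerD2r ler_expR lerD2r.
case: (leP 0 q.2) => q0; last by rewrite lerD2l lerN2 ler_expR lerD2l lerN2.
have e1 := expR_ge1Dx (y - p.1); have e2 := expR_ge1Dx (q.1 - y).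
by lra.
Qed.

Lemma cha_lt y p q : ple p q -> p.1 < q.1 -> cha y p < cha y q.
Proof.
move=> /andP[_ h2] h1; rewrite /cha; case: (leP 0 p.2) => p0.
  by rewrite (le_trans p0 h2) ltrD2r ltr_expR ltrD2r.
case: (leP 0 q.2) => q0; last by rewrite ltrD2l ltrN2 ltr_expR ltrD2l ltrN2.
have e1 := expR_ge1Dx (y - p.1); have e2 := expR_ge1Dx (q.1 - y).
by lra.
Qed.

Lemma chb_le y p q : p.2 <= q.2 -> chb y p <= chb y q.
Proof.
move=> h2; rewrite /chb; case: (leP 0 p.2) => p0.
  by rewrite (le_trans p0 h2) ler_pM2r ?expR_gt0.
case: (leP 0 q.2) => q0; last by rewrite ler_pM2r ?expR_gt0.
have e1 : p.2 * expR (- y) <= 0 by rewrite mulr_le0_ge0 ?expR_ge0 // ltW.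
by rewrite (le_trans e1) // mulr_ge0 ?expR_ge0.
Qed.

Lemma chb_lt y p q : p.2 < q.2 -> chb y p < chb y q.
Proof.
move=> h2; rewrite /chb; case: (leP 0 p.2) => p0.
  by rewrite (le_trans p0 (ltW h2)) ltr_pM2r ?expR_gt0.
case: (leP 0 q.2) => q0; last by rewrite ltr_pM2r ?expR_gt0.
have e1 : p.2 * expR (- y) < 0 by rewrite nmulr_rlt0 ?expR_gt0.
by rewrite (lt_le_trans e1) // mulr_ge0 ?expR_ge0.
Qed.

Lemma csep2_ge0 y p q : ple p q -> 0 <= csep2 y p q.
Proof.
move=> h; rewrite mulr_ge0 ?subr_ge0 ?cha_le ?chb_le //.
by case/andP: h.
Qed.

Lemma csep2_gt0 y p q : plt p q -> 0 < csep2 y p q.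
Proof.
move=> h; case/andP: (h) => h1 h2.
by rewrite mulr_gt0 ?subr_gt0 ?cha_lt ?chb_lt ?plt_ple.
Qed.

Definition same_side p q := (0 <= p.2) == (0 <= q.2).

Lemma same_sideP p q : reflect ((0 <= p.2 /\ 0 <= q.2) \/ (p.2 < 0 /\ q.2 < 0))
  (same_side p q).
Proof.
rewrite /same_side; case: (leP 0 p.2) => p0; case: (leP 0 q.2) => q0 /=; constructor; tauto || lra.
Qed.

Lemma same_sideC p q : same_side p q = same_side q p.
Proof. by rewrite /same_side eq_sym. Qed.

Lemma csep2_same y z p q : same_side p q -> csep2 y p q = csep2 z p q.
Proof.
case/same_sideP => [[h1 h2]|[h1 h2]]; first by rewrite !csep2_above.
by rewrite !csep2_below.
Qed.

(** On one side all tangent planes carry the flat separation. The optimum is at [y = p.1] above and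
    at [y = q.1] below, where [via] and [sep2] both reduce to it. *)
Lemma ptau_same y p q : same_side p q -> ple p q ->
  ptau p q = Num.sqrt (csep2 y p q).
Proof.
move=> ss h; case/andP: (h) => h1 h2.
case/same_sideP: ss => [[p0 q0]|[p0 q0]].
  have e : sep2 p.1 p q = csep2 y p q.
    rewrite csep2_above // /sep2 subrr expR0 /dlow /dupp !min_r // !max_l // subrr.
    rewrite mul0r add0r expRD expRN.
    have := expR_gt0 p.1; move: (expR p.1) => k k0.
    by field; lra.
  rewrite -e; apply: ptau_via => //; first by rewrite lexx.
  rewrite e csep2_above // /via !subrr mulr0 sqrtr0 add0r /dupp !max_l //.
  by rewrite mulrC.
have e : sep2 q.1 p q = csep2 y p q.
  rewrite csep2_below // /sep2 subrr expR0 /dlow /dupp !min_l ?ltW // !max_r ?ltW //.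
  rewrite subrr mul0r addr0 expRD !expRN.
  have := expR_gt0 q.1; have := expR_gt0 p.1.
  move: (expR p.1) (expR q.1) => k k' k0 k0'.
  by field; lra.
rewrite -e; apply: ptau_via => //; first by rewrite h1 lexx.
rewrite e csep2_below // /via !subrr mulr0 sqrtr0 addr0 /dlow !min_l ?ltW //.
by rewrite mulrC.
Qed.

Lemma ptau_le y p q : ple p q -> ptau p q <= Num.sqrt (csep2 y p q).
Proof.
move=> h; case: (boolP (same_side p q)) => [ss|].
  by rewrite (ptau_same y ss h).
case/andP: (h) => _ h2; rewrite /same_side.
case: (leP 0 p.2) => p0; first by rewrite (le_trans p0 h2).
by case: (leP 0 q.2) => // q0 _; rewrite csep2_cross // ptau_le_sep2.
Qed.

(** The signs put [y] between [p.1] and [q.1], and the equation says that the chart segment from [p]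
    to [q] passes through the origin, which is the point [(y, 0)]. This is the optimality condition
    of [exists_via_eq]. *)
Lemma ptau_cross y p q : ple p q -> p.2 < 0 -> 0 <= q.2 ->
  cha y p <= 0 -> 0 <= cha y q -> cha y p * chb y q = cha y q * chb y p ->
  ptau p q = Num.sqrt (csep2 y p q).
Proof.
move=> h p0 q0; rewrite csep2_cross //.
rewrite /cha /chb q0 (leNgt 0 p.2) p0 /= => a1 a2 e.
have yI : p.1 <= y <= q.1.
  by move: a1 a2; rewrite subr_le0 subr_ge0 -expR0 !ler_expR !subr_ge0 => -> ->.
apply: ptau_via => //.
rewrite /via /sep2 /dlow /dupp.
rewrite (min_r q0) (min_l (ltW p0)) (max_l q0) (max_r (ltW p0)) sub0r subr0.
case/andP: yI => y1 y2.
rewrite (_ : expR (y - p.1) + expR (q.1 - y) - 2 =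
   (expR (y - p.1) - 1) + (expR (q.1 - y) - 1)); last by ring.
rewrite -sqrt_mulD_eq ?mulr_ge0 ?expR_ge0 ?oppr_ge0 ?(ltW p0) //;
  try by rewrite subr_ge0 -expR0 ler_expR subr_ge0.
  congr (Num.sqrt _ + Num.sqrt _).
    by rewrite -[RHS]mulrA; congr (_ * _); rewrite mulrBr mulr1 -expRD; congr (expR _ - _); ring.
  by rewrite -[RHS]mulrA; congr (_ * _); rewrite mulrBr mulr1 -expRD; congr (expR _ - _); ring.
by move: e; lra.
Qed.

Lemma exists_chart p q : ple p q -> exists y,
  ptau p q = Num.sqrt (csep2 y p q) /\
  (p.2 < 0 -> 0 <= q.2 ->
   [/\ cha y p <= 0, 0 <= cha y q & cha y p * chb y q = cha y q * chb y p]).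
Proof.
move=> h; case: (boolP (same_side p q)) => [ss|ss].
  exists 0; split; first by rewrite (ptau_same 0 ss h).
  by case/same_sideP: ss => [[]|[]] *; lra.
case/andP: (h) => _ h2.
have [p0 q0] : p.2 < 0 /\ 0 <= q.2.
  by move/same_sideP: ss => ss; case: (ltP p.2 0) => p0; case: (leP 0 q.2) => q0 //;
    exfalso; apply: ss; lra.
have [y [yI e1 e2]] := exists_via_eq h.
have K : [/\ cha y p <= 0, 0 <= cha y q & cha y p * chb y q = cha y q * chb y p].
  case/andP: yI => y1 y2; rewrite /cha /chb q0 (leNgt 0 p.2) p0 /=; split.
  - by rewrite subr_le0 -expR0 ler_expR subr_ge0.
  - by rewrite subr_ge0 -expR0 ler_expR subr_ge0.
  - move: e2; rewrite /dlow /dupp (min_r q0) (min_l (ltW p0)) (max_l q0) (max_r (ltW p0)).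
    by lra.
by exists y; split => //; case: K => *; exact: ptau_cross.
Qed.

(** For null pairs one tangent plane suffices: if [p.1 = q.1], the one at this value gives 0; equal
    heights put both points on the same side, with a vanishing null increment. *)
Lemma ptau_gt0 p q : (0 < ptau p q) = plt p q.
Proof.
apply/idP/idP => h; last first.
  have [y [-> _]] := exists_chart (plt_ple h).
  by rewrite sqrtr_gt0 csep2_gt0.
have hle : ple p q by apply: contraLR h => /ptauN ->; rewrite ltxx.
case/andP: (hle) => h1 h2; rewrite /plt !lt_neqAle h1 h2 !andbT.
apply/andP; split; apply/eqP => e; move: h; rewrite ltNge => /negP; apply.
  have ev : via p.1 p q = Num.sqrt (sep2 p.1 p q).
    by rewrite /via /sep2 e !subrr !mulr0 sqrtr0 expR0 (_ : 1 + 1 - 2 = 0 :> R) ?mulr0 ?sqrtr0 ?addr0 //; lra.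
  by rewrite (ptau_via hle _ ev) ?lexx // -ev /via e !subrr !mulr0 sqrtr0 addr0.
rewrite (ptau_same 0) // /same_side ?e // /csep2 /chb e subrr.
by rewrite mulr0 sqrtr0.
Qed.

Lemma ptau_eq0 p q : ~~ plt p q -> ptau p q = 0.
Proof. by rewrite -ptau_gt0 lt_neqAle ptau_ge0 andbT negbK => /eqP <-. Qed.

Lemma ptauxx p : ptau p p = 0.
Proof. by rewrite ptau_eq0 // /plt ltxx. Qed.

(** The chart that is optimal for [p] and [q] is exact for the end points and overestimates both
    pieces, so the inequality of the Minkowski plane carries over. *)
Lemma ptau_triangle p m q : ple p m -> ple m q ->
  ptau p m + ptau m q <= ptau p q.
Proof.
move=> h1 h2; have h := ple_trans h1 h2.
have [y [-> _]] := exists_chart h.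
apply: le_trans (lerD (ptau_le y h1) (ptau_le y h2)) _.
case/andP: (h1) => h11 h12; case/andP: (h2) => h21 h22.
apply: le_trans (sqrt_mulD_le _ _ _ _) _; rewrite ?subr_ge0 ?cha_le ?chb_le //.
have e (a b c : R) : b - a + (c - b) = c - a by ring.
by rewrite !e.
Qed.

(* A null segment wastes a rectangle of positive area in the chart that is
   optimal for the end points. *)
Lemma ptau_lt_null p m n q : plt p q -> ple p m -> ple m n -> ple n q ->
  m <> n -> ptau p m + ptau n q < ptau p q.
Proof.
move=> h h1 h2 h3 mn.
have [y [-> _]] := exists_chart (plt_ple h).
apply: le_lt_trans (lerD (ptau_le y h1) (ptau_le y h3)) _.
case/andP: (h1) => h11 h12; case/andP: (h2) => h21 h22; case/andP: (h3) => h31 h32.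
apply: le_lt_trans (sqrt_mulD_le _ _ _ _) _; rewrite ?subr_ge0 ?cha_le ?chb_le //.
rewrite ltr_sqrt ?csep2_gt0 //.
have A0 : 0 < cha y q - cha y p by case/andP: (h) => ? ?; rewrite subr_gt0 cha_lt ?plt_ple.
have B0 : 0 < chb y q - chb y p by case/andP: (h) => ? ?; rewrite subr_gt0 chb_lt.
have a1 := cha_le y h1; have a2 := cha_le y h2; have a3 := cha_le y h3.
have b1 := chb_le y h12; have b2 := chb_le y h22; have b3 := chb_le y h32.
have : (cha y m < cha y n) || (chb y m < chb y n).
  apply/orP; case: (ltP m.1 n.1) => [e|e]; first by left; rewrite cha_lt.
  case: (ltP m.2 n.2) => [e'|e']; first by right; rewrite chb_lt.
  by exfalso; apply: mn; case: m n h21 h22 e e' {h1 h2 h3 h11 h12 h31 h32 a1 a2 a3 b1 b2 b3} => [? ?] [? ?] /= *; congr pair; apply/le_anti/andP.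
rewrite /csep2; move: A0 B0 a1 a2 a3 b1 b2 b3.
move: (cha y p) (cha y m) (cha y n) (cha y q) => a0 a1 a2 a3.
move: (chb y p) (chb y m) (chb y n) (chb y q) => b0 b1 b2 b3.
move=> A0 B0 h4 h5 h6 h7 h8 h9 /orP[] h10.
  apply: (@le_lt_trans _ _ ((a1 - a0 + (a3 - a2)) * (b3 - b0))).
    by rewrite ler_wpM2l //; lra.
  by rewrite ltr_pM2r //; lra.
apply: (@le_lt_trans _ _ ((a3 - a0) * (b1 - b0 + (b3 - b2)))).
  by rewrite ler_wpM2r //; lra.
by rewrite ltr_pM2l //; lra.
Qed.

End Charts.

(** * Comparison with flat triangles *)

Section FlatComparison.
Variable R : realType.
Implicit Types (p q m v : plane R) (y z : R).

(** Time reversal: it exchanges the half planes and takes the tangent plane at [y] to the one at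
    [- y]. *)
Definition prev p : plane R := (- p.1, - p.2).

Lemma ple_prev p q : ple (prev q) (prev p) = ple p q.
Proof. by rewrite /ple /= !lerN2. Qed.

Lemma plt_prev p q : plt (prev q) (prev p) = plt p q.
Proof. by rewrite /plt /= !ltrN2. Qed.

Lemma sep2_prev y p q : sep2 (- y) (prev q) (prev p) = sep2 y p q.
Proof.
rewrite /sep2 /dlow /dupp /= -[0]oppr0 -!oppr_max -!oppr_min oppr0 !opprK.
rewrite (addrC (- p.1)) (addrC (expR (- y + _))) (addrC (- y)).
by rewrite !(addrC (- Num.max _ _)) !(addrC (- Num.min _ _)) (addrC (_ * expR y)).
Qed.

Lemma ptau_prev p q : ptau (prev q) (prev p) = ptau p q.
Proof.
rewrite /ptau ple_prev; case: ifP => // _; congr inf.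
apply/seteqP; split => [_ [y _ <-]|_ [y _ <-]]; exists (- y) => //.
  by rewrite -{2}[y]opprK sep2_prev.
by rewrite sep2_prev.
Qed.

(** At most one term is nonzero, so this is the squared separation made symmetric, with value 0 for
    unrelated points. *)
Definition tsq p q : R := ptau p q ^+ 2 + ptau q p ^+ 2.

Lemma tsqC p q : tsq p q = tsq q p. Proof. exact: addrC. Qed.

Lemma tsq_prev p q : tsq (prev p) (prev q) = tsq p q.
Proof. by rewrite /tsq !ptau_prev addrC. Qed.

Lemma tsq_ge0 p q : 0 <= tsq p q.
Proof. by rewrite addr_ge0 ?sqr_ge0. Qed.

Lemma ptau_antisym p q : ple p q -> ptau q p = 0.
Proof.
move=> h; apply: ptau_eq0; apply: contraL h => /andP[h1 h2].
by rewrite /ple leNgt h1.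
Qed.

Lemma tsq_le p q : ple p q -> tsq p q = ptau p q ^+ 2.
Proof. by move=> h; rewrite /tsq (ptau_antisym h) expr0n addr0. Qed.

Definition pcomp p q := ple p q || ple q p.

Lemma tsq_le_csep2 y p v : pcomp p v -> tsq p v <= csep2 y p v.
Proof.
wlog h : p v / ple p v.
  move=> H /orP[h|h]; first by apply: H => //; rewrite /pcomp h.
  by rewrite tsqC csep2C; apply: H => //; rewrite /pcomp h.
move=> _; rewrite (tsq_le h) -[leRHS]sqr_sqrtr ?csep2_ge0 //.
by rewrite ler_pXn2r ?nnegrE ?ptau_ge0 ?sqrtr_ge0 ?ptau_le.
Qed.

(** Related points give equality. For unrelated points of one half plane the null increments have
    opposite signs, so the product is nonpositive. *)
Lemma csep2_le_tsq_same y m v : same_side m v -> csep2 y m v <= tsq m v.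
Proof.
move=> ss; case: (boolP (pcomp m v)) => [|h].
  wlog h : m v ss / ple m v.
    move=> H /orP[h|h]; first by apply: H => //; rewrite /pcomp h.
    by rewrite tsqC csep2C; apply: H; rewrite // 1?(same_sideC v m) // /pcomp h.
  by move=> _; rewrite (tsq_le h) (ptau_same y ss h) sqr_sqrtr ?csep2_ge0.
apply: (@le_trans _ _ 0); last exact: tsq_ge0.
case/norP: h; rewrite /ple !negb_and -!ltNge => h1 h2.
case/same_sideP: ss => [[p0 q0]|[p0 q0]]; rewrite ?(csep2_above _ p0 q0) ?(csep2_below _ p0 q0).
  case/orP: h1 => h1; case/orP: h2 => h2; try lra.
    by apply: mulr_le0_ge0; rewrite ?subr_ge0 ?subr_le0 ?ler_expR ltW.
  by apply: mulr_ge0_le0; rewrite ?subr_ge0 ?subr_le0 ?ler_expR ltW.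
case/orP: h1 => h1; case/orP: h2 => h2; try lra.
  by apply: mulr_le0_ge0; rewrite ?subr_ge0 ?subr_le0 ?ler_expR ?lerN2 ltW.
by apply: mulr_ge0_le0; rewrite ?subr_ge0 ?subr_le0 ?ler_expR ?lerN2 ltW.
Qed.

(** If [m.1 <= v.1], the points are related and the optimal chart gives equality. Otherwise the
    chart at [y = v.1] makes them spacelike: there [v] has first coordinate 0 and [m] a nonnegative
    one. *)
Lemma exists_csep2_le_tsq m v : m.2 < 0 -> 0 <= v.2 -> exists y, csep2 y m v <= tsq m v.
Proof.
move=> m0 v0; case: (leP m.1 v.1) => h.
  have hle : ple m v by rewrite /ple h ltW // (lt_le_trans m0).
  have [y [e _]] := exists_chart hle.
  by exists y; rewrite tsq_le // e sqr_sqrtr // csep2_ge0.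
exists v.1; apply: le_trans (tsq_ge0 _ _); apply: mulr_le0_ge0.
  rewrite /cha v0 (leNgt 0 m.2) m0 /= subrr expR0 subrr sub0r oppr_le0 subr_ge0.
  by rewrite -expR0 ler_expR subr_le0 ltW.
by rewrite subr_ge0 chb_le // ltW // (lt_le_trans m0).
Qed.

(** Additivity along the side leaves no room between the true separations and their overestimates in
    the optimal chart. So the reversed Schwarz inequality is an equality, and [m] lies on the chart
    segment. *)
Lemma side_point y p q m : plt p q -> ple p m -> ple m q ->
  ptau p q = Num.sqrt (csep2 y p q) -> ptau p m + ptau m q = ptau p q ->
  let lam := ptau p m / ptau p q in
  [/\ 0 <= lam <= 1, cha y m = (1 - lam) * cha y p + lam * cha y q &
      chb y m = (1 - lam) * chb y p + lam * chb y q].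
Proof.
move=> h h1 h2 e es lam.
have l0 : 0 < ptau p q by rewrite ptau_gt0.
have lI : 0 <= lam <= 1.
  rewrite /lam divr_ge0 ?ptau_ge0 //= ler_pdivrMr // mul1r -es lerDl ptau_ge0 //.
have A0 : 0 <= cha y m - cha y p by rewrite subr_ge0 cha_le.
have C0 : 0 <= cha y q - cha y m by rewrite subr_ge0 cha_le.
have B0 : 0 <= chb y m - chb y p by case/andP: h1 => ? ?; rewrite subr_ge0 chb_le.
have D0 : 0 <= chb y q - chb y m by case/andP: h2 => ? ?; rewrite subr_ge0 chb_le.
have S0 : 0 < cha y q - cha y p by case/andP: (h) => ? ?; rewrite subr_gt0 cha_lt ?plt_ple.
have T0 : 0 < chb y q - chb y p by case/andP: (h) => ? ?; rewrite subr_gt0 chb_lt.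
have t1 := ptau_le y h1; have t2 := ptau_le y h2.
have tri (a b c : R) : b - a + (c - b) = c - a by ring.
have E : (cha y m - cha y p) * (chb y q - chb y m) = (cha y q - cha y m) * (chb y m - chb y p).
  by apply: eq_sqrt_mulD => //; rewrite !tri -/(csep2 y p q) -e -es lerD.
have F := sqrt_mulD_eq A0 B0 C0 D0 E.
rewrite !tri -/(csep2 y p q) -/(csep2 y p m) -/(csep2 y m q) -e in F.
have t3 : ptau p m = Num.sqrt (csep2 y p m).
  by apply/eqP; rewrite eq_le t1 /=; move: F t1 t2 es; lra.
set mu := (cha y m - cha y p) / (cha y q - cha y p).
have m0 : 0 <= mu by rewrite divr_ge0 // ltW.
have ea : cha y m - cha y p = mu * (cha y q - cha y p) by rewrite divfK // gt_eqF.
have eb : chb y m - chb y p = mu * (chb y q - chb y p).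
  rewrite /mu mulrAC; apply/eqP; rewrite eq_sym; apply/eqP; apply: canLR (mulfK _) _; first by rewrite gt_eqF.
  by move: E; lra.
have lm : lam = mu.
  rewrite /lam t3 e /csep2 ea eb mulrACA -expr2 sqrtrM ?sqr_ge0 // sqrtr_sqr ger0_norm //.
  by rewrite mulfK // gt_eqF // -/(csep2 y p q) -e.
rewrite -lm in ea eb; move: lI ea eb; clear; clearbody lam.
move: (cha y p) (cha y q) (cha y m) (chb y p) (chb y q) (chb y m) => a b c d e f lI ea eb.
by split => //; lra.
Qed.

(** A change of tangent point is affine on each half plane, but by two different maps. Segments on
    one side therefore stay straight in all charts; crossing segments in general do not. *)
Lemma cha_below y z p : p.2 < 0 ->
  cha z p = 1 - expR (z - y) + expR (z - y) * cha y p.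
Proof.
move=> p0; rewrite /cha leNgt p0 /= mulrBr mulr1 -expRD.
by rewrite (_ : z - y + (y - p.1) = z - p.1); ring.
Qed.

Lemma chb_below y z p : p.2 < 0 -> chb z p = expR (y - z) * chb y p.
Proof.
move=> p0; rewrite /chb leNgt p0 /= mulrCA -expRD.
by rewrite (_ : y - z + - y = - z); ring.
Qed.

Lemma cha_above y z p : 0 <= p.2 -> cha z p = expR (y - z) * (cha y p + 1) - 1.
Proof.
by move=> p0; rewrite /cha p0 subrK -expRD (_ : y - z + (p.1 - y) = p.1 - z) //; ring.
Qed.

Lemma chb_above y z p : 0 <= p.2 -> chb z p = expR (z - y) * chb y p.
Proof.
move=> p0; rewrite /chb p0 mulrCA -expRD (_ : z - y + y = z) //; ring.
Qed.

Lemma stewart (lam a b ap bp aq bq av bv : R) :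
  a = (1 - lam) * ap + lam * aq -> b = (1 - lam) * bp + lam * bq ->
  (av - a) * (bv - b) = (1 - lam) * ((av - ap) * (bv - bp)) +
    lam * ((av - aq) * (bv - bq)) - lam * (1 - lam) * ((aq - ap) * (bq - bp)).
Proof. by move=> -> ->; ring. Qed.

(** Here [r = expR (z - y)], where the side is straight in the chart at [y] and the chart at [z] is
    chosen for [m] and [v]; the right side is [csep2 z m v]. The side meets the line at the origin,
    at parameter [nu], and [m] has parameter [mu] on the part before it. Stewart's formula in the
    chart at [y] bounds the value at the crossing point, the change of chart raises this value by
    [(r - 1) ^ 2 * bv >= 0], and Stewart's formula in the chart at [z] carries it back to [m]. *)
Lemma crossing_ineq (r k lam ap bp aq bq av bv Tp Tq : R) : 0 < r -> r * k = 1 ->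
  0 <= lam -> ap <= 0 -> 0 <= aq -> ap * bq = aq * bp -> bp < 0 -> 0 <= bq -> 0 <= bv ->
  bp + lam * (bq - bp) < 0 ->
  Tp <= (av - ap) * (bv - bp) ->
  Tp <= (k * (av + 1) - 1 - (1 - r + r * ap)) * (r * bv - k * bp) ->
  Tq <= (av - aq) * (bv - bq) ->
  (1 - lam) * Tp + lam * Tq - lam * (1 - lam) * ((aq - ap) * (bq - bp)) <=
  (k * (av + 1) - 1 - (1 - r + r * ((1 - lam) * ap + lam * aq))) *
  (r * bv - k * ((1 - lam) * bp + lam * bq)).
Proof.
move=> r0 rk l0 ap0 aq0 col bp0 bq0 bv0 bm h1 h2 h3.
have d0 : 0 < bq - bp by lra.
have [nu [nu0 nud nu1]] : exists nu, [/\ 0 < nu, nu * (bq - bp) = - bp & nu <= 1].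
  exists (- bp / (bq - bp)); split; first by rewrite divr_gt0 // oppr_gt0.
    by rewrite divfK // gt_eqF.
  by rewrite ler_pdivrMr // mul1r; lra.
have [mu [mu0 lE mu1]] : exists mu, [/\ 0 <= mu, lam = mu * nu & mu < 1].
  exists (lam / nu); split; first by rewrite divr_ge0 // ltW.
    by rewrite divfK // gt_eqF.
  by rewrite ltr_pdivrMr // mul1r -(ltr_pM2r d0) nud; lra.
have oa : (1 - nu) * ap + nu * aq = 0.
  suff /eqP : ((1 - nu) * ap + nu * aq) * (bq - bp) = 0.
    by rewrite mulf_eq0 (gt_eqF d0) orbF => /eqP.
  transitivity (ap * (bq - bp) + (aq - ap) * (nu * (bq - bp))); first by ring.
  by rewrite nud; lra.
have ob : (1 - nu) * bp + nu * bq = 0 by move: nud; lra.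
have S0 := @stewart nu 0 0 ap bp aq bq av bv (esym oa) (esym ob).
have ea : (1 - lam) * ap + lam * aq = (1 - mu) * ap.
  by transitivity ((1 - mu) * ap + mu * ((1 - nu) * ap + nu * aq)); [rewrite lE; ring|rewrite oa; ring].
have eb : (1 - lam) * bp + lam * bq = (1 - mu) * bp.
  by transitivity ((1 - mu) * bp + mu * ((1 - nu) * bp + nu * bq)); [rewrite lE; ring|rewrite ob; ring].
rewrite ea eb.
(* Stewart's formula between [p] and the crossing point, whose coordinates in the chart at [z] are
   [(1 - r, 0)]. *)
have S1 : (k * (av + 1) - 1 - (1 - r + r * ((1 - mu) * ap))) * (r * bv - k * ((1 - mu) * bp))
  = (1 - mu) * ((k * (av + 1) - 1 - (1 - r + r * ap)) * (r * bv - k * bp))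
   + mu * ((r * k * (av + 1) - 2 * r + r ^+ 2) * bv) - mu * (1 - mu) * (r * k * (ap * bp)) by ring.
rewrite S1 rk !mul1r.
have S2 : av * bv <= (av + 1 - 2 * r + r ^+ 2) * bv.
  rewrite ler_wpM2r //; have := sqr_ge0 (r - 1); lra.
have app : ap * bp = nu ^+ 2 * ((aq - ap) * (bq - bp)).
  have -> : ap = - (nu * (aq - ap)) by move: oa; lra.
  have -> : bp = - (nu * (bq - bp)) by move: ob; lra.
  rewrite (_ : aq - - (nu * (aq - ap)) = aq - ap); last by move: oa; lra.
  rewrite (_ : bq - - (nu * (bq - bp)) = bq - bp); last by move: ob; lra.
  ring.
rewrite app.
rewrite !subr0 in S0.
have S3 : (1 - nu) * Tp + nu * Tq - nu * (1 - nu) * ((aq - ap) * (bq - bp)) <= av * bv.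
  rewrite S0 lerD2r lerD // ler_wpM2l //; lra.
have S4 : (1 - mu) * Tp <= (1 - mu) * ((k * (av + 1) - 1 - (1 - r + r * ap)) * (r * bv - k * bp)).
  by rewrite ler_wpM2l //; lra.
have S5 : mu * ((1 - nu) * Tp + nu * Tq - nu * (1 - nu) * ((aq - ap) * (bq - bp))) <=
  mu * ((av + 1 - 2 * r + r ^+ 2) * bv).
  by rewrite ler_wpM2l // (le_trans S3).
rewrite lE; apply: le_trans (lerD (lerD S4 S5) (lexx _)).
by rewrite le_eqVlt; apply/orP; left; apply/eqP; ring.
Qed.

End FlatComparison.

Section SideComparison.
Variable R : realType.
Implicit Types (p q m v : plane R) (y z : R).

(** If [m] and [v] are on one side, the chart of the side of the triangle is good enough. Otherwise
    a chart [z] adapted to [m] and [v] is used: it is affine along a side that stays below the line,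
    and [crossing_ineq] treats a side that crosses. *)
Lemma tsq_side_le_half lam p q m v : plt p q -> ple p m -> ple m q ->
  ptau p m + ptau m q = ptau p q -> pcomp p v -> pcomp q v ->
  same_side m v || (m.2 < 0) && (0 <= v.2) ->
  ptau p m = lam * ptau p q ->
  (1 - lam) * tsq p v + lam * tsq q v - lam * (1 - lam) * ptau p q ^+ 2 <= tsq m v.
Proof.
move=> h h1 h2 es cp cq side lamE.
have {lamE}-> : lam = ptau p m / ptau p q by rewrite lamE mulfK // gt_eqF // ptau_gt0.
set lam' := _ / _.
have [y [e col]] := exists_chart (plt_ple h).
have [/andP[l0 l1] ea eb] := side_point h h1 h2 e es.
rewrite -/lam' in l0 l1 ea eb.
have l2 : ptau p q ^+ 2 = csep2 y p q by rewrite e sqr_sqrtr // csep2_ge0 // plt_ple.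
have L0 : 0 <= 1 - lam' by rewrite subr_ge0.
case: (boolP (same_side m v)) side => [ss _|_ /andP[m0 v0]].
  apply: le_trans (csep2_le_tsq_same y ss).
  rewrite /csep2 (stewart _ _ ea eb) l2 lerD2r.
  by apply: lerD; apply: ler_wpM2l => //; exact: tsq_le_csep2.
have [z hz] := exists_csep2_le_tsq m0 v0.
apply: le_trans hz; clearbody lam'.
have p0 : p.2 < 0 by case/andP: h1 => _ k; exact: le_lt_trans k m0.
case: (ltP q.2 0) => q0.
  have l2z : ptau p q ^+ 2 = csep2 z p q.
    by rewrite l2; apply: csep2_same; apply/same_sideP; right.
  rewrite l2z /csep2.
  have ea' : cha z m = (1 - lam') * cha z p + lam' * cha z q.
    by rewrite !(cha_below y z) // ea; ring.
  have eb' : chb z m = (1 - lam') * chb z p + lam' * chb z q.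
    by rewrite !(chb_below y z) // eb; ring.
  rewrite (stewart _ _ ea' eb') lerD2r.
  by apply: lerD; apply: ler_wpM2l => //; exact: tsq_le_csep2.
have [ca cb cc] := col p0 q0.
rewrite l2 /csep2 (cha_below y z m0) (chb_below y z m0) ea eb.
rewrite (cha_above y z v0) (chb_above y z v0).
apply: crossing_ineq => //.
- exact: expR_gt0.
- by rewrite -expRD (_ : z - y + (y - z) = 0) ?expR0 //; ring.
- by rewrite /chb leNgt p0 /= nmulr_rlt0 ?expR_gt0.
- by rewrite /chb q0 mulr_ge0 ?expR_ge0.
- by rewrite /chb v0 mulr_ge0 ?expR_ge0.
- have : chb y m < 0 by rewrite /chb leNgt m0 /= nmulr_rlt0 ?expR_gt0.
  by rewrite eb; lra.
- exact: tsq_le_csep2.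
- rewrite -(cha_below y z p0) -(cha_above y z v0) -(chb_below y z p0) -(chb_above y z v0).
  exact: tsq_le_csep2.
- exact: tsq_le_csep2.
Qed.

(* This is curvature bounded above by 0: [tsq] along a side is at least the
   value in the flat comparison triangle given by Stewart's formula. *)
Lemma tsq_side_le lam p q m v : plt p q -> ple p m -> ple m q ->
  ptau p m + ptau m q = ptau p q -> pcomp p v -> pcomp q v ->
  ptau p m = lam * ptau p q ->
  (1 - lam) * tsq p v + lam * tsq q v - lam * (1 - lam) * ptau p q ^+ 2 <= tsq m v.
Proof.
move=> h h1 h2 es cp cq lamE.
case: (boolP (same_side m v || (m.2 < 0) && (0 <= v.2))) => [|/norP[ss cr]].
  by move=> k; exact: tsq_side_le_half.
have [m0 v0] : 0 <= m.2 /\ v.2 < 0.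
  move/same_sideP: ss => ss; move: cr; case: (ltP m.2 0) => m0 /=; case: (leP 0 v.2) => v0 //= _.
  - by case: ss; right.
  - by case: ss; left.
(* With [m] above and [v] below, time reversal leads back to the case treated. If [m] is on the
   line, the reversed points are on the same side. *)
have := @tsq_side_le_half (1 - lam) (prev q) (prev p) (prev m) (prev v).
rewrite plt_prev !ple_prev !tsq_prev !ptau_prev /pcomp !ple_prev.
rewrite addrC (orbC (ple v q)) (orbC (ple v p)).
move=> /(_ h h2 h1 es cq cp).
have -> : same_side (prev m) (prev v) || ((prev m).2 < 0) && (0 <= (prev v).2).
  rewrite /same_side /= oppr_lt0 !oppr_ge0 (ltW v0) /= andbT.
  by case: (ltgtP 0 m.2) m0 => // <-; rewrite ?lexx.
move=> /(_ isT) H.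
have /H : ptau m q = (1 - lam) * ptau p q by rewrite mulrBl mul1r -lamE -es addrAC subrr add0r.
apply: le_trans; rewrite le_eqVlt; apply/orP; left; apply/eqP; ring.
Qed.

End SideComparison.

(** * Continuity of the time separation *)

Section SeparationContinuity.
Variable R : realType.
Implicit Types (p q m v : plane R) (z : plane R * plane R).

Lemma ct_plane1 p : continuous_at p (fun p : plane R => p.1).
Proof. exact: (@cvg_fst _ _ (nbhs p.1) (nbhs p.2)). Qed.

Lemma ct_plane2 p : continuous_at p (fun p : plane R => p.2).
Proof. exact: (@cvg_snd _ _ (nbhs p.1) (nbhs p.2)). Qed.

Lemma ct_pair11 z : continuous_at z (fun z => z.1.1).
Proof. by apply: (@continuous_comp _ _ _ fst (fun p : plane R => p.1)); [exact: cvg_fst|exact: ct_plane1]. Qed.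

Lemma ct_pair12 z : continuous_at z (fun z => z.1.2).
Proof. by apply: (@continuous_comp _ _ _ fst (fun p : plane R => p.2)); [exact: cvg_fst|exact: ct_plane2]. Qed.

Lemma ct_pair21 z : continuous_at z (fun z => z.2.1).
Proof. by apply: (@continuous_comp _ _ _ snd (fun p : plane R => p.1)); [exact: cvg_snd|exact: ct_plane1]. Qed.

Lemma ct_pair22 z : continuous_at z (fun z => z.2.2).
Proof. by apply: (@continuous_comp _ _ _ snd (fun p : plane R => p.2)); [exact: cvg_snd|exact: ct_plane2]. Qed.

Lemma near_lt (T : topologicalType) (x : T) (f g : T -> R) :
  continuous_at x f -> continuous_at x g -> f x < g x -> \forall t \near x, f t < g t.
Proof.
move=> cf cg fg; have c : continuous_at x (fun t => g t + - f t) by apply: ctD => //; exact: ctN.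
have : \forall t \near x, 0 < g t + - f t.
  by apply: (cvgr_gt _ c); rewrite subr_gt0.
by apply: filterS => t; rewrite subr_gt0.
Qed.

Lemma near_plt z : plt z.1 z.2 -> \forall w \near z, plt w.1 w.2.
Proof.
move=> /andP[h1 h2].
have H1 := near_lt (@ct_pair11 z) (@ct_pair21 z) h1.
have H2 := near_lt (@ct_pair12 z) (@ct_pair22 z) h2.
by near=> w; apply/andP; split; near: w.
Unshelve. all: end_near. Qed.

Lemma near_Nple z : ~~ ple z.1 z.2 -> \forall w \near z, ~~ ple w.1 w.2.
Proof.
rewrite /ple negb_and -!ltNge => /orP[] h.
  apply: filterS (near_lt (@ct_pair21 z) (@ct_pair11 z) h) => w h'.
  by rewrite negb_and -!ltNge h'.
apply: filterS (near_lt (@ct_pair22 z) (@ct_pair12 z) h) => w h'.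
by rewrite negb_and -!ltNge h' orbT.
Qed.

Lemma ct_dlow z : continuous_at z (fun z => dlow z.1 z.2).
Proof.
have c2 := @ct_pair12 z; have c4 := @ct_pair22 z.
by rewrite /dlow; ct_real.
Qed.

Lemma ct_dupp z : continuous_at z (fun z => dupp z.1 z.2).
Proof.
have c2 := @ct_pair12 z; have c4 := @ct_pair22 z.
by rewrite /dupp; ct_real.
Qed.

Lemma exists_optimal p q : ple p q -> exists y,
  [/\ p.1 <= y <= q.1, ptau p q = via y p q & ptau p q = Num.sqrt (sep2 y p q)].
Proof.
move=> h; have [y [yI e _]] := exists_via_eq h.
by exists y; rewrite e; split => //; exact: ptau_via.
Qed.

(** The tangent plane that is optimal at [z] still bounds the separation of nearby pairs, and being
    unrelated is an open condition. *)
Lemma ptau_usc z e : 0 < e -> \forall w \near z, ptau w.1 w.2 < ptau z.1 z.2 + e.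
Proof.
move=> e0; case: (boolP (ple z.1 z.2)) => h; last first.
  rewrite (ptauN h); apply: filterS (near_Nple h) => w /ptauN ->.
  by rewrite add0r.
have [y [_ _ ez]] := exists_optimal h.
have c1 := @ct_pair11 z; have c2 := @ct_pair21 z.
have c3 := @ct_dlow z; have c4 := @ct_dupp z.
have cs : continuous_at z (fun z => Num.sqrt (sep2 y z.1 z.2)).
  by rewrite /sep2; ct_real.
have : \forall w \near z, Num.sqrt (sep2 y w.1 w.2) < ptau z.1 z.2 + e.
  by apply: (cvgr_lt _ cs); rewrite -ez ltrDl.
apply: filterS => w hw; case: (boolP (ple w.1 w.2)) => h'.
  exact: le_lt_trans (ptau_le_sep2 y h') hw.
by rewrite ptauN // (le_lt_trans _ hw) // sqrtr_ge0.
Qed.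

(** A fixed crossing point could leave [[w.1.1, w.2.1]] when the end points move, so it is moved
    with them at the constant ratio [th]. *)
Lemma ptau_lsc z a : a < ptau z.1 z.2 -> \forall w \near z, a < ptau w.1 w.2.
Proof.
move=> az; case: (ltP a 0) => a0.
  by near=> w; exact: lt_le_trans a0 (ptau_ge0 _ _).
have h : plt z.1 z.2 by rewrite -ptau_gt0 (le_lt_trans a0 az).
have [y [/andP[y1 y2] ez _]] := exists_optimal (plt_ple h).
case/andP: (h) => h1 _.
pose th := (y - z.1.1) / (z.2.1 - z.1.1).
have d0 : 0 < z.2.1 - z.1.1 by rewrite subr_gt0.
have th0 : 0 <= th by rewrite divr_ge0 ?subr_ge0 // ltW.
have th1 : th <= 1 by rewrite ler_pdivrMr // mul1r lerD2r.
have yE : y = z.1.1 + th * (z.2.1 - z.1.1).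
  by rewrite /th divfK ?gt_eqF // addrC subrK.
have c1 := @ct_pair11 z; have c2 := @ct_pair21 z.
have c3 := @ct_dlow z; have c4 := @ct_dupp z.
clearbody th.
pose f (w : plane R * plane R) := via (w.1.1 + th * (w.2.1 - w.1.1)) w.1 w.2.
have cf : continuous_at z f by rewrite /f /via; ct_real.
have H : \forall w \near z, a < f w by apply: (cvgr_gt _ cf); rewrite /f -yE -ez.
apply: filterS2 H (near_plt h) => w hw pw; apply: lt_le_trans hw _.
case/andP: (pw) => w1 _.
apply: via_le_ptau; first exact: plt_ple.
apply/andP; split; first by rewrite lerDl mulr_ge0 // subr_ge0 ltW.
rewrite -lerBrDl -[leRHS]mul1r ler_wpM2r // subr_ge0 ltW //.
Unshelve. all: end_near. Qed.

Lemma ct_ptau z : continuous_at z (fun z => ptau z.1 z.2).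
Proof.
apply/cvgrPdist_lt => e e0.
have H1 := @ptau_usc z _ e0.
have H2 : \forall w \near z, ptau z.1 z.2 - e < ptau w.1 w.2.
  by apply: ptau_lsc; rewrite ltrBlDr ltrDl.
apply: filterS2 H1 H2 => w w1 w2.
by rewrite ltr_norml; apply/andP; split; lra.
Qed.

Lemma ptau_continuous : continuous (fun z : plane R * plane R => ptau z.1 z.2).
Proof. exact: ct_ptau. Qed.

Lemma ptau_lsc_on (A : set (plane R)) : lower_semicontinuous
  ((fun z => (ptau z.1 z.2)%:E) : subspace (A `*` A) -> \bar R).
Proof.
apply/lower_semicontinuousP => a; apply: open_subspaceW.
rewrite openE => z /=; rewrite lte_fin => /ptau_lsc.
by apply: filterS => w /=; rewrite lte_fin.
Qed.

Lemma ptau_pre_length_on (A : set (plane R)) :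
  pre_length_on A (fun p q => plt p q) (fun p q => ple p q)
    (fun p q => (ptau p q)%:E).
Proof.
split.
- by move=> p _; exact: ple_refl.
- by move=> p m q _ _ _; exact: ple_trans.
- by move=> p m q _ _ _; exact: plt_trans.
- by move=> p q _ _; exact: plt_ple.
- by move=> p q _ _; rewrite lee_fin ptau_ge0.
- exact: ptau_lsc_on.
- by move=> p m q _ _ _ h1 h2; rewrite -EFinD lee_fin ptau_triangle.
- by move=> p q _ _ /negP h; rewrite ptauN.
- by move=> p q _ _; rewrite lte_fin ptau_gt0.
Qed.

Definition glued : lorentzPreLengthSpace R :=
  LorentzPreLengthSpace (ptau_pre_length_on setT).

End SeparationContinuity.

(** * Maximizing curves *)

Section Segments.
Variable R : realType.
Implicit Types (p q m n : plane R) (y a b lam s t : R).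

Definition unchart y a b : plane R :=
  if 0 <= b then (y + ln (1 + a), b * expR (- y)) else (y - ln (1 - a), b * expR y).

Lemma unchart_chart y p : unchart y (cha y p) (chb y p) = p.
Proof.
case: p => x v; rewrite /unchart /cha /chb /=; case: (leP 0 v) => v0.
  rewrite mulr_ge0 ?expR_ge0 // -mulrA -expRD subrr expR0 mulr1.
  rewrite (_ : 1 + (expR (x - y) - 1) = expR (x - y)); last by ring.
  by rewrite expRK; congr pair; ring.
rewrite leNgt nmulr_rlt0 ?expR_gt0 // /= -mulrA -expRD addNr expR0 mulr1.
rewrite (_ : 1 - (1 - expR (y - x)) = expR (y - x)); last by ring.
by rewrite expRK; congr pair; ring.
Qed.

Lemma unchart2 y a b : (0 <= (unchart y a b).2) = (0 <= b).
Proof.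
rewrite /unchart; case: (leP 0 b) => b0 /=; first by rewrite mulr_ge0 ?expR_ge0.
by rewrite leNgt nmulr_rlt0 ?expR_gt0.
Qed.

Lemma cha_unchart y a b : (0 <= b -> -1 < a) -> (b < 0 -> a < 1) ->
  cha y (unchart y a b) = a.
Proof.
move=> h1 h2; rewrite /cha unchart2 /unchart; case: (leP 0 b) => b0 /=.
  rewrite (_ : y + _ - y = ln (1 + a)); last by ring.
  by rewrite lnK ?posrE; have := h1 b0; lra.
rewrite (_ : y - _ = ln (1 - a)); last by ring.
by rewrite lnK ?posrE; have := h2 b0; lra.
Qed.

Lemma chb_unchart y a b : chb y (unchart y a b) = b.
Proof.
rewrite /chb unchart2 /unchart; case: (leP 0 b) => b0 /=.
  by rewrite -mulrA -expRD addNr expR0 mulr1.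
by rewrite -mulrA -expRD subrr expR0 mulr1.
Qed.

(** A chart enlarges the order across the line: both coordinates may increase although [n.1 < m.1].
    The signs at the origin exclude this, since they give [m.1 <= y <= n.1]. *)
Lemma chart_plt y m n : cha y m < cha y n -> chb y m < chb y n ->
  (m.2 < 0 -> 0 <= n.2 -> cha y m <= 0 /\ 0 <= cha y n) -> plt m n.
Proof.
rewrite /cha /chb /plt; case: (leP 0 m.2) => m0; case: (leP 0 n.2) => n0.
- by rewrite ltrD2r ltr_expR ltrD2r ltr_pM2r ?expR_gt0 // => -> ->.
- move=> _ h _; exfalso; move: h; rewrite ltNge; apply/negP/negPn.
  by rewrite (@le_trans _ _ 0) ?mulr_ge0 ?expR_ge0 // ltW // nmulr_rlt0 ?expR_gt0.
- rewrite !subr_le0 subr_ge0 -expR0 !ler_expR !subr_ge0 => h _ /(_ isT isT)[h1 h2].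
  rewrite (lt_le_trans m0 n0) andbT lt_neqAle (le_trans h1 h2) andbT.
  apply: contraL h => /eqP e; rewrite -leNgt.
  have -> : y = m.1 by apply/le_anti; rewrite h1 e h2.
  by rewrite e !subrr.
- by rewrite ltrD2l ltrN2 ltr_expR ltrD2l ltrN2 ltr_pM2r ?expR_gt0 // => -> ->.
Qed.

Lemma expR_dist_le a b : b - a <= expR (- a) * (expR b - expR a).
Proof.
rewrite mulrBr -!expRD addNr expR0 addrC; have := expR_ge1Dx (b - a).
by rewrite addrC; lra.
Qed.

(** The two exponentials bound the inverse slope of [cha y] between [m] and [n], above and below the
    line respectively. For a crossing pair it is enough that their sum is at least 1. *)
Lemma chart_dist1 y m n : ple m n ->
  n.1 - m.1 <= (expR (y - m.1) + expR (n.1 - y)) * (cha y n - cha y m).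
Proof.
move=> h; have c := cha_le y h; case/andP: (h) => h1 h2.
have e1 := expR_ge0 (y - m.1); have e2 := expR_ge0 (n.1 - y).
have D0 : 0 <= cha y n - cha y m by rewrite subr_ge0.
rewrite mulrDl; move: D0; rewrite /cha; case: (leP 0 m.2) => m0.
  rewrite (le_trans m0 h2) => D0.
  apply: ler_wpDr; first by rewrite mulr_ge0.
  have := expR_dist_le (m.1 - y) (n.1 - y); rewrite opprB; lra.
case: (leP 0 n.2) => n0 D0; last first.
  apply: ler_wpDl; first by rewrite mulr_ge0.
  have := expR_dist_le (y - n.1) (y - m.1); rewrite opprB; lra.
have k1 := expR_ge1Dx (y - m.1); have k2 := expR_ge1Dx (n.1 - y).
apply: (@le_trans _ _ (expR (n.1 - y) - 1 - (1 - expR (y - m.1)))); first by lra.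
rewrite -mulrDl -[leLHS]mul1r ler_wpM2r //.
by case: (leP 0 (y - m.1)) => k; move: k1 k2; lra.
Qed.

Lemma chart_dist2 y m n : m.2 <= n.2 ->
  n.2 - m.2 <= (expR (- y) + expR y) * (chb y n - chb y m).
Proof.
move=> h; have c := chb_le y h.
have D0 : 0 <= chb y n - chb y m by rewrite subr_ge0.
have e1 := expR_ge0 y; have e2 := expR_ge0 (- y).
have K : expR (- y) * expR y = 1 by rewrite -expRD addNr expR0.
rewrite mulrDl; move: D0; rewrite /chb; case: (leP 0 m.2) => m0.
  rewrite (le_trans m0 h) => D0; apply: ler_wpDr; first by rewrite mulr_ge0.
  by rewrite -mulrBl mulrCA K mulr1.
case: (leP 0 n.2) => n0 D0; last first.
  apply: ler_wpDl; first by rewrite mulr_ge0.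
  by rewrite -mulrBl mulrCA (mulrC (expR y)) K mulr1.
rewrite -opprB !mulrBr !mulrA.
have h3 : 0 <= n.2 * expR y by rewrite mulr_ge0.
have h4 : 0 <= - (m.2 * expR (- y)) by rewrite oppr_ge0 nmulr_rle0.
have h5 : 0 <= expR y * expR y * n.2 by rewrite !mulr_ge0.
have h6 : 0 <= expR (- y) * expR (- y) * (- m.2) by rewrite !mulr_ge0 // oppr_ge0 ltW.
move: K h5 h6; move: (expR y) (expR (- y)) => k k' K h5 h6.
have e3 : k' * n.2 * k = n.2 by rewrite mulrAC K mul1r.
have e4 : k * m.2 * k' = m.2 by rewrite mulrAC (mulrC k) K mul1r.
by move: e3 e4 h5 h6; lra.
Qed.

Lemma pdist_ple m n : ple m n -> pdist m n <= (n.1 - m.1) + (n.2 - m.2).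
Proof.
case/andP => h1 h2; rewrite /pdist ge_max (distrC m.1) (distrC m.2) !ger0_norm ?subr_ge0 //.
by rewrite lerDl lerDr !subr_ge0 h1 h2.
Qed.

(** The curve is straight in the optimal chart. If it crosses the line, it does so at the origin, so
    any two of its points on opposite sides are again collinear with the origin and have the same
    optimal chart. Hence the separations along it are exact. *)
Lemma exists_timelike_segment p q : plt p q -> exists (g : R -> plane R) (K : R),
  [/\ g 0 = p, g 1 = q & forall s t, 0 <= s -> s < t -> t <= 1 ->
    [/\ plt (g s) (g t), ptau (g s) (g t) = ptau p q * (t - s) &
        pdist (g s) (g t) <= K * (t - s)]].
Proof.
move=> h; have [y [e col]] := exists_chart (plt_ple h).
case/andP: (h) => h1 h2.
have A0 : 0 < cha y q - cha y p by rewrite subr_gt0 cha_lt ?plt_ple.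
have B0 : 0 < chb y q - chb y p by rewrite subr_gt0 chb_lt.
pose A s := (1 - s) * cha y p + s * cha y q.
pose B s := (1 - s) * chb y p + s * chb y q.
pose g s := unchart y (A s) (B s).
have dA' u v : A v - A u = (v - u) * (cha y q - cha y p) by rewrite /A; ring.
have dB' u v : B v - B u = (v - u) * (chb y q - chb y p) by rewrite /B; ring.
have Aup m : 0 <= m.2 -> -1 < cha y m.
  by move=> m0; rewrite /cha m0 ltrBrDr addNr expR_gt0.
have Alow m : m.2 < 0 -> cha y m < 1.
  by move=> m0; rewrite /cha leNgt m0 /= ltrBlDr ltrDl expR_gt0.
have Bup m : (0 <= chb y m) = (0 <= m.2) by rewrite -{2}(unchart_chart y m) unchart2.
have ABcross s : p.2 < 0 -> 0 <= q.2 ->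
    A s * (chb y q - chb y p) = B s * (cha y q - cha y p).
  by move=> p0 q0; have [_ _] := col p0 q0; rewrite /A /B; lra.
have sgnA s : p.2 < 0 -> 0 <= q.2 -> (0 <= A s) = (0 <= B s).
  by move=> p0 q0; rewrite -(pmulr_lge0 (A s) B0) ABcross // pmulr_lge0.
(* The segment stays where [unchart] inverts the chart: by convexity if it does not cross, by the
   agreement of signs if it does. *)
have bd s : 0 <= s -> s <= 1 -> (0 <= B s -> -1 < A s) /\ (B s < 0 -> A s < 1).
  move=> s0 s1; have s1' : 0 <= 1 - s by rewrite subr_ge0.
  have conv (u v w : R) : u < v -> u < w -> u < (1 - s) * v + s * w.
    move=> uv uw; case: (ltP 0 s) => [s0'|s0'].
      have := ltr_pM2l s0' u w; rewrite uw => k1.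
      have k2 : (1 - s) * u <= (1 - s) * v by rewrite ler_wpM2l // ltW.
      by move: k1 k2; lra.
    have -> : s = 0 by apply/le_anti/andP. by lra.
  have conv' (u v w : R) : v < u -> w < u -> (1 - s) * v + s * w < u.
    by move=> vu wu; have := conv (- u) (- v) (- w); rewrite !ltrN2 => /(_ vu wu); lra.
  case: (leP 0 p.2) => p0.
    have q0 : 0 <= q.2 by rewrite (le_trans p0) // ltW.
    split => [_|]; first by apply: conv; exact: Aup.
    by rewrite ltNge addr_ge0 // mulr_ge0 // Bup.
  case: (leP 0 q.2) => q0; last first.
    split => [|_]; last by apply: conv'; exact: Alow.
    have : B s < 0 by apply: conv'; rewrite ltNge Bup -ltNge.
    by rewrite ltNge => /negbTE ->.
  split => [|]; first by rewrite -sgnA //; lra.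
  by rewrite ltNge -sgnA // -ltNge; lra.
have gA s : 0 <= s -> s <= 1 -> cha y (g s) = A s.
  by move=> s0 s1; have [k1 k2] := bd s s0 s1; exact: cha_unchart.
have gB s : chb y (g s) = B s by exact: chb_unchart.
have gcross s t : 0 <= s -> s < t -> t <= 1 -> (g s).2 < 0 -> 0 <= (g t).2 ->
    [/\ A s <= 0, 0 <= A t & A s * B t = A t * B s].
  move=> s0 st t1; rewrite (ltNge (g s).2) !unchart2 -ltNge => Bs Bt.
  have [p0 q0] : p.2 < 0 /\ 0 <= q.2.
    rewrite -Bup ltNge -Bup -ltNge.
    have k1 : B 0 = chb y p by rewrite /B; ring.
    have k2 : B 1 = chb y q by rewrite /B; ring.
    have k3 u v : u <= v -> B u <= B v.
      by move=> uv; rewrite -subr_ge0 dB' mulr_ge0 ?subr_ge0 // ltW // -subr_gt0.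
    by rewrite -k1 -k2 (le_lt_trans (k3 _ _ s0) Bs) (le_trans Bt (k3 _ _ t1)).
  split; last 1 first.
    apply: (mulIf (lt0r_neq0 B0)); rewrite mulrAC ABcross // -[RHS]mulrAC ABcross //; ring.
  - by rewrite leNgt; apply/negP => /ltW; rewrite sgnA // leNgt Bs.
  - by rewrite sgnA.
pose K := (expR (y - p.1) + expR (q.1 - y)) * (cha y q - cha y p) +
   (expR (- y) + expR y) * (chb y q - chb y p).
have g0 : g 0 = p.
  by rewrite /g /A /B subr0 !mul1r !mul0r !addr0 unchart_chart.
have g1 : g 1 = q.
  by rewrite /g /A /B subrr !mul1r !mul0r !add0r unchart_chart.
have gplt s t : 0 <= s -> s < t -> t <= 1 -> plt (g s) (g t).
  move=> s0 st t1; have s1 : s <= 1 by lra. have t0 : 0 <= t by lra.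
  apply: (@chart_plt y); rewrite ?gA ?gB //.
  - by rewrite -subr_gt0 dA' mulr_gt0 // subr_gt0.
  - by rewrite -subr_gt0 dB' mulr_gt0 // subr_gt0.
  - by move=> m0 n0; have [] := gcross s t s0 st t1 m0 n0.
have gple s t : 0 <= s -> s <= t -> t <= 1 -> ple (g s) (g t).
  move=> s0; rewrite le_eqVlt => /orP[/eqP -> _|st t1]; first exact: ple_refl.
  by apply: plt_ple; exact: gplt.
exists g, K; split => // s t s0 st t1.
have s1 : s <= 1 by lra. have t0 : 0 <= t by lra.
have dA : cha y (g t) - cha y (g s) = (t - s) * (cha y q - cha y p).
  by rewrite !gA.
have dB : chb y (g t) - chb y (g s) = (t - s) * (chb y q - chb y p).
  by rewrite !gB.
have ts : 0 <= t - s by lra.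
split; first exact: gplt.
  transitivity (Num.sqrt (csep2 y (g s) (g t))); last first.
    rewrite /csep2 dA dB mulrACA -expr2 sqrtrM ?sqr_ge0 // sqrtr_sqr ger0_norm //.
    by rewrite mulrC e.
  have hst := plt_ple (gplt s t s0 st t1).
  case: (boolP (same_side (g s) (g t))) => [ss|ss]; first exact: ptau_same.
  have [m0 n0] : (g s).2 < 0 /\ 0 <= (g t).2.
    case/andP: hst => _ k; move/same_sideP: ss => ss.
    by case: (ltP (g s).2 0) => m0; case: (leP 0 (g t).2) => n0 //; exfalso; apply: ss; lra.
  have [k1 k2 k3] := gcross s t s0 st t1 m0 n0.
  by apply: ptau_cross; rewrite ?gA ?gB.
have hst := plt_ple (gplt s t s0 st t1).
apply: le_trans (pdist_ple hst) _.
rewrite /K mulrDl; case/andP: (hst) => k1 k2; apply: lerD.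
  apply: le_trans (chart_dist1 y hst) _; rewrite dA -mulrA (mulrC (t - s)).
  apply: ler_wpM2r; first by rewrite mulr_ge0 // ltW.
  have /andP[k3 _] : ple (g 0) (g s) by exact: gple.
  have /andP[k4 _] : ple (g t) (g 1) by exact: gple.
  rewrite g0 in k3; rewrite g1 in k4.
  by apply: lerD; rewrite ler_expR; lra.
by apply: le_trans (chart_dist2 y k2) _; rewrite dB -mulrA (mulrC (t - s)).
Qed.

Lemma exists_segment p q : ple p q -> p <> q -> exists (g : R -> plane R) (K : R),
  [/\ g 0 = p, g 1 = q & forall s t, 0 <= s -> s < t -> t <= 1 ->
    [/\ ple (g s) (g t), ptau (g s) (g t) = ptau p q * (t - s),
        pdist (g s) (g t) <= K * (t - s) & plt p q -> plt (g s) (g t)]].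
Proof.
move=> h pq; case: (boolP (plt p q)) => [h'|h'].
  have [g [K [g0 g1 H]]] := exists_timelike_segment h'.
  exists g, K; split => // s t s0 st t1; have [k1 k2 k3] := H s t s0 st t1.
  by split => //; exact: plt_ple.
case/andP: (h) => h1 h2.
(* Points that are causally but not chronologically related share a coordinate, so this line is
   null. *)
pose g s : plane R := (p.1 + s * (q.1 - p.1), p.2 + s * (q.2 - p.2)).
have gple s t : s < t -> ple (g s) (g t).
  by move=> /ltW st; rewrite /ple /= !lerD2l !ler_wpM2r ?subr_ge0.
exists g, ((q.1 - p.1) + (q.2 - p.2)); split.
- by rewrite /g !mul0r !addr0; case: (p).
- by rewrite /g !mul1r ![_ + (_ - _)]addrC !subrK; case: (q).
move=> s t s0 st t1; split => //; first exact: gple.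
- rewrite (ptau_eq0 h') mul0r ptau_eq0 // negb_and -!leNgt /= !lerD2l.
  move: h'; rewrite negb_and -!leNgt => /orP[e|e]; apply/orP; [left|right].
    by rewrite (_ : q.1 - p.1 = 0) ?mulr0 //; apply/eqP; rewrite subr_eq0 eq_le h1 e.
  by rewrite (_ : q.2 - p.2 = 0) ?mulr0 //; apply/eqP; rewrite subr_eq0 eq_le h2 e.
apply: le_trans (pdist_ple (gple s t st)) _; rewrite /g /=.
by rewrite le_eqVlt; apply/orP; left; apply/eqP; ring.
Qed.

End Segments.

(** * Lengths as infima over partitions *)

Section ChainSums.
Variables (R : realType) (X : lorentzPreLengthSpace R).
Implicit Types (f : X -> X -> \bar R) (g : R -> X) (a b s t c : R).

Lemma chain_sum_nil f g a : chain_sum f g a [::] = 0%E.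
Proof. by rewrite /chain_sum big_nil. Qed.

Lemma chain_sum_cons f g a x l :
  chain_sum f g a (x :: l) = (f (g a) (g x) + chain_sum f g x l)%E.
Proof.
rewrite /chain_sum big_nat_recl //=; congr (_ + _)%E.
apply: eq_big_nat => i /andP[_ il].
by rewrite (set_nth_default x) ?(set_nth_default x a) //= ltnW // ltnS.
Qed.

Lemma chain_sum1 f g a x : chain_sum f g a [:: x] = f (g a) (g x).
Proof. by rewrite chain_sum_cons chain_sum_nil adde0. Qed.

Lemma itv_partition_consE a b x l :
  itv_partition a b (x :: l) -> a < x /\ itv_partition x b l.
Proof. by move=> [/= /andP[ax xl] e]. Qed.

Lemma chain_sum_affine c g a b l : itv_partition a b l ->
  (forall s t, a <= s -> s < t -> t <= b -> tau (g s) (g t) = (c * (t - s))%:E) ->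
  chain_sum tau g a l = (c * (b - a))%:E.
Proof.
elim: l a => [|x l IH] a.
  by move=> /itv_partition_nil <- _; rewrite chain_sum_nil subrr mulr0.
move=> /itv_partition_consE[ax xl] H; rewrite chain_sum_cons (IH x) //.
  have xb := itv_partition_le xl.
  by rewrite H // -EFinD; congr EFin; ring.
by move=> s t xs st tb; apply: H => //; rewrite (le_trans (ltW ax)).
Qed.

Lemma tau_length_affine c g a b : a < b ->
  (forall s t, a <= s -> s < t -> t <= b -> tau (g s) (g t) = (c * (t - s))%:E) ->
  tau_length g a b = (c * (b - a))%:E.
Proof.
move=> ab H; apply/eqP; rewrite eq_le; apply/andP; split.
  apply: ereal_inf_lbound; exists [:: b]; first exact: itv_partition1.
  by apply: chain_sum_affine => //; exact: itv_partition1.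
by apply: le_ereal_inf_tmp => _ [l pl <-]; rewrite (chain_sum_affine pl H).
Qed.

Lemma tau_length_le g a b : a < b -> (tau_length g a b <= tau (g a) (g b))%E.
Proof.
move=> ab; rewrite -chain_sum1; apply: ereal_inf_lbound.
by exists [:: b] => //; exact: itv_partition1.
Qed.

Lemma tau_length_le_cat g a s b : a < s -> s < b ->
  (tau_length g a b <= tau (g a) (g s) + tau (g s) (g b))%E.
Proof.
move=> h1 h2; rewrite -(chain_sum1 tau g s b) -chain_sum_cons; apply: ereal_inf_lbound.
by exists [:: s; b] => //; split; rewrite /= ?h1 ?h2.
Qed.

Lemma tau_length_le_cat3 g a s t b : a < s -> s < t -> t < b ->
  (tau_length g a b <= tau (g a) (g s) + (tau (g s) (g t) + tau (g t) (g b)))%E.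
Proof.
move=> h1 h2 h3; rewrite -(chain_sum1 tau g t b) -!chain_sum_cons; apply: ereal_inf_lbound.
by exists [:: s; t; b] => //; split; rewrite /= ?h1 ?h2 ?h3.
Qed.

End ChainSums.

(** * Causal curves of the glued plane *)

Section GluedCurves.
Variable R : realType.
Local Notation X := (glued R).
Implicit Types (p q m n : plane R) (I : interval R) (g : R -> X) (a b s t : R).

Lemma mdist_glued (p q : X) : mdist p q = pdist p q.
Proof. by []. Qed.

Lemma pdistxx p : pdist p p = 0.
Proof. by rewrite /pdist !subrr normr0 maxxx. Qed.

Lemma pdistC p q : pdist p q = pdist q p.
Proof. by rewrite /pdist (distrC p.1) (distrC p.2). Qed.

Lemma locally_lipschitz_glued I g :
  (forall s, s \in I -> exists2 V : set R, nbhs s V & exists k : R,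
    forall t u, t \in I -> u \in I -> V t -> V u -> t < u ->
      pdist (g t) (g u) <= k * (u - t)) -> locally_lipschitz_curve I g.
Proof.
move=> H s sI; have [V nV [k hk]] := H s sI.
exists V => //; exists k => t u tI uI Vt Vu; rewrite mdist_glued.
have [tu|ut|->] := ltgtP t u.
- by rewrite ltr0_norm ?subr_lt0 // opprB; exact: hk.
- by rewrite gtr0_norm ?subr_gt0 // pdistC; exact: hk.
- by rewrite subrr normr0 mulr0 pdistxx.
Qed.

Lemma lipschitz_glued K I g :
  (forall s t, s \in I -> t \in I -> s < t -> pdist (g s) (g t) <= K * (t - s)) ->
  locally_lipschitz_curve I g.
Proof.
move=> H; apply: locally_lipschitz_glued => s sI.
by exists setT; [exact: filterT|exists K => t u tI uI _ _; exact: H].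
Qed.

Lemma exists_maximizer p q : ple p q -> p <> q -> exists g : R -> X,
  [/\ causal_from_to 0 1 g p q, tau_length g 0 1 = (ptau p q)%:E,
      (forall t, t \in `[0, 1] -> ple p (g t) /\ ple (g t) q) &
      plt p q -> timelike_curve `[0, 1] g].
Proof.
move=> h pq; have [g [K [g0 g1 H]]] := exists_segment h pq.
have nc : nonconstant `[0, 1] (g : R -> X).
  by exists 0, 1; rewrite !in_itv /= !lexx ler01 g0 g1.
have lip : locally_lipschitz_curve `[0, 1] (g : R -> X).
  apply: (@lipschitz_glued K) => s t; rewrite !in_itv /= => /andP[s0 _] /andP[_ t1] st.
  by have [] := H s t s0 st t1.
have cau s t : s \in `[0, 1] -> t \in `[0, 1] -> s <= t -> ple (g s) (g t).
  rewrite !in_itv /= => /andP[s0 _] /andP[_ t1].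
  rewrite le_eqVlt => /orP[/eqP ->|st]; first exact: ple_refl.
  by have [] := H s t s0 st t1.
exists g; split.
- by split => //; split => // s t sI tI /ltW; exact: cau.
- rewrite (@tau_length_affine _ _ (ptau p q)) ?subr0 ?mulr1 // => s t s0 st t1.
  by rewrite /=; have [_ -> _ _] := H s t s0 st t1.
- move=> t tI; rewrite -g0 -g1; case/andP: (tI) => /= t0 t1.
  by split; apply: cau => //; rewrite in_itv /= ?lexx ?ler01.
- move=> pq'; split => // s t; rewrite !in_itv /= => /andP[s0 _] /andP[_ t1] st.
  by have [_ _ _] := H s t s0 st t1; apply.
Qed.

Lemma causal_from_to_lt a b g p q : causal_from_to a b g p q -> a < b.
Proof.
move=> [[[s [t [sI tI st]]] _ _] _ _]; rewrite ltNge; apply/negP => ba.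
have E u : u \in `[a, b] -> u = a.
  by rewrite in_itv /= => /andP[h1 h2]; apply/le_anti; rewrite h1 (le_trans h2).
by apply: st; rewrite (E s sI) (E t tI).
Qed.

Lemma causal_curve_ple I g s t : causal_curve I g -> s \in I -> t \in I -> s <= t ->
  ple (g s) (g t).
Proof.
move=> [_ _ c] sI tI; rewrite le_eqVlt => /orP[/eqP ->|]; first exact: ple_refl.
exact: c.
Qed.

Lemma causal_from_to_between a b g p q t : causal_from_to a b g p q ->
  t \in `[a, b] -> ple p (g t) /\ ple (g t) q.
Proof.
move=> h tI; have ab := ltW (causal_from_to_lt h); case: h => h <- <-.
case/andP: (tI) => /= at_ tb.
by split; apply: causal_curve_ple h _ _ _ => //; rewrite in_itv /= ?lexx ?ab.
Qed.

Lemma tau_length_le_ptau a b g p q : causal_from_to a b g p q ->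
  (tau_length g a b <= (ptau p q)%:E)%E.
Proof.
move=> h; have ab := causal_from_to_lt h; case: h => _ <- <-.
exact: tau_length_le.
Qed.

(** Partitions are strictly increasing, so [s = a] or [t = b] cannot be inserted as a further point;
    there the extra term is [ptau] of a point with itself. *)
Lemma tau_length_le_ptau3 a b g p q s t : causal_from_to a b g p q ->
  a <= s -> s < t -> t <= b ->
  (tau_length g a b <= (ptau p (g s) + ptau (g s) (g t) + ptau (g t) q)%:E)%E.
Proof.
move=> h; have ab := causal_from_to_lt h; case: h => _ <- <-.
rewrite le_eqVlt => /orP[/eqP <-|as_] st; rewrite le_eqVlt => /orP[/eqP tb|tb]; rewrite ?tb in st *.
- by rewrite !ptauxx addr0 add0r; exact: tau_length_le.
- by rewrite ptauxx add0r EFinD; exact: tau_length_le_cat.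
- by rewrite ptauxx addr0 EFinD; exact: tau_length_le_cat.
- by rewrite -addrA !EFinD; exact: tau_length_le_cat3.
Qed.

Lemma tau_length_null a b g p q : plt p q -> causal_from_to a b g p q ->
  has_null_segment a b g -> (tau_length g a b < (ptau p q)%:E)%E.
Proof.
move=> pq h [s0 [t0 [s0I t0I [[s [t [sI tI st]]] _ _] ach]]].
wlog lt_st : s t sI tI st / s < t.
  move=> H; have [l|l|e] := ltgtP s t; [exact: H st l| |by case: st; rewrite e].
  by apply: H l => //; exact: nesym.
have sub u : u \in `[s0, t0] -> u \in `[a, b].
  move: s0I t0I; rewrite !in_itv /= => /andP[h1 _] /andP[_ h2] /andP[h3 h4].
  by rewrite (le_trans h1) // (le_trans h4).
have sI' := sub _ sI; have tI' := sub _ tI.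
have [hc _ _] := h.
have [k1 _] := causal_from_to_between h sI'; have [_ k2] := causal_from_to_between h tI'.
have k3 : ple (g s) (g t) by apply: causal_curve_ple hc _ _ _ => //; exact: ltW.
move: sI' tI'; rewrite !in_itv /= => /andP[as_ _] /andP[_ tb].
apply: le_lt_trans (tau_length_le_ptau3 h as_ lt_st tb) _.
have -> : ptau (g s) (g t) = 0 by apply: ptau_eq0; apply/negP; exact: ach.
by rewrite addr0 lte_fin ptau_lt_null.
Qed.

(** Both coordinates are nondecreasing along the curve, so the bounds [pdist_ple] telescope. *)
Lemma chain_sum_pdist g a b l : itv_partition a b l ->
  (forall s t, a <= s -> s < t -> t <= b -> ple (g s) (g t)) ->
  (chain_sum (fun x y : X => (mdist x y)%:E) g a l <=
   (((g b).1 - (g a).1) + ((g b).2 - (g a).2))%:E)%E.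
Proof.
elim: l a => [|x l IH] a.
  by move=> /itv_partition_nil <- _; rewrite chain_sum_nil !subrr addr0.
move=> /itv_partition_consE[ax xl] H; rewrite chain_sum_cons.
have xb := itv_partition_le xl.
have /(IH x xl) H' : forall s t, x <= s -> s < t -> t <= b -> ple (g s) (g t).
  by move=> s t xs st tb; apply: H => //; rewrite (le_trans (ltW ax)).
have h1 : ple (g a) (g x) by exact: H.
have h2 : ((mdist (g a) (g x))%:E <=
    (((g x).1 - (g a).1) + ((g x).2 - (g a).2))%:E)%E.
  by rewrite lee_fin mdist_glued; exact: pdist_ple.
apply: le_trans (leeD h2 H') _.
by rewrite -EFinD lee_fin; lra.
Qed.

Lemma bounded_causal_lengths_box (A : set X) p q :
  (forall m, A m -> ple p m /\ ple m q) -> bounded_causal_lengths A.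
Proof.
move=> H; exists (`|(q.1 - p.1) + (q.2 - p.2)| + 1); first by rewrite ltr_wpDl.
move=> I g cg gA; apply: ge_ereal_sup => _ [a [b [l [aI bI pl ->]]]].
have conv s : a <= s -> s <= b -> s \in I.
  by move=> h1 h2; rewrite (interval_is_interval aI bI) // h1.
apply: le_trans (chain_sum_pdist pl _) _.
  move=> s t as_ st tb; apply: causal_curve_ple cg _ _ _.
  - by apply: conv => //; rewrite (le_trans _ tb) // ltW.
  - by apply: conv => //; rewrite (le_trans as_) // ltW.
  - exact: ltW.
rewrite lee_fin.
have [/andP[h1 h2] _] := H _ (gA a aI); have [_ /andP[h3 h4]] := H _ (gA b bI).
have := ler_norm ((q.1 - p.1) + (q.2 - p.2)); lra.
Qed.

End GluedCurves.

(** * The glued plane is a Lorentzian length space *)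

Section GluedSpace.
Variable R : realType.
Local Notation X := (glued R).
Implicit Types (p q m n : plane R) (I : interval R) (g : R -> X) (a b s t : R).

Lemma closed_ple : closed [set z : plane R * plane R | ple z.1 z.2].
Proof.
rewrite -[X in closed X]setCK; apply: open_closedC; rewrite openE => z /= /negP h.
by apply: filterS (near_Nple h) => w /negP.
Qed.

Lemma glued_causally_closed : locally_causally_closed X.
Proof.
move=> x; exists setT; first exact: filterT.
by apply: closed_subspaceW; exact: closed_ple.
Qed.

Lemma plt_neq p q : plt p q -> p <> q.
Proof. by move=> /andP[h _] e; move: h; rewrite e ltxx. Qed.

Lemma glued_path_connected : causally_path_connected X.
Proof.
split=> p q.
  move=> h; have [g [[_ g0 g1] _ _ H]] := exists_maximizer (plt_ple h) (plt_neq h).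
  by exists 0, 1, g; split => //; exact: H.
by move=> [h pq]; have [g [? _ _ _]] := exists_maximizer h pq; exists 0, 1, g.
Qed.

(** Open chronological diamonds are causally convex, so the global maximizers between their points
    stay inside and [ptau] itself serves as the local separation. *)
Definition box (p : plane R) : set (plane R) :=
  [set q | plt (p.1 - 1, p.2 - 1) q && plt q (p.1 + 1, p.2 + 1)].

Lemma open_box p : open (box p).
Proof.
rewrite openE => q /= /andP[/andP[/= h1 h2] /andP[/= h3 h4]].
have c1 := @ct_plane1 R q; have c2 := @ct_plane2 R q.
have n1 := near_lt (@ct_cst R _ (p.1 - 1) q) c1 h1.
have n2 := near_lt (@ct_cst R _ (p.2 - 1) q) c2 h2.
have n3 := near_lt c1 (@ct_cst R _ (p.1 + 1) q) h3.
have n4 := near_lt c2 (@ct_cst R _ (p.2 + 1) q) h4.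
by near=> w; apply/andP; split; apply/andP; split; near: w.
Unshelve. all: end_near. Qed.

Lemma box_center p : box p p.
Proof. by rewrite /box /= /plt /=; apply/andP; split; apply/andP; split; lra. Qed.

Lemma box_between p m n q : box p m -> box p n -> ple m q -> ple q n -> box p q.
Proof.
move=> /andP[h1 _] /andP[_ h2] h3 h4; rewrite /box /=.
by rewrite (plt_ple_trans h1 h3) (ple_plt_trans h4 h2).
Qed.

Lemma box_localizing p : localizing (X := X) (box p) (@ptau R).
Proof.
split.
- apply: (@bounded_causal_lengths_box _ _ (p.1 - 1, p.2 - 1) (p.1 + 1, p.2 + 1)).
  by move=> m /andP[h1 h2]; split; exact: plt_ple.
- by apply: continuous_subspaceT; exact: ptau_continuous.
- exact: ptau_pre_length_on.
- move=> q /andP[/andP[/= h1 h2] /andP[/= h3 h4]]; split.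
    exists ((q.1 + (p.1 + 1)) / 2, (q.2 + (p.2 + 1)) / 2) => /=.
      by apply/andP; split; apply/andP; split => /=; lra.
    by apply/andP; split => /=; lra.
  exists ((q.1 + (p.1 - 1)) / 2, (q.2 + (p.2 - 1)) / 2) => /=.
    by apply/andP; split; apply/andP; split => /=; lra.
  by apply/andP; split => /=; lra.
Qed.

Lemma glued_regularly_localizable : regularly_localizable X.
Proof.
move=> x; exists (box x), (@ptau R); split.
- exact: open_box.
- exact: box_center.
- exact: box_localizing.
move=> p q bp bq [h pq]; have [g [gc gl gb gt]] := exists_maximizer h pq.
exists 0, 1, g; split.
  split => //.
  - by move=> t tI; have [h1 h2] := gb t tI; exact: box_between bp bq h1 h2.
  - by move=> a b k kc _; rewrite gl; exact: tau_length_le_ptau.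
move=> h'; split; first exact: gt.
by move=> a b k kc _ kn; rewrite gl; exact: tau_length_null kc kn.
Qed.

Lemma glued_localizable : localizable X.
Proof.
move=> x; have [Om [om [h1 h2 h3 h4]]] := glued_regularly_localizable x.
exists Om, om; split => // p q hp hq pq.
by have [a [b [g [h _]]]] := h4 p q hp hq pq; exists a, b, g.
Qed.

Lemma glued_intrinsic : intrinsic_tau X.
Proof.
move=> p q; apply/eqP; rewrite eq_le; apply/andP; split; last first.
  apply: ge_ereal_sup => _ [->|[a [b [g [gc ->]]]]]; first by rewrite lee_fin ptau_ge0.
  exact: tau_length_le_ptau.
apply: ereal_sup_ubound.
case: (boolP (plt p q)) => h; last first.
  by left; rewrite /= (ptau_eq0 h).
have [g [gc gl _ _]] := exists_maximizer (plt_ple h) (plt_neq h).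
by right; exists 0, 1, g; rewrite gl.
Qed.

Lemma glued_length_space : lorentzian_length_space X.
Proof.
split; [exact: glued_causally_closed|exact: glued_path_connected|
  exact: glued_localizable|exact: glued_intrinsic].
Qed.

Lemma compact_image_bounded (f : plane R -> R) (K : set (plane R)) :
  continuous f -> compact K -> exists M, forall p, K p -> - M <= f p /\ f p <= M.
Proof.
move=> cf cK.
have cfK : compact (f @` K : set R^o).
  by apply: continuous_compact => //; exact: continuous_subspaceT.
have /pinfty_ex_gt0[M _ HM] := compact_bounded cfK.
exists M => p Kp; have : `|f p| <= M by apply: HM; exists p.
by rewrite ler_norml => /andP[].
Qed.

Lemma glued_hyperbolic : globally_hyperbolic X.
Proof.
split.
  move=> p q; have -> : diamond p q =
      ([set` `[p.1, q.1]] `*` [set` `[p.2, q.2]] : set (R * R)).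
    apply/seteqP; split => [[x y] [/andP[/= h1 h2] /andP[/= h3 h4]]|[x y] [/=]].
      by split; rewrite /= in_itv /= ?h1 ?h2.
    rewrite !in_itv /= => /andP[h1 h2] /andP[h3 h4].
    by split; apply/andP; split.
  by apply: compact_setX; exact: segment_compact.
move=> K cK.
have [M1 H1] := compact_image_bounded (@ct_plane1 R) cK.
have [M2 H2] := compact_image_bounded (@ct_plane2 R) cK.
apply: (@bounded_causal_lengths_box _ _ (- M1, - M2) (M1, M2)) => m Km.
have [h1 h2] := H1 m Km; have [h3 h4] := H2 m Km.
by split; apply/andP.
Qed.

(** * The achronal curve and the geodesics that approximate it *)

Lemma ptau_above p q : 0 <= p.2 -> ple p q ->
  ptau p q = Num.sqrt ((expR q.1 - expR p.1) * (q.2 - p.2)).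
Proof.
move=> h1 h2; case/andP: (h2) => _ h3.
rewrite (@ptau_same _ 0) ?csep2_above ?(le_trans h1 h3) //.
by apply/same_sideP; left; rewrite h1 (le_trans h1).
Qed.

Lemma ptau_below p q : q.2 < 0 -> ple p q ->
  ptau p q = Num.sqrt ((expR (- p.1) - expR (- q.1)) * (q.2 - p.2)).
Proof.
move=> h1 h2; case/andP: (h2) => _ h3; have h4 := le_lt_trans h3 h1.
by rewrite (@ptau_same _ 0) ?csep2_below //; apply/same_sideP; right.
Qed.

Lemma ln_sub_le (u v : R) : 0 < u -> u <= v -> 0 <= ln v - ln u <= (v - u) / u.
Proof.
move=> u0 uv; have v0 := lt_le_trans u0 uv.
rewrite subr_ge0 ler_ln ?posrE // uv /=.
have := expR_ge1Dx (ln v - ln u); rewrite expRD expRN !lnK ?posrE // => h.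
by rewrite mulrBl divff ?gt_eqF //; lra.
Qed.

(** These are the straight lines [u = 1 + t], [v = e * t] above and, for [lower_ray], [U = s - 1],
    [v = e * U] below. At [e = 0] both run through the achronal half line. *)
Definition upper_ray (e t : R) : X := (ln (1 + t), e * t).
Definition lower_ray (e s : R) : X := (- ln (1 - s), e * (s - 1)).

Lemma upper_ray_lipschitz e : 0 <= e -> locally_lipschitz_curve `[0, +oo[ (upper_ray e).
Proof.
move=> e0; apply: (@lipschitz_glued _ (1 + e)) => s t.
rewrite !in_itv /= !andbT => s0 t0 st.
have /andP[l1 l2] : 0 <= ln (1 + t) - ln (1 + s) <= (1 + t - (1 + s)) / (1 + s).
  by apply: ln_sub_le; lra.
have st' : ple (upper_ray e s) (upper_ray e t).
  by rewrite /ple /= -subr_ge0 l1 /= ler_wpM2l // ltW.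
apply: le_trans (pdist_ple st') _; rewrite /= mulrDl mul1r.
apply: lerD; last by rewrite -mulrBr.
apply: le_trans l2 _; rewrite ler_pdivrMr; last by lra.
have -> : 1 + t - (1 + s) = t - s by ring.
by rewrite ler_peMr ?lerDl // subr_ge0 ltW.
Qed.

Lemma lower_ray_lipschitz e : 0 <= e -> locally_lipschitz_curve `[0, 1[ (lower_ray e).
Proof.
move=> e0; apply: locally_lipschitz_glued => s; rewrite in_itv /= => /andP[s0 s1].
(* The slope of [- ln (1 - s)] is unbounded near 1; up to the midpoint between [s] and 1 it is at
   most [2 / (1 - s)]. *)
exists [set t | t < (1 + s) / 2].
  by apply: (near_lt (@ct_id R s) (@ct_cst R R ((1 + s) / 2) s)); lra.
exists (2 / (1 - s) + e) => t u; rewrite !in_itv /= => /andP[t0 t1] /andP[u0 u1] Vt Vu tu.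
have /andP[l1 l2] : 0 <= ln (1 - t) - ln (1 - u) <= (1 - t - (1 - u)) / (1 - u).
  by apply: ln_sub_le; lra.
have tu' : ple (lower_ray e t) (lower_ray e u).
  by rewrite /ple /= lerN2 -subr_ge0 l1 /= ler_wpM2l // lerB // ltW.
apply: le_trans (pdist_ple tu') _; rewrite /= mulrDl.
apply: lerD; last by rewrite -mulrBr (_ : u - 1 - (t - 1) = u - t) //; ring.
rewrite opprK addrC; apply: le_trans l2 _.
have -> : 1 - t - (1 - u) = u - t by ring.
rewrite mulrC ler_wpM2r ?subr_ge0 ?(ltW tu) //.
rewrite -[leRHS]invf_div lef_pV2 ?posrE; lra.
Qed.

Lemma upper_ray_plt e s t : 0 < e -> 0 <= s -> s < t -> plt (upper_ray e s) (upper_ray e t).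
Proof.
move=> e0 s0 st; rewrite /plt /= ltr_pM2l // st andbT ltr_ln ?posrE; lra.
Qed.

Lemma lower_ray_plt e s t : 0 < e -> s < t -> t < 1 -> plt (lower_ray e s) (lower_ray e t).
Proof.
move=> e0 st t1; rewrite /plt /= ltr_pM2l // ltrN2 ltr_ln ?posrE; last 2 first.
- lra.
- lra.
by rewrite !ltrD2l ltrN2 ltrD2r st.
Qed.

Lemma upper_ray_ptau e s t : 0 < e -> 0 <= s -> s < t ->
  ptau (upper_ray e s) (upper_ray e t) = Num.sqrt e * (t - s).
Proof.
move=> e0 s0 st; rewrite ptau_above /=; last 2 first.
- by rewrite mulr_ge0 // ltW.
- exact/plt_ple/upper_ray_plt.
rewrite !lnK ?posrE; [|lra|lra].
rewrite (_ : _ * _ = e * (t - s) ^+ 2); last by ring.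
by rewrite sqrtrM ?(ltW e0) // sqrtr_sqr ger0_norm // subr_ge0 ltW.
Qed.

Lemma lower_ray_ptau e s t : 0 < e -> s < t -> t < 1 ->
  ptau (lower_ray e s) (lower_ray e t) = Num.sqrt e * (t - s).
Proof.
move=> e0 st t1; rewrite ptau_below /=; last 2 first.
- by rewrite pmulr_rlt0 // subr_lt0.
- exact/plt_ple/lower_ray_plt.
rewrite !opprK !lnK ?posrE; [|lra|lra].
rewrite (_ : _ * _ = e * (t - s) ^+ 2); last by ring.
by rewrite sqrtrM ?(ltW e0) // sqrtr_sqr ger0_norm // subr_ge0 ltW.
Qed.

Lemma ptau_affine_geodesic c I g : timelike_curve I g ->
  (forall s t, s \in I -> t \in I -> s < t -> ptau (g s) (g t) = c * (t - s)) ->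
  timelike_geodesic I g /\ affinely_parametrized I g.
Proof.
move=> gt H.
have L s t : s \in I -> t \in I -> s < t -> tau_length g s t = (c * (t - s))%:E.
  move=> sI tI st; apply: tau_length_affine => // u v su uv vt.
  have conv w : s <= w -> w <= t -> w \in I.
    by move=> h1 h2; rewrite (interval_is_interval sI tI) // h1.
  rewrite /= H //; apply: conv => //; first by rewrite (le_trans (ltW uv)).
  by rewrite (le_trans su) // ltW.
split; last by exists c.
by split => // s t sI tI st; rewrite L //= H.
Qed.

Lemma upper_ray_geodesic e : 0 < e ->
  timelike_geodesic `[0, +oo[ (upper_ray e) /\
  affinely_parametrized `[0, +oo[ (upper_ray e).
Proof.
move=> e0; apply: (@ptau_affine_geodesic (Num.sqrt e)); last first.
  by move=> s t; rewrite !in_itv /= !andbT => s0 _ st; exact: upper_ray_ptau.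
split.
- exists 0, 1; rewrite !in_itv /= ?lexx ?ler01; split => //.
  by apply: plt_neq; apply: upper_ray_plt.
- by apply: upper_ray_lipschitz; exact: ltW.
- by move=> s t; rewrite !in_itv /= !andbT => s0 _ st; exact: upper_ray_plt.
Qed.

Lemma lower_ray_geodesic e : 0 < e ->
  timelike_geodesic `[0, 1[ (lower_ray e) /\
  affinely_parametrized `[0, 1[ (lower_ray e).
Proof.
move=> e0; apply: (@ptau_affine_geodesic (Num.sqrt e)); last first.
  by move=> s t; rewrite !in_itv /= => _ /andP[_ t1] st; exact: lower_ray_ptau.
split.
- exists 0, (1 / 2); rewrite !in_itv /=; split; try by apply/andP; split; lra.
  by apply: plt_neq; apply: lower_ray_plt => //; lra.
- by apply: lower_ray_lipschitz; exact: ltW.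
- by move=> s t; rewrite !in_itv /= => _ /andP[_ t1] st; exact: lower_ray_plt.
Qed.

Lemma upper_ray_causal : causal_curve `[0, +oo[ (upper_ray 0).
Proof.
split.
- exists 0, 1; rewrite !in_itv /= ?lexx ?ler01; split => //.
  rewrite /upper_ray addr0 ln1 => -[/esym/eqP]; rewrite mulr0 ln_eq0; lra.
- exact: upper_ray_lipschitz.
- move=> s t; rewrite !in_itv /= !andbT => s0 t0 st.
  by rewrite /ple /= !mul0r lexx andbT ler_ln ?posrE; lra.
Qed.

Lemma lower_ray_causal : causal_curve `[0, 1[ (lower_ray 0).
Proof.
split.
- exists 0, (1 / 2); rewrite !in_itv /=; split; try by apply/andP; split; lra.
  rewrite /lower_ray subr0 ln1 oppr0 !mul0r => -[/esym/eqP].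
  rewrite oppr_eq0 ln_eq0; [move/eqP|]; lra.
- exact: lower_ray_lipschitz.
- move=> s t; rewrite !in_itv /= => /andP[s0 s1] /andP[t0 t1] st.
  by rewrite /ple /= !mul0r lexx andbT lerN2 ler_ln ?posrE; lra.
Qed.

Lemma upper_ray_achronal : achronal `[0, +oo[ (upper_ray 0).
Proof. by move=> s t _ _ /=; rewrite /plt /= !mul0r ltxx andbF. Qed.

Lemma lower_ray_reparametrization :
  reparametrization `[0, 1[ (lower_ray 0) `[0, +oo[ (upper_ray 0).
Proof.
split; first exact: lower_ray_causal.
(* The gluing relation [u = -1 / U] with [u = 1 + t] and [U = s - 1], solved for [t]. *)
exists (fun s => s / (1 - s)); split.
- apply: continuous_in_subspaceT => s; rewrite inE /= in_itv /= => /andP[s0 s1].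
  apply: cvgM; first exact: cvg_id.
  apply: cvgV; first by rewrite gt_eqF // subr_gt0.
  by apply: cvgB; [exact: cvg_cst|exact: cvg_id].
- move=> s t; rewrite !in_itv /= => /andP[s0 s1] /andP[t0 t1] st.
  rewrite ltr_pdivrMr ?subr_gt0 // mulrAC ltr_pdivlMr ?subr_gt0 //; lra.
- apply/seteqP; split => [_ [s + <-]|t] /=; rewrite !in_itv /= ?andbT.
    by move=> /andP[s0 s1]; rewrite divr_ge0 // subr_ge0 ltW.
  move=> t0; exists (t / (1 + t)); last by field; lra.
  rewrite in_itv /= divr_ge0 ?ltr_pdivrMr; lra.
- move=> s; rewrite in_itv /= => /andP[s0 s1]; rewrite /lower_ray /upper_ray !mul0r.
  congr pair; rewrite -lnV ?posrE ?subr_gt0 //; congr ln.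
  by field; lra.
Qed.

Lemma ray_approximation (J I : interval R) (f : R -> R -> X) :
  (forall e, 0 < e -> timelike_geodesic J (f e) /\ affinely_parametrized J (f e)) ->
  (forall T, 0 <= T -> [set` `[0, T]] `<=` [set` I] -> [set` `[0, T]] `<=` [set` J]) ->
  (forall T, 0 <= T -> exists K, forall e t, 0 <= t <= T -> 0 <= e ->
     pdist (f 0 t) (f e t) <= e * K) ->
  geodesically_approximable I (f 0).
Proof.
move=> H1 H2 H3; exists (fun=> J), (fun k : nat => f k.+1%:R^-1); split.
  by move=> k; apply: H1; rewrite invr_gt0.
move=> T T0 TI; split; first by near=> k; exact: H2.
have [K HK] := H3 T T0.
move=> P /uniform_nbhs[E [+ sub]].
rewrite -entourage_ballE => -[e /= e0 eE].
have K0 : 0 < `|K| + 1 by rewrite ltr_wpDl.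
have eK0 : 0 < e / (`|K| + 1) by rewrite divr_gt0.
near=> k; apply: sub => t /=; rewrite in_itv /= => tT; apply: eE => /=.
rewrite ballEmdist /= mdist_glued.
apply: le_lt_trans (HK _ t tT _) _; first by rewrite invr_ge0.
apply: (@le_lt_trans _ _ (k.+1%:R^-1 * (`|K| + 1))).
  by rewrite ler_wpM2l ?invr_ge0 // (le_trans (ler_norm K)) // lerDl.
rewrite -ltr_pdivlMr //; near: k; exact: (near_infty_natSinv_lt (PosNum eK0)).
Unshelve. all: end_near. Qed.

Lemma upper_ray_approximable : geodesically_approximable `[0, +oo[ (upper_ray 0).
Proof.
apply: (ray_approximation upper_ray_geodesic) => // T T0; exists T => e t /andP[t0 tT] e0.
rewrite /upper_ray /pdist /= subrr normr0 mul0r sub0r normrN ger0_norm ?mulr_ge0 //.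
by rewrite max_r ?mulr_ge0 // ler_wpM2l.
Qed.

Lemma lower_ray_approximable : geodesically_approximable `[0, 1[ (lower_ray 0).
Proof.
apply: (ray_approximation lower_ray_geodesic) => // T T0.
exists (T + 1) => e t /andP[t0 tT] e0.
rewrite /lower_ray /pdist /= subrr normr0 mul0r sub0r normrN normrM ger0_norm //.
rewrite max_r ?mulr_ge0 // ler_wpM2l // ler_norml; apply/andP; split; lra.
Qed.

End GluedSpace.

(** * Comparison of flat and anti-de Sitter trigonometry *)

Section RealDerivatives.
Variable R : realType.
Implicit Types (f g h : R -> R) (x : R).

(* A copy of [is_derive] that is not a class, so that no instance is inferred
   while a derivative is computed. *)
Definition der f x (d : R) : Prop := is_derive x 1 f d.

Lemma der_eq f x (d d' : R) : der f x d -> d = d' -> der f x d'.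
Proof. by move=> h <-. Qed.

Lemma dv_cst (c : R) x : der (fun _ => c) x 0.
Proof. exact: is_derive_cst. Qed.

Lemma dv_id x : der (fun x => x) x 1.
Proof. exact: is_derive_id. Qed.

Lemma dvD f g x (df dg : R) : der f x df -> der g x dg ->
  der (fun x => f x + g x) x (df + dg).
Proof. by move=> hf hg; exact: is_deriveD. Qed.

Lemma dvN f x (df : R) : der f x df -> der (fun x => - f x) x (- df).
Proof. by move=> hf; exact: is_deriveN. Qed.

Lemma dvM f g x (df dg : R) : der f x df -> der g x dg ->
  der (fun x => f x * g x) x (df * g x + f x * dg).
Proof.
move=> hf hg; have H := is_deriveM hf hg; apply: is_derive_eq H _.
by rewrite addrC; congr (_ + _); rewrite mulrC.
Qed.

Lemma dv_comp h f x (dh df : R) : der h (f x) dh -> der f x df ->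
  der (fun x => h (f x)) x (dh * df).
Proof. by move=> hh hf; exact: is_derive1_comp. Qed.

Lemma dvX2 f x (df : R) : der f x df ->
  der (fun x => f x ^+ 2) x (df * f x + f x * df).
Proof. by move=> hf; exact: dvM. Qed.

Lemma dvV f x (df : R) : f x != 0 -> der f x df ->
  der (fun x => (f x)^-1) x (- (f x ^+ 2)^-1 * df).
Proof.
move=> f0 hf; have H := is_deriveV f0 hf; exact: is_derive_eq H _.
Qed.

Lemma dv_sin f x (df : R) : der f x df ->
  der (fun x => sin (f x)) x (cos (f x) * df).
Proof. by apply: dv_comp; exact: is_derive_sin. Qed.

Lemma dv_cos f x (df : R) : der f x df ->
  der (fun x => cos (f x)) x (- sin (f x) * df).
Proof. by apply: dv_comp; exact: is_derive_cos. Qed.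

Lemma dv_expR f x (df : R) : der f x df ->
  der (fun x => expR (f x)) x (expR (f x) * df).
Proof. by apply: dv_comp; exact: is_derive_expR. Qed.

Lemma dv_ln f x (df : R) : 0 < f x -> der f x df ->
  der (fun x => ln (f x)) x ((f x)^-1 * df).
Proof. by move=> f0; apply: dv_comp; exact: is_derive1_ln. Qed.

Lemma dv_acos f x (df : R) : -1 < f x < 1 -> der f x df ->
  der (fun x => acos (f x)) x (- (Num.sqrt (1 - f x ^+ 2))^-1 * df).
Proof. by move=> f0; apply: dv_comp; exact: is_derive1_acos. Qed.

Lemma dv_atan f x (df : R) : der f x df ->
  der (fun x => atan (f x)) x ((1 + f x ^+ 2)^-1 * df).
Proof. by apply: dv_comp; exact: is_derive1_atan. Qed.

Lemma dv_continuous f x (df : R) : der f x df -> continuous_at x f.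
Proof. by move=> [d _]; exact/differentiable_continuous/derivable1_diffP. Qed.

Lemma derivative_le0 f (df : R -> R) (a b : R) : a <= b ->
  (forall x, a <= x <= b -> der f x (df x)) ->
  (forall x, a < x < b -> df x <= 0) -> f b <= f a.
Proof.
rewrite le_eqVlt => /orP[/eqP -> //|ab] H dfle.
have [| |c] := @MVT R f df a b ab.
- by move=> x; rewrite in_itv /= => /andP[h1 h2]; apply: H; rewrite !ltW.
- apply: continuous_in_subspaceT => x; rewrite inE /= in_itv /= => xI.
  exact: dv_continuous (H x xI).
- rewrite in_itv /= => /dfle dc e.
  by rewrite -subr_le0 e mulr_le0_ge0 // subr_ge0 ltW.
Qed.

End RealDerivatives.

Ltac dv_real := lazymatch goal with
  | |- der (fun x => @?f x + @?g x) _ _ => apply: dvD; dv_real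
  | |- der (fun x => - @?f x) _ _ => apply: dvN; dv_real
  | |- der (fun x => @?f x * @?g x) _ _ => apply: dvM; dv_real
  | |- der (fun x => @?f x ^+ 2) _ _ => apply: (@dvX2 _ f); dv_real
  | |- der (fun x => (@?f x)^-1) _ _ => apply: (@dvV _ f); dv_real
  | |- der (fun x => expR (@?f x)) _ _ => apply: dv_expR; dv_real
  | |- der (fun x => cos (@?f x)) _ _ => apply: dv_cos; dv_real
  | |- der (fun x => sin (@?f x)) _ _ => apply: dv_sin; dv_real
  | |- der (fun x => ln (@?f x)) _ _ => apply: dv_ln; dv_real
  | |- der (fun x => acos (@?f x)) _ _ => apply: dv_acos; dv_real
  | |- der (fun x => atan (@?f x)) _ _ => apply: dv_atan; dv_real
  | |- der (fun x => _) _ _ =>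
      first [exact: dv_cst | exact: dv_id | eassumption | idtac]
  | |- der ?f ?y ?d =>
      first [eassumption | change (der (fun x => f x) y d); dv_real]
  | |- _ => idtac
  end.

(** * The entire functions behind [cos] and [sin] of a square root *)

Section CosSqrt.
Variable R : realType.
Implicit Types (f : nat -> R) (x y : R) (n : nat).

(** Domination by the exponential series gives convergence everywhere and passes to [pseries_diffs],
    so termwise differentiation can be repeated. *)
Definition dominated f := forall n, `|f n| <= (n`!%:R)^-1.

Lemma dominated_cvg f x : dominated f -> cvgn (pseries f x).
Proof.
move=> df; apply: normed_cvg.
apply: series_le_cvg (is_cvg_series_exp_coeff `|x|) => /= n.
- exact: normr_ge0.
- by rewrite /exp_coeff /= divr_ge0 // exprn_ge0.
- rewrite /exp_coeff /= normrM normrX mulrC; exact: ler_wpM2l.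
Qed.

Lemma dominated_diffs f : dominated f -> dominated (pseries_diffs f).
Proof.
move=> df n; rewrite /pseries_diffs normrM normr_nat.
apply: le_trans (ler_wpM2l _ (df n.+1)) _ => //.
by rewrite factS natrM invfM mulrA divff ?mul1r // pnatr_eq0.
Qed.

Definition psum f x : R := limn (pseries f x).

Lemma der_psum f x : dominated f -> der (psum f) x (psum (pseries_diffs f) x).
Proof.
move=> df; have d1 := dominated_diffs df; have d2 := dominated_diffs d1.
apply: (@pseries_snd_diffs _ f (`|x| + 1)); try exact: dominated_cvg.
by rewrite [ltRHS]ger0_norm ?addr_ge0 // ltrDl.
Qed.

Lemma psumZ f g x (k : R) : dominated f -> (forall n, g n = k * f n) ->
  psum g x = k * psum f x.
Proof.
move=> df e; apply: cvg_lim => //.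
have -> : pseries g x = (fun n => k * pseries f x n).
  apply/funext => n; rewrite /pseries /series /= mulr_sumr.
  by apply: eq_bigr => i _; rewrite e mulrA.
by apply: cvgMr; exact: dominated_cvg.
Qed.

Lemma psum_ge f x (a : R) : dominated f -> (forall n, a <= pseries f x n.+1) -> a <= psum f x.
Proof.
move=> df H; apply: limr_ge; first exact: dominated_cvg.
by near=> n; have -> : n = n.-1.+1 by rewrite prednK //; near: n; exact: nbhs_infty_gt.
Unshelve. all: end_near. Qed.

Lemma psum_le f x (a : R) : dominated f -> (forall n, pseries f x n.+1 <= a) -> psum f x <= a.
Proof.
move=> df H; apply: limr_le; first exact: dominated_cvg.
by near=> n; have -> : n = n.-1.+1 by rewrite prednK //; near: n; exact: nbhs_infty_gt.
Unshelve. all: end_near. Qed.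

(* [cosq (y ^+ 2) = cos y] and [y * sinq (y ^+ 2) = sin y]; at negative
   arguments these are the hyperbolic functions. *)
Definition cosq_coeff n : R := (-1) ^+ n / n.*2`!%:R.
Definition sinq_coeff n : R := (-1) ^+ n / n.*2.+1`!%:R.
Definition cosq := psum cosq_coeff.
Definition sinq := psum sinq_coeff.
Definition dsinq := psum (pseries_diffs sinq_coeff).

Lemma fact_le m n : (m <= n)%N -> (m`! <= n`!)%N.
Proof.
elim: n => [|n IH]; first by rewrite leqn0 => /eqP ->.
rewrite leq_eqVlt => /orP[/eqP -> //|]; rewrite ltnS => /IH h.
by rewrite (leq_trans h) // factS leq_pmull.
Qed.

Lemma dominated_cosq : dominated cosq_coeff.
Proof.
move=> n; rewrite normrM normrX normrN1 expr1n mul1r ger0_norm ?invr_ge0 //.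
by rewrite lef_pV2 ?posrE ?ltr0n ?fact_gt0 // ler_nat fact_le // -addnn leq_addr.
Qed.

Lemma dominated_sinq : dominated sinq_coeff.
Proof.
move=> n; rewrite normrM normrX normrN1 expr1n mul1r ger0_norm ?invr_ge0 //.
rewrite lef_pV2 ?posrE ?ltr0n ?fact_gt0 // ler_nat fact_le //.
by rewrite -addnn ltnW // ltnS leq_addr.
Qed.

Lemma der_cosq x : der cosq x (- sinq x / 2).
Proof.
apply: der_eq (der_psum x dominated_cosq) _.
rewrite (@psumZ sinq_coeff _ x (- 2^-1)) ?mulNr ?(mulrC 2^-1) //; first exact: dominated_sinq.
move=> n; rewrite /pseries_diffs /cosq_coeff /sinq_coeff doubleS factS natrM exprS.
rewrite -[n.*2.+2]/(n.*2.+2) invfM.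
have -> : n.*2.+2%:R = 2 * n.+1%:R :> R by rewrite -natrM mul2n doubleS.
have n0 : n.+1%:R != 0 :> R by rewrite pnatr_eq0.
have f0 : (n.*2.+1)`!%:R != 0 :> R by rewrite pnatr_eq0 -lt0n fact_gt0.
move: (n.+1%:R : R) ((n.*2.+1)`!%:R : R) ((-1) ^+ n : R) n0 f0 => a b c a0 b0.
by field; rewrite a0 b0.
Qed.

Lemma der_sinq x : der sinq x (dsinq x).
Proof. exact: der_psum dominated_sinq. Qed.

(** For [x = y ^ 2] this is the derivative of [sin y / y]. The comparison of coefficients also
    covers [x <= 0]. *)
Lemma dsinqE x : 2 * x * dsinq x = cosq x - sinq x.
Proof.
have d1 := dominated_diffs dominated_sinq.
have c1 := @dominated_cvg _ x dominated_cosq.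
have c2 := @dominated_cvg _ x dominated_sinq.
have := pseries_diffs_equiv (@dominated_cvg _ x d1).
set s := (fun i => _); rewrite -/(psum _ _) -/dsinq => c3.
have c4 : (fun n => 2 * x * series s n) @ \oo --> 2 * x * dsinq x.
  by apply: cvgM => //; exact: cvg_cst.
have c5 : (fun n => pseries cosq_coeff x n - pseries sinq_coeff x n) @ \oo --> cosq x - sinq x.
  by apply: cvgB.
apply: (cvg_unique _ c4) => //.
rewrite (_ : (fun n => 2 * x * series s n) = (fun n => pseries cosq_coeff x n - pseries sinq_coeff x n)) //.
apply/funext => n; rewrite /pseries /series /= mulr_sumr -sumrB.
apply: eq_bigr => -[|i] _.
  by rewrite /s /cosq_coeff /sinq_coeff /= !mul0r mulr0 subrr.
rewrite /s /cosq_coeff /sinq_coeff /= -mulrBl.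
rewrite (factS i.+1.*2) natrM invfM.
have -> : (i.+1.*2.+1)%:R = 2 * i.+1%:R + 1 :> R by rewrite -natrM natr1 mul2n.
have a0 : 2 * i.+1%:R + 1 != 0 :> R by rewrite -natrM natr1 pnatr_eq0.
have f0 : (i.+1.*2)`!%:R != 0 :> R by rewrite pnatr_eq0 -lt0n fact_gt0.
rewrite (exprS x i); move: (i.+1%:R : R) ((i.+1.*2)`!%:R : R) ((-1) ^+ i.+1 : R) (x ^+ i) a0 f0 => a b c d a0 b0.
by field; rewrite a0 b0.
Qed.

Lemma cosq_sqr y : cosq (y ^+ 2) = cos y.
Proof.
apply: cvg_lim => //; rewrite (_ : pseries _ _ = series (cos_coeff' y)).
  exact: cvg_cos_coeff'.
apply/funext => n; apply: eq_bigr => i _.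
by rewrite /= /cosq_coeff /cos_coeff' -exprM mul2n mulrAC.
Qed.

Lemma sinq_sqr y : y * sinq (y ^+ 2) = sin y.
Proof.
have c : series (sin_coeff' y) @ \oo --> sin y by exact: cvg_sin_coeff'.
have c' : (fun n => y * pseries sinq_coeff (y ^+ 2) n) @ \oo --> y * sinq (y ^+ 2).
  by apply: cvgMr; exact: dominated_cvg dominated_sinq.
apply: (cvg_unique _ c') => //; rewrite (_ : (fun n => _) = series (sin_coeff' y)) //.
apply/funext => n; rewrite /pseries /series /= mulr_sumr; apply: eq_bigr => i _.
rewrite /sinq_coeff /sin_coeff' -exprM mul2n exprS.
by rewrite [RHS]mulrAC [LHS]mulrCA.
Qed.

Lemma alt_pow n x : x <= 0 -> 0 <= (-1) ^+ n * x ^+ n.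
Proof. by move=> x0; rewrite -exprMn exprn_ge0 // mulN1r oppr_ge0. Qed.

Lemma cosq_ge1 x : x <= 0 -> 1 <= cosq x.
Proof.
move=> x0; apply: psum_ge dominated_cosq _ => n.
rewrite /pseries /series /= big_nat_recl // /cosq_coeff expr0 fact0 divr1 mul1r.
rewrite lerDl; apply: sumr_ge0 => i _.
by rewrite mulrAC divr_ge0 // alt_pow.
Qed.

Lemma sin_ge_mulcos y : 0 <= y <= pi -> y * cos y <= sin y.
Proof.
move=> /andP[y0 ypi].
have H : (fun y : R => y * cos y - sin y) y <= (fun y : R => y * cos y - sin y) 0.
  apply: (@derivative_le0 _ (fun y : R => y * cos y - sin y) (fun y => - (y * sin y))) => // x.
    by move=> _; apply: der_eq; [dv_real|rewrite /= /id; ring].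
  move=> /andP[x0 xy]; rewrite oppr_le0 mulr_ge0 ?(ltW x0) // sin_ge0_pi //.
  by rewrite (ltW x0) (le_trans (ltW xy)).
by move: H; rewrite /= mul0r sin0 subrr subr_le0.
Qed.

(** For [x <= 0] every term of the series is nonpositive. For [x = y ^ 2] with [0 < y <= pi] the
    sign is that of [y * cos y - sin y]. *)
Lemma dsinq_le0 x : x <= pi ^+ 2 -> dsinq x <= 0.
Proof.
have d1 := dominated_diffs dominated_sinq.
case: (lerP x 0) => [x0 _|x0 xpi].
  apply: psum_le d1 _ => n; rewrite -oppr_ge0 /pseries /series /= -sumrN; apply: sumr_ge0 => i _.
  rewrite /pseries_diffs /sinq_coeff (exprS _ i).
  rewrite (_ : - _ = i.+1%:R * (((-1) ^+ i * x ^+ i) / i.+1.*2.+1`!%:R)); last by ring.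
  by rewrite mulr_ge0 // divr_ge0 // alt_pow.
have y0 : 0 < Num.sqrt x by rewrite sqrtr_gt0.
have ypi : Num.sqrt x <= pi.
  by rewrite -[leRHS]ger0_norm ?pi_ge0 // -sqrtr_sqr ler_sqrt // sqr_ge0.
have e1 := sinq_sqr (Num.sqrt x); have e2 := cosq_sqr (Num.sqrt x).
rewrite sqr_sqrtr ?ltW // in e1 e2.
have k : 0 < 2 * x * Num.sqrt x by rewrite !mulr_gt0.
rewrite -(pmulr_rle0 _ k) mulrAC dsinqE mulrBl e2 (mulrC (sinq x)) e1 subr_le0 mulrC.
by rewrite sin_ge_mulcos // ltW.
Qed.

End CosSqrt.

Section FlatVersusAdS.
Variable R : realType.
Implicit Types (a b l s : R).

(* Sturm comparison: [w = cos] of the flat distance satisfies [w'' + w >= 0]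
   along a side, the right hand side solves [w'' + w = 0], and both agree at the
   end points. *)
Lemma cosq_stewart_le a b l s : 0 < l < pi -> 0 <= a <= pi -> 0 <= b <= pi ->
  (2 * a * l) ^+ 2 <= (b ^+ 2 - a ^+ 2 - l ^+ 2) ^+ 2 -> 0 <= s <= l ->
  cosq (s * s + (b ^+ 2 - a ^+ 2 - l ^+ 2) / l * s + a ^+ 2) * sin l <=
  sin (l - s) * cos a + sin s * cos b.
Proof.
move=> /andP[l0 lpi] /andP[a0 api] /andP[b0 bpi] disc /andP[s0 sl].
set be := _ / l; pose q t := t * t + be * t + a ^+ 2.
have bel : be * l = b ^+ 2 - a ^+ 2 - l ^+ 2 by rewrite divfK // gt_eqF.
(* This is the discriminant of [q], the squared flat separation along the side; the hypothesis on
   [a], [b], [l] is a form of the reverse triangle inequality. *)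
have disc' : 0 <= be ^+ 2 - 4 * a ^+ 2.
  rewrite -(pmulr_lge0 _ (exprn_gt0 2 l0)) mulrBl -exprMn bel; move: disc; lra.
have q0 : q 0 = a ^+ 2 by rewrite /q; ring.
have ql : q l = b ^+ 2 by rewrite /q bel; ring.
(* By convexity [q] stays below its chord, hence in the range where [dsinq] is nonpositive. *)
have qpi t : 0 <= t -> t <= l -> q t <= pi ^+ 2.
  move=> t0 tl.
  have ha : a ^+ 2 <= pi ^+ 2 by rewrite ler_pXn2r ?nnegrE ?pi_ge0.
  have hb : b ^+ 2 <= pi ^+ 2 by rewrite ler_pXn2r ?nnegrE ?pi_ge0.
  rewrite -(ler_pM2r l0).
  have -> : q t * l = (l - t) * a ^+ 2 + t * b ^+ 2 - l * (t * (l - t)).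
    by rewrite -ql /q; ring.
  have h1 : (l - t) * a ^+ 2 <= (l - t) * pi ^+ 2 by rewrite ler_wpM2l // subr_ge0.
  have h2 : t * b ^+ 2 <= t * pi ^+ 2 by rewrite ler_wpM2l.
  have h3 : 0 <= l * (t * (l - t)) by rewrite !mulr_ge0 ?subr_ge0 // ltW.
  by move: h1 h2 h3; lra.
have sl0 : 0 < sin l by rewrite sin_gt0_pi // l0.
clearbody be.
have Dq t : der q t (2 * t + be).
  by rewrite /q; apply: der_eq; [dv_real|rewrite /= /id; ring].
have Dc t : der (fun t => cosq (q t)) t (- sinq (q t) / 2 * (2 * t + be)).
  exact: dv_comp (der_cosq _) (Dq t).
have Ds t : der (fun t => sinq (q t)) t (dsinq (q t) * (2 * t + be)).
  exact: dv_comp (der_sinq _) (Dq t).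
pose W t := sin (l - t) * cos a + sin t * cos b - cosq (q t) * sin l.
pose W' t := - (cos (l - t) * cos a) + cos t * cos b + sinq (q t) / 2 * (2 * t + be) * sin l.
(* The Wronskian of [W] and [sin]: its derivative is [(W'' + W) * sin], and [W / sin] has derivative
   [N / sin ^ 2]. So [N <= 0] makes [W / sin] nonincreasing down to its value 0 at [l]. *)
pose N t := W' t * sin t - W t * cos t.
have DW t : der W t (W' t).
  have := Dc t => Dct.
  by rewrite /W /W'; apply: der_eq; [dv_real|rewrite /= /id; ring].
have DN t : der N t (dsinq (q t) / 2 * (be ^+ 2 - 4 * a ^+ 2) * sin l * sin t).
  have := DW t => DWt; have := Ds t => Dst.
  have E := dsinqE (q t).
  rewrite /N /W'; apply: der_eq; first by dv_real.
  rewrite /= /id /W /W'.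
  transitivity (sin t * sin l * (sinq (q t) + dsinq (q t) / 2 * (2 * t + be) ^+ 2 - cosq (q t))).
    by field.
  rewrite (_ : cosq (q t) = 2 * q t * dsinq (q t) + sinq (q t)); last by rewrite E; ring.
  by move: (dsinq (q t)) (sinq (q t)) => d1 d2; rewrite /q; field.
have W0 : W 0 = 0.
  by rewrite /W q0 cosq_sqr subr0 sin0 mul0r addr0 mulrC subrr.
have Wl : W l = 0.
  by rewrite /W ql cosq_sqr subrr sin0 mul0r add0r mulrC subrr.
have Nle t : 0 <= t -> t <= l -> N t <= 0.
  move=> t0 tl; have -> : 0 = N 0 by rewrite /N W0 sin0 mulr0 mul0r subrr.
  apply: (derivative_le0 t0 (fun x _ => DN x)) => x /andP[x0 xt].
  rewrite mulr_le0_ge0 ?sin_ge0_pi ?(ltW x0) ?(ltW (lt_le_trans xt _)) //; last first.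
    by rewrite (le_trans tl) // ltW.
  rewrite mulr_le0_ge0 ?(ltW sl0) // mulr_le0_ge0 // pmulr_lle0 //.
  by rewrite dsinq_le0 // qpi ?ltW // (lt_le_trans xt).
suff : 0 <= W s by rewrite subr_ge0.
have [->|s0'] : s = 0 \/ 0 < s by move: s0; rewrite le_eqVlt => /orP[/eqP <-|]; [left|right].
  by rewrite W0.
have ss0 t : s <= t -> t <= l -> 0 < sin t.
  by move=> st tl; rewrite sin_gt0_pi // (lt_le_trans s0') //= (le_lt_trans tl).
have : W l / sin l <= W s / sin s.
  apply: (@derivative_le0 _ (fun t => W t / sin t) (fun t => N t / sin t ^+ 2) s l sl).
    move=> t /andP[st tl]; have st0 := ss0 t st tl.
    have := DW t => DWt.
    apply: der_eq; first by dv_real; rewrite gt_eqF.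
    by rewrite /= /N; field; rewrite gt_eqF.
  move=> t /andP[/ltW st /ltW tl]; apply: mulr_le0_ge0; last by rewrite invr_ge0 sqr_ge0.
  by apply: Nle => //; exact: le_trans st.
by rewrite Wl mul0r pmulr_lge0 // invr_gt0 ss0.
Qed.

(** The flat value [D] may be negative, and then [cos e <= 1 <= cosq D]. Otherwise [cosq D] is the
    cosine of its square root, and [cos] decreases on [[0, pi]]. *)
Lemma cos_sqrt_stewart_le a b l lam e : 0 < l < pi -> 0 <= a <= pi -> 0 <= b <= pi ->
  (2 * a * l) ^+ 2 <= (b ^+ 2 - a ^+ 2 - l ^+ 2) ^+ 2 -> 0 <= lam <= 1 ->
  0 <= e <= pi ->
  (1 - lam) * a ^+ 2 + lam * b ^+ 2 - lam * (1 - lam) * l ^+ 2 <= e ^+ 2 ->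
  cos e * sin l <= sin (l - lam * l) * cos a + sin (lam * l) * cos b.
Proof.
move=> hl ha hb disc /andP[lam0 lam1] /andP[e0 epi] De; case/andP: (hl) => l0 lpi.
have hs : 0 <= lam * l <= l.
  by rewrite mulr_ge0 ?(ltW l0) //= -[leRHS]mul1r ler_wpM2r // ltW.
apply: le_trans (cosq_stewart_le hl ha hb disc hs).
rewrite (_ : _ + _ = (1 - lam) * a ^+ 2 + lam * b ^+ 2 - lam * (1 - lam) * l ^+ 2); last first.
  by field; rewrite gt_eqF.
set D := _ - _ in De *; rewrite ler_wpM2r ?sin_ge0_pi ?(ltW l0) ?(ltW lpi) //.
have [D0|D0] := lerP D 0; first by rewrite (le_trans (cos_le1 e)) // cosq_ge1.
rewrite -[D]sqr_sqrtr ?(ltW D0) // cosq_sqr.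
have h : Num.sqrt D <= e.
  by rewrite -[leRHS]ger0_norm // -sqrtr_sqr ler_sqrt // sqr_ge0.
rewrite leNgt ltr_cos ?in_itv /= ?sqrtr_ge0 ?e0 ?epi ?(le_trans h) // -leNgt //.
Qed.

End FlatVersusAdS.

(** * Time separation of the model space *)

Section Increments.
Variable R : realType.
Implicit Types (f g F : R -> R) (a b s : R).
Local Notation mu := (@lebesgue_measure R).

Lemma continuous_at_within f a b : (forall s, a <= s <= b -> continuous_at s f) ->
  {within `[a, b], continuous f}.
Proof.
by move=> H; apply: continuous_in_subspaceT => s; rewrite inE /= in_itv /=; exact: H.
Qed.

Lemma measurable_continuous_at f a b : (forall s, a <= s <= b -> continuous_at s f) ->
  measurable_fun `[a, b] f.
Proof.
move=> H; apply: subspace_continuous_measurable_fun => //.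
exact: continuous_at_within.
Qed.

Lemma integral_der F f a b : a < b ->
  (forall s, a <= s <= b -> der F s (f s)) ->
  (forall s, a <= s <= b -> continuous_at s f) ->
  (\int[mu]_(s in `[a, b]) (f s)%:E = (F b - F a)%:E)%E.
Proof.
move=> ab dF cf; rewrite EFinB; apply: continuous_FTC2 => //.
- exact: continuous_at_within.
- split.
  + move=> s; rewrite in_itv /= => /andP[h1 h2].
    by have [] := dF s; rewrite ?ltW.
  + by apply: cvg_at_right_filter; apply: dv_continuous (dF a _); rewrite lexx ltW.
  + by apply: cvg_at_left_filter; apply: dv_continuous (dF b _); rewrite lexx ltW.
- move=> s; rewrite in_itv /= => /andP[h1 h2]; rewrite derive1E.
  by have [] := dF s; rewrite ?ltW.
Qed.

Lemma integral_le_increment g F f a b : a < b ->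
  (forall s, a <= s <= b -> der F s (f s)) ->
  (forall s, a <= s <= b -> continuous_at s f) ->
  (forall s, a <= s <= b -> continuous_at s g) ->
  (forall s, a <= s <= b -> 0 <= g s <= f s) ->
  (\int[mu]_(s in `[a, b]) (g s)%:E <= (F b - F a)%:E)%E.
Proof.
move=> ab dF cf cg gf; rewrite -(integral_der ab dF cf).
apply: ge0_le_integral => //=.
- by move=> s; rewrite in_itv /= => /gf /andP[h _]; rewrite lee_fin.
- by apply/measurable_EFinP; exact: measurable_continuous_at.
- by apply/measurable_EFinP; exact: measurable_continuous_at.
- by move=> s; rewrite in_itv /= => /gf /andP[_ h]; rewrite lee_fin.
Qed.

End Increments.

(** * Hyperbolic functions and the conformal coordinate *)

Section Hyperbolic.
Variable R : realType.
Implicit Types (r s : R) (f : R -> R).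

Definition sinh r : R := (expR r - expR (- r)) / 2.

Lemma coshD_sinhB r : cosh r ^+ 2 - sinh r ^+ 2 = 1.
Proof.
have K : expR r * expR (- r) = 1 by rewrite -expRD subrr expR0.
rewrite /cosh /sinh; move: K; move: (expR r) (expR (- r)) => a b K.
by rewrite -[RHS]K; field.
Qed.

Lemma cosh_gt0 r : 0 < cosh r.
Proof. by rewrite divr_gt0 // addr_gt0 ?expR_gt0. Qed.

Lemma coshM_gt0 r s : 0 < cosh r * cosh s.
Proof. by apply: mulr_gt0; exact: cosh_gt0. Qed.

Lemma cosh2 r : cosh r ^+ 2 = 1 + sinh r ^+ 2.
Proof. by rewrite -(coshD_sinhB r) subrK. Qed.

Lemma dv_cosh f s (df : R) : der f s df -> der (fun s => cosh (f s)) s (sinh (f s) * df).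
Proof.
by move=> h; rewrite /cosh /sinh; apply: der_eq; [dv_real|rewrite /= /id; ring].
Qed.

Lemma dv_sinh f s (df : R) : der f s df -> der (fun s => sinh (f s)) s (cosh (f s) * df).
Proof.
by move=> h; rewrite /cosh /sinh; apply: der_eq; [dv_real|rewrite /= /id; ring].
Qed.

(* The conformal coordinate: the model metric is
   [(cosh r) ^ 2 (- dt ^ 2 + dth ^ 2)] with [th = thr r] in [(-pi/2, pi/2)]. *)
Definition thr r : R := atan (sinh r).

Lemma thr_bound r : - (pi / 2) < thr r < pi / 2.
Proof. by rewrite /thr atan_gtNpi2 atan_ltpi2. Qed.

Lemma cos_thr r : cos (thr r) = (cosh r)^-1.
Proof. by rewrite /thr cos_atan -cosh2 sqrtr_sqr ger0_norm // ltW // cosh_gt0. Qed.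

Lemma sin_thr r : sin (thr r) = sinh r / cosh r.
Proof.
have c0 : cos (thr r) != 0 by rewrite cos_thr invr_neq0 // gt_eqF // cosh_gt0.
have := atanK (sinh r); rewrite -/(thr r) /tan => <-.
by rewrite cos_thr invrK mulfK // gt_eqF // cosh_gt0.
Qed.

Lemma dv_thr f s (df : R) : der f s df -> der (fun s => thr (f s)) s (df / cosh (f s)).
Proof.
move=> h; rewrite /thr; apply: der_eq; first exact: dv_atan (dv_sinh h).
by rewrite -cosh2; field; rewrite gt_eqF // cosh_gt0.
Qed.

End Hyperbolic.

(** * The bilinear form and the causal relation of the model *)

Section ModelForm.
Variable R : realType.
Implicit Types (p q m x y : R * R).

(** Minus the bilinear form of the quadric, at the images of the points under the covering map. *)
Definition mC p q : R :=
  cosh p.2 * cosh q.2 * cos (q.1 - p.1) - sinh p.2 * sinh q.2.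
(** The causal relation, read off in the conformal strip. *)
Definition mle p q : Prop := `|thr q.2 - thr p.2| <= q.1 - p.1.
(** This says that [q] is in the chronological past of [(p.1 + pi, - p.2)], the antipode of [p],
    where the timelike geodesics from [p] meet again. *)
Definition mN p q : Prop := q.1 - p.1 + `|thr p.2 + thr q.2| < pi.

Lemma mC_sym p q : mC p q = mC q p.
Proof. by rewrite /mC -(cosN (q.1 - p.1)) opprB; ring. Qed.

Lemma mCxx p : mC p p = 1.
Proof. by rewrite /mC subrr cos0 mulr1 -!expr2 coshD_sinhB. Qed.

(** In conformal coordinates the form becomes a difference of cosines, whose sign compares the
    increments of [t] and [thr]. In the same way [mC_add1] locates [q] relative to the antipode of
    [p]. *)
Lemma mC_sub1 p q :
  mC p q - 1 = cosh p.2 * cosh q.2 * (cos (q.1 - p.1) - cos (thr q.2 - thr p.2)).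
Proof.
rewrite (cosB (thr q.2)) !cos_thr !sin_thr /mC.
have := cosh_gt0 p.2; have := cosh_gt0 q.2; have := coshD_sinhB p.2.
move: (cosh p.2) (cosh q.2) (sinh p.2) (sinh q.2) => a b c d _ b0 a0.
by field; rewrite !gt_eqF.
Qed.

Lemma mC_add1 p q :
  mC p q + 1 = cosh p.2 * cosh q.2 * (cos (q.1 - p.1) + cos (thr p.2 + thr q.2)).
Proof.
rewrite (cosD (thr p.2)) !cos_thr !sin_thr /mC.
have := cosh_gt0 p.2; have := cosh_gt0 q.2.
move: (cosh p.2) (cosh q.2) (sinh p.2) (sinh q.2) => a b c d b0 a0.
by field; rewrite !gt_eqF.
Qed.

Lemma cos_lt_norm (u v : R) : `|u| < v -> v <= pi -> cos v < cos u.
Proof.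
move=> uv vpi; have -> : cos u = cos `|u|.
  by case: (ger0P u) => _ //; rewrite cosN.
have v0 : 0 <= v by apply: le_trans (ltW uv).
have upi : `|u| <= pi by apply: le_trans (ltW uv) vpi.
by rewrite ltr_cos // in_itv /= ?normr_ge0 ?v0 ?upi.
Qed.

Lemma cos_le_norm (u v : R) : `|u| <= v -> v <= pi -> cos v <= cos u.
Proof.
rewrite le_eqVlt => /orP[/eqP <- _|uv vpi]; last by rewrite ltW // cos_lt_norm.
by case: (ger0P u) => _ //; rewrite cosN.
Qed.

Lemma mN_ltpi p q : mN p q -> q.1 - p.1 < pi.
Proof. by rewrite /mN; have := normr_ge0 (thr p.2 + thr q.2); lra. Qed.

Lemma mC_le1 p q : mle p q -> mN p q -> mC p q <= 1.
Proof.
move=> h1 /mN_ltpi/ltW h2; rewrite -subr_le0 mC_sub1 pmulr_rle0 ?coshM_gt0 //.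
by rewrite subr_le0 cos_le_norm.
Qed.

Lemma mC_lt1 p q : `|thr q.2 - thr p.2| < q.1 - p.1 -> mN p q -> mC p q < 1.
Proof.
move=> h1 /mN_ltpi/ltW h2; rewrite -subr_lt0 mC_sub1 pmulr_rlt0 ?coshM_gt0 //.
by rewrite subr_lt0 cos_lt_norm.
Qed.

Lemma mC_gtN1 p q : mle p q -> mN p q -> -1 < mC p q.
Proof.
move=> h1 h2; rewrite -subr_gt0 opprK mC_add1 pmulr_rgt0 ?coshM_gt0 //.
have h3 : 0 <= q.1 - p.1 by apply: le_trans h1.
have e (y : R) : cos y = - cos (pi - `|y|).
  by rewrite (addrC pi) cosDpi cosN opprK; case: (ger0P y) => // _; rewrite cosN.
rewrite (e (thr _ + _)) subr_gt0; apply: cos_lt_norm.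
  by rewrite ger0_norm //; move: h2; rewrite /mN; lra.
by have := normr_ge0 (thr p.2 + thr q.2); lra.
Qed.

Lemma mle_refl p : mle p p.
Proof. by rewrite /mle !subrr normr0. Qed.

Lemma mle_trans m p q : mle p m -> mle m q -> mle p q.
Proof.
rewrite /mle => h1 h2; apply: (@le_trans _ _ (`|thr m.2 - thr p.2| + `|thr q.2 - thr m.2|)).
  rewrite (_ : thr q.2 - thr p.2 = (thr m.2 - thr p.2) + (thr q.2 - thr m.2)); last by ring.
  exact: ler_normD.
by move: h1 h2; lra.
Qed.

Lemma mN_left p m q : mle p m -> mN p q -> mN m q.
Proof.
rewrite /mle /mN => h1 h2.
have : `|thr m.2 + thr q.2| <= `|thr m.2 - thr p.2| + `|thr p.2 + thr q.2|.
  rewrite (_ : thr m.2 + thr q.2 = (thr m.2 - thr p.2) + (thr p.2 + thr q.2)); last by ring.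
  exact: ler_normD.
by move: h1 h2; lra.
Qed.

Lemma mN_right p m q : mle m q -> mN p q -> mN p m.
Proof.
rewrite /mle /mN => h1 h2.
have : `|thr p.2 + thr m.2| <= `|thr q.2 - thr m.2| + `|thr p.2 + thr q.2|.
  rewrite (_ : thr p.2 + thr m.2 = - (thr q.2 - thr m.2) + (thr p.2 + thr q.2)); last by ring.
  by apply: le_trans (ler_normD _ _) _; rewrite normrN.
by move: h1 h2; lra.
Qed.

End ModelForm.

(** * Causal curves of the model and the calibration by [acos] *)

Section ModelCurves.
Variable R : realType.
Implicit Types (p q m x y : R * R) (a b s t : R) (c : R -> R * R).

Definition mcurve p q : Prop := exists a b c, model_causal_from_to a b c p q.

Lemma derivable_der (f : R -> R) s : derivable f s 1 -> der f s (derive1 f s).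
Proof. by move=> h; apply: DeriveDef => //; rewrite derive1E. Qed.

Lemma der_model_vt a b c p q s : model_causal_from_to a b c p q ->
  der (fun u => (c u).1) s (model_vt c s).
Proof. by move=> [_ /(_ s)[h _] _ _ _]; exact: derivable_der. Qed.

Lemma der_model_vr a b c p q s : model_causal_from_to a b c p q ->
  der (fun u => (c u).2) s (model_vr c s).
Proof. by move=> [_ /(_ s)[_ h] _ _ _]; exact: derivable_der. Qed.

Lemma model_speed_bound a b c p q s : model_causal_from_to a b c p q ->
  a <= s <= b -> `|model_vr c s| <= cosh (c s).2 * model_vt c s.
Proof.
move=> [_ _ _ H _] sI; have [] := H s _; first by rewrite in_itv.
move=> v0; rewrite /model_speed2 -exprMn subr_ge0 => h.
have T0 : 0 <= cosh (c s).2 * model_vt c s by rewrite mulr_ge0 // ltW // cosh_gt0.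
by rewrite -(@ler_pXn2r _ 2) ?nnegrE // real_normK // num_real.
Qed.

(** Since [thr] has derivative [1 / cosh], causality of the velocity says that [thr] changes no
    faster than [t]. The signs [e = 1] and [e = -1] give the two bounds. *)
Lemma model_curve_mle a b c p q s t : model_causal_from_to a b c p q ->
  a <= s -> s <= t -> t <= b -> mle (c s) (c t).
Proof.
move=> H as_ st tb.
have key (e : R) : `|e| = 1 ->
    e * (thr (c t).2 - thr (c s).2) <= (c t).1 - (c s).1.
  move=> e1; pose f u := e * thr (c u).2 - (c u).1.
  have df u : s <= u <= t -> der f u (e * (model_vr c u / cosh (c u).2) - model_vt c u).
    move=> _; have h1 := der_model_vt u H; have h2 := dv_thr (der_model_vr u H).
    by rewrite /f; apply: der_eq; [dv_real|rewrite /= /id; ring].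
  have : f t <= f s.
    apply: (derivative_le0 st df) => u /andP[su ut].
    have uI : a <= u <= b by rewrite (le_trans as_ (ltW su)) (le_trans (ltW ut) tb).
    have := model_speed_bound H uI; have c0 := cosh_gt0 (c u).2.
    rewrite -ler_pdivrMl // => h; rewrite subr_le0; apply: le_trans h.
    rewrite mulrC mulrAC ler_pdivrMr // mulrAC mulVf ?gt_eqF // mul1r.
    by apply: le_trans (ler_norm _) _; rewrite normrM e1 mulr1.
  by rewrite /f mulrBr; lra.
rewrite /mle ler_norml; apply/andP; split.
  by have := key (-1); rewrite normrN1 => /(_ erefl); lra.
by have := key 1; rewrite normr1 => /(_ erefl); lra.
Qed.

Lemma model_curve_lt a b c p q : model_causal_from_to a b c p q -> p.1 < q.1.
Proof.
move=> H; have [ab _ _ Hs [ca cb]] := H.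
have [| |u uI e] := @MVT R (fun u => (c u).1) (model_vt c) a b ab.
- by move=> s _; exact: (der_model_vt s H).
- apply: continuous_in_subspaceT => s _.
  exact: dv_continuous (der_model_vt s H).
have [v0 _] : 0 < model_vt c u /\ 0 <= model_speed2 c u.
  by apply: Hs; move: uI; rewrite !in_itv /= => /andP[h1 h2]; rewrite !ltW.
by rewrite -subr_gt0 -ca -cb e mulr_gt0 // subr_gt0.
Qed.

Lemma mcurve_mle p q : mcurve p q -> mle p q /\ p.1 < q.1.
Proof.
move=> [a [b [c H]]]; split; last exact: model_curve_lt H.
have [ab _ _ _ [<- <-]] := H.
by apply: (model_curve_mle H); rewrite ?lexx // ltW.
Qed.

Lemma model_curve_sub a b c p q s t : model_causal_from_to a b c p q ->
  a <= s -> s < t -> t <= b -> model_causal_from_to s t c (c s) (c t).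
Proof.
move=> [ab h1 h2 h3 _] as_ st tb; split => // u; rewrite in_itv /= => /andP[su ut].
by apply: h3; rewrite in_itv /= (le_trans as_) // (le_trans ut).
Qed.

(** Up to sign, [calA] and [calB] are the derivatives of [mC p0] along the unit vectors
    [(cosh r)^-1 d/dt] and [d/dr]. *)
Definition calA p0 p : R := cosh p0.2 * sin (p.1 - p0.1).
Definition calB p0 p : R := cosh p0.2 * sinh p.2 * cos (p.1 - p0.1) - sinh p0.2 * cosh p.2.

(** The eikonal equation: where [mC p0] is strictly between -1 and 1, it says that the gradient of
    [acos (mC p0)] is a unit timelike vector. *)
Lemma mC_gram p0 p : 1 - mC p0 p ^+ 2 = calA p0 p ^+ 2 - calB p0 p ^+ 2.
Proof.
rewrite /mC /calA /calB.
have := coshD_sinhB p0.2; have := coshD_sinhB p.2; have := cos2Dsin2 (p.1 - p0.1).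
move: (cosh p0.2) (sinh p0.2) (cosh p.2) (sinh p.2) (cos _) (sin _) => A B C D k s e1 e2 e3.
transitivity ((C ^+ 2 - D ^+ 2) * (A ^+ 2 * (k ^+ 2 + s ^+ 2) - B ^+ 2) -
   (A * C * k - B * D) ^+ 2).
  by rewrite e1 e2 mulr1 mul1r e3.
transitivity (A ^+ 2 * s ^+ 2 * (C ^+ 2 - D ^+ 2)  - (A * D * k - B * C) ^+ 2).
  ring.
by rewrite e2 mulr1 exprMn.
Qed.

Lemma der_mC p0 c s (vt vr : R) : der (fun u => (c u).1) s vt ->
  der (fun u => (c u).2) s vr ->
  der (fun u => mC p0 (c u)) s
    (- (calA p0 (c s) * (cosh (c s).2 * vt) - calB p0 (c s) * vr)).
Proof.
move=> h1 h2; have h3 := dv_cosh h2; have h4 := dv_sinh h2.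
by rewrite /mC /calA /calB; apply: der_eq; [dv_real|rewrite /= /id; ring].
Qed.

Lemma ct_cosh (f : R -> R) s : continuous_at s f -> continuous_at s (fun s => cosh (f s)).
Proof. by move=> h; rewrite /cosh; ct_real. Qed.

Lemma ct_sinh (f : R -> R) s : continuous_at s f -> continuous_at s (fun s => sinh (f s)).
Proof. by move=> h; rewrite /sinh; ct_real. Qed.

Lemma ct_inv (f : R -> R) s : f s != 0 -> continuous_at s f ->
  continuous_at s (fun s => (f s)^-1).
Proof. by move=> h0 h; exact: cvgV. Qed.

Lemma reversed_schwarz (al be T r : R) : 0 < al ^+ 2 - be ^+ 2 -> 0 < al -> `|r| <= T ->
  Num.sqrt (T ^+ 2 - r ^+ 2) <= (Num.sqrt (al ^+ 2 - be ^+ 2))^-1 * (al * T - be * r).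
Proof.
move=> g0 a0 rT; have T0 : 0 <= T by apply: le_trans rT.
have r2 : r ^+ 2 <= T ^+ 2 by rewrite -real_normK ?num_real // ler_pXn2r ?nnegrE.
have be_al : `|be| <= al.
  rewrite -(@ler_pXn2r _ 2) ?nnegrE ?(ltW a0) // real_normK ?num_real //.
  by rewrite -subr_ge0 ltW.
have h0 : 0 <= al * T - be * r.
  rewrite subr_ge0; apply: le_trans (ler_norm _) _; rewrite normrM.
  by apply: ler_pM.
rewrite ler_pdivlMl ?sqrtr_gt0 // -sqrtrM ?(ltW g0) //.
rewrite -[leRHS]ger0_norm // -sqrtr_sqr ler_sqrt ?sqr_ge0 // -subr_ge0.
rewrite (_ : _ - _ = (al * r - be * T) ^+ 2) ?sqr_ge0 //; ring.
Qed.

Lemma continuous_model_speed a b c p q s : model_causal_from_to a b c p q ->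
  continuous_at s (fun s => Num.sqrt (model_speed2 c s)).
Proof.
move=> H; have [_ _ [ct cr] _ _] := H.
have h1 := ct_cosh (dv_continuous (der_model_vr s H)).
have h2 : continuous_at s (model_vt c) by exact: ct.
have h3 : continuous_at s (model_vr c) by exact: cr.
apply: ct_sqrt.
exact: (ctD (ctM (ctM h1 h1) (ctM h2 h2)) (ctN (ctM h3 h3))).
Qed.

(** The derivative of [acos (mC p0)] along the curve dominates the speed by [reversed_schwarz]; the
    range of the time difference makes [calA] positive, hence [(calA, calB)] future directed. *)
Lemma model_length_le_acos p0 a b c p q : model_causal_from_to a b c p q ->
  (forall s, a <= s <= b -> -1 < mC p0 (c s) < 1 /\ 0 < (c s).1 - p0.1 < pi) ->
  (model_length a b c <= (acos (mC p0 q) - acos (mC p0 p))%:E)%E.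
Proof.
move=> H H0; have [ab _ [ct cr] _ [ca cb]] := H.
pose f s := - (Num.sqrt (1 - mC p0 (c s) ^+ 2))^-1 *
   - (calA p0 (c s) * (cosh (c s).2 * model_vt c s) - calB p0 (c s) * model_vr c s).
rewrite -ca -cb /model_length.
apply: (@integral_le_increment _ _ (fun s => acos (mC p0 (c s))) f) => // s sI.
- have [h _] := H0 s sI.
  exact: (@dv_acos R (fun u => mC p0 (c u)) s _ h (der_mC p0 (der_model_vt s H) (der_model_vr s H))).
- have [/andP[h1 h2] _] := H0 s sI.
  have k1 := dv_continuous (der_model_vt s H).
  have k2 := dv_continuous (der_model_vr s H).
  have k3 := ct_cosh k2; have k4 := ct_sinh k2.
  have k5 : continuous_at s (model_vt c) by exact: ct.
  have k6 : continuous_at s (model_vr c) by exact: cr.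
  have k7 := dv_continuous (der_mC p0 (der_model_vt s H) (der_model_vr s H)).
  have k8 : continuous_at s (fun s => (Num.sqrt (1 - mC p0 (c s) ^+ 2))^-1).
    apply: ct_inv; last by ct_real.
    rewrite gt_eqF // sqrtr_gt0; nra.
  by rewrite /f /calA /calB; ct_real.
- exact: continuous_model_speed H.
- have [/andP[h1 h2] /andP[h3 h4]] := H0 s sI.
  rewrite sqrtr_ge0 /= /f mulrNN mC_gram /model_speed2 -exprMn.
  apply: reversed_schwarz.
  + rewrite -mC_gram; nra.
  + by rewrite /calA mulr_gt0 ?cosh_gt0 // sin_gt0_pi // h3.
  + exact: model_speed_bound H sI.
Qed.

End ModelCurves.

(** * Geodesics and the formula for the model separation *)

Section ModelGeodesics.
Variable R : realType.
Implicit Types (p q m x y : R * R) (a b s t e : R) (c : R -> R * R).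

Lemma near_right (P : R -> Prop) s : (\forall u \near s, P u) -> \forall u \near s^'+, P u.
Proof. by move=> h; rewrite near_withinE; apply: filterS h. Qed.

Lemma near_left (P : R -> Prop) s : (\forall u \near s, P u) -> \forall u \near s^'-, P u.
Proof. by move=> h; rewrite near_withinE; apply: filterS h. Qed.

(** The value [f s = 1] of the light cone is included, and [acos] is not meaningful above 1; hence
    the bound is conditional on [f u <= 1]. *)
Lemma near_acos_lt (f : R -> R) s e : continuous_at s f -> -1 < f s <= 1 -> 0 < e ->
  \forall u \near s, f u <= 1 -> acos (f u) < acos (f s) + e.
Proof.
move=> cf /andP[f1 f2] e0; have n1 : \forall u \near s, -1 < f u by exact: (cvgr_gt _ cf).
have a0 : 0 <= acos (f s) by rewrite acos_ge0 // (ltW f1).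
case: (ltP pi (acos (f s) + e)) => h.
  by apply: filterS n1 => u u1 u2; rewrite (le_lt_trans _ h) // acos_lepi // ltW.
have n2 : \forall u \near s, cos (acos (f s) + e) < f u.
  apply: (cvgr_gt _ cf); rewrite -{2}[f s]acosK ?in_itv /= ?(ltW f1) //.
  rewrite ltr_cos ?in_itv /= ?ltrDl // ?a0 ?acos_lepi ?(ltW f1) //.
  by rewrite addr_ge0 // ltW.
apply: filterS2 n1 n2 => u u1 u2 u3.
have uI : -1 <= f u <= 1 by rewrite (ltW u1).
rewrite -ltr_cos ?in_itv /= ?acos_ge0 ?acos_lepi //; last by rewrite addr_ge0 // ltW.
by rewrite acosK // in_itv.
Qed.

Lemma near_acos_gt (f : R -> R) s e : continuous_at s f -> -1 < f s <= 1 -> 0 < e ->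
  \forall u \near s, f u <= 1 -> acos (f s) - e < acos (f u).
Proof.
move=> cf /andP[f1 f2] e0; have n1 : \forall u \near s, -1 < f u by exact: (cvgr_gt _ cf).
case: (ltP (acos (f s) - e) 0) => h.
  by apply: filterS n1 => u u1 u2; rewrite (lt_le_trans h) // acos_ge0 // ltW.
have api : acos (f s) <= pi by rewrite acos_lepi // (ltW f1).
have n2 : \forall u \near s, f u < cos (acos (f s) - e).
  apply: (cvgr_lt _ cf); rewrite -{1}[f s]acosK ?in_itv /= ?(ltW f1) //.
  rewrite ltr_cos ?in_itv /= ?h ?gtrDl ?oppr_lt0 // ?acos_ge0 ?api ?(ltW f1) //.
  by rewrite (le_trans _ api) // gerDl oppr_le0 ltW.
apply: filterS2 n1 n2 => u u1 u2 u3.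
have uI : -1 <= f u <= 1 by rewrite (ltW u1).
rewrite -ltr_cos ?in_itv /= ?acos_ge0 ?acos_lepi ?h //=; last first.
  by rewrite (le_trans _ api) // gerDl oppr_le0 ltW.
by rewrite acosK // in_itv.
Qed.

Lemma ct_mC_base x y s : continuous_at s (fun u : R => mC (x.1 - u, x.2) y).
Proof. by rewrite /mC /=; ct_real. Qed.

(* The base point is pushed into the past to avoid the singularity of the time
   separation on the light cone. *)
Lemma model_length_le x a b c m y : model_causal_from_to a b c m y ->
  mle x m -> mN x y ->
  (model_length a b c <= (acos (mC x y) - acos (mC x m))%:E)%E.
Proof.
move=> H xm xy; have [ab _ _ _ [ca cb]] := H.
have my : mle m y by rewrite -ca -cb; apply: (model_curve_mle H); rewrite ?lexx ?ltW.
have xy' := mle_trans xm my.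
have xNm := mN_right my xy.
apply/lee_addgt0Pr => e e0; rewrite -EFinD.
pose d0 := pi - (y.1 - x.1 + `|thr x.2 + thr y.2|).
have d00 : 0 < d0 by rewrite subr_gt0.
pose X (u : R) : R * R := (x.1 - u, x.2).
have X0 : X 0 = x by rewrite /X subr0; case: (x).
have e20 : 0 < e / 2 by lra.
have n1 := @near_acos_lt (fun u => mC (X u) y) 0 (e / 2) (@ct_mC_base x y 0).
have n2 := @near_acos_gt (fun u => mC (X u) m) 0 (e / 2) (@ct_mC_base x m 0).
rewrite X0 in n1 n2.
have {}n1 := n1 _ e20; have {}n2 := n2 _ e20.
rewrite (mC_gtN1 xy' xy) (mC_le1 xy' xy) in n1; have {}n1 := n1 isT.
rewrite (mC_gtN1 xm xNm) (mC_le1 xm xNm) in n2; have {}n2 := n2 isT.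
have {n1}m1 := near_right n1; have {n2}m2 := near_right n2.
have [u [u0 ud k1 k2]] : exists u, [/\ 0 < u, u < d0,
    mC (X u) y <= 1 -> acos (mC (X u) y) < acos (mC x y) + e / 2 &
    mC (X u) m <= 1 -> acos (mC x m) - e / 2 < acos (mC (X u) m)].
  near (0 : R)^'+ => u; exists u; split; near: u => //.
  - exact: nbhs_right_gt.
  - exact: nbhs_right_lt.
have mX z : mle x z -> `|thr z.2 - thr (X u).2| < z.1 - (X u).1.
  by rewrite /mle /X /=; lra.
have NX : mN (X u) y by move: ud; rewrite /mN /X /d0 /=; lra.
have cond s : a <= s <= b -> -1 < mC (X u) (c s) < 1 /\ 0 < (c s).1 - (X u).1 < pi.
  move=> /andP[as_ sb].
  have h1 : mle x (c s).
    by apply: mle_trans xm _; rewrite -ca; apply: (model_curve_mle H); rewrite ?lexx.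
  have h2 : mle (c s) y.
    by rewrite -cb; apply: (model_curve_mle H); rewrite ?lexx.
  have h3 := mX _ h1; have h4 := mN_right h2 NX.
  rewrite mC_lt1 // mC_gtN1 //; last exact: ltW.
  by rewrite mN_ltpi // (le_lt_trans _ h3).
apply: le_trans (model_length_le_acos H cond) _; rewrite lee_fin.
have /k1 : mC (X u) y <= 1.
  have /cond[/andP[_ /ltW]] : a <= b <= b by rewrite lexx (ltW ab).
  by rewrite cb.
have /k2 : mC (X u) m <= 1.
  have /cond[/andP[_ /ltW]] : a <= a <= b by rewrite lexx (ltW ab).
  by rewrite ca.
lra.
Unshelve. all: end_near. Qed.

Definition atanh (x : R) : R := (ln (1 + x) - ln (1 - x)) / 2.

Lemma sinh_atanh (x : R) : -1 < x < 1 -> sinh (atanh x) = x * cosh (atanh x).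
Proof.
move=> /andP[x1 x2]; rewrite /sinh /cosh.
have h : expR (atanh x) * expR (atanh x) * (1 - x) = 1 + x.
  rewrite -expRD -splitr expRD expRN !lnK ?posrE; [|lra|lra].
  by rewrite divfK // gt_eqF //; lra.
have h' : expR (atanh x) * expR (- atanh x) = 1 by rewrite -expRD subrr expR0.
have n : expR (atanh x) != 0 by rewrite gt_eqF // expR_gt0.
suff : expR (atanh x) * (1 - x) = expR (- atanh x) * (1 + x) by lra.
by apply: (mulfI n); rewrite mulrA h mulrA h' mul1r.
Qed.

Lemma cosh_atanh (x : R) : -1 < x < 1 -> cosh (atanh x) ^+ 2 * (1 - x ^+ 2) = 1.
Proof.
by move=> h; rewrite mulrBr mulr1 -exprMn (mulrC _ x) -sinh_atanh // coshD_sinhB.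
Qed.

Lemma atanh_tanh (r : R) : atanh (sinh r / cosh r) = r.
Proof.
have c0 := cosh_gt0 r; have c1 : cosh r != 0 by rewrite gt_eqF.
have e1 : 1 + sinh r / cosh r = expR r / cosh r.
  by rewrite -{1}(divff c1) -mulrDl; congr (_ / _); rewrite /sinh /cosh; field.
have e2 : 1 - sinh r / cosh r = expR (- r) / cosh r.
  by rewrite -{1}(divff c1) -mulrBl; congr (_ / _); rewrite /sinh /cosh; field.
by rewrite /atanh e1 e2 !lnM ?posrE ?invr_gt0 ?expR_gt0 // !expRK; field.
Qed.

Lemma dv_atanh (f : R -> R) s (df : R) : -1 < f s < 1 -> der f s df ->
  der (fun s => atanh (f s)) s (df * cosh (atanh (f s)) ^+ 2).
Proof.
move=> h hf; have k := cosh_atanh h; case/andP: (h) => h1 h2.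
have n1 : 0 < 1 + f s by lra.
have n2 : 0 < 1 - f s by lra.
have d1 : der (fun s => ln (1 + f s)) s ((1 + f s)^-1 * (0 + df)).
  by apply: (@dv_ln _ (fun s => 1 + f s)) => //; dv_real.
have d2 : der (fun s => ln (1 - f s)) s ((1 - f s)^-1 * (0 - df)).
  by apply: (@dv_ln _ (fun s => 1 - f s)) => //; dv_real.
rewrite /atanh; apply: der_eq; first by dv_real.
rewrite /= -/(atanh _).
have -> : cosh (atanh (f s)) ^+ 2 = (1 - f s ^+ 2)^-1.
  apply: (mulIf (lt0r_neq0 (_ : 0 < 1 - f s ^+ 2))); first by nra.
  by rewrite k mulVf // gt_eqF //; nra.
by field; rewrite !gt_eqF //; nra.
Qed.

Section Geodesic.
Variables (A B : R).
Hypothesis AB : A ^+ 2 + B ^+ 2 < 1.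

(** The curve [tanh r = A * cos t + B * sin t] lifts the section of the quadric by the plane
    [z = A * x + B * y]; the hypothesis [AB] makes it timelike. *)
Definition gx t : R := A * cos t + B * sin t.
Definition gx' t : R := B * cos t - A * sin t.
Definition geo t : R * R := (t, atanh (gx t)).

Lemma gx_sum t : gx t ^+ 2 + gx' t ^+ 2 = A ^+ 2 + B ^+ 2.
Proof.
rewrite /gx /gx' -[RHS]mulr1 -(cos2Dsin2 t); ring.
Qed.

Lemma gx_bound t : -1 < gx t < 1.
Proof.
have := gx_sum t; have := sqr_ge0 (gx' t); move: AB => h1 h2 h3.
apply/andP; split; nra.
Qed.

Lemma der_gx t : der gx t (gx' t).
Proof. by rewrite /gx /gx'; apply: der_eq; [dv_real|rewrite /= /id; ring]. Qed.

Lemma der_geo2 t : der (fun t => (geo t).2) t (gx' t * cosh (geo t).2 ^+ 2).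
Proof. exact: dv_atanh (gx_bound t) (der_gx t). Qed.

Lemma der_geo1 t : der (fun t => (geo t).1) t 1.
Proof. exact: dv_id. Qed.

Lemma der_val (f : R -> R) s (df : R) : der f s df -> derive1 f s = df.
Proof. by move=> h; rewrite derive1E; case: h. Qed.

Lemma geo_vt t : model_vt geo t = 1.
Proof. exact: der_val (der_geo1 t). Qed.

Lemma geo_vr t : model_vr geo t = gx' t * cosh (geo t).2 ^+ 2.
Proof. exact: der_val (der_geo2 t). Qed.

Lemma cosh_geo t : cosh (geo t).2 ^+ 2 * (1 - gx t ^+ 2) = 1.
Proof. exact: cosh_atanh (gx_bound t). Qed.

Lemma sinh_geo t : sinh (geo t).2 = gx t * cosh (geo t).2.
Proof. exact: sinh_atanh (gx_bound t). Qed.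

Lemma geo_def t : 0 < 1 - cosh (geo t).2 ^+ 2 * gx' t ^+ 2.
Proof.
have h1 := cosh_geo t; have h2 := gx_sum t.
have h3 : 0 < cosh (geo t).2 ^+ 2 by rewrite exprn_gt0 // cosh_gt0.
have -> : 1 - cosh (geo t).2 ^+ 2 * gx' t ^+ 2 =
   cosh (geo t).2 ^+ 2 * (1 - (A ^+ 2 + B ^+ 2)) by rewrite -h2 -{1}h1; ring.
by rewrite mulr_gt0 // subr_gt0.
Qed.

Lemma geo_speed2 t :
  model_speed2 geo t = cosh (geo t).2 ^+ 2 - (gx' t * cosh (geo t).2 ^+ 2) ^+ 2.
Proof. by rewrite /model_speed2 geo_vt geo_vr expr1n mulr1. Qed.

Lemma geo_speed2_gt0 t : 0 < model_speed2 geo t.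
Proof.
rewrite geo_speed2 (_ : _ - _ = cosh (geo t).2 ^+ 2 * (1 - cosh (geo t).2 ^+ 2 * gx' t ^+ 2)); last by ring.
by rewrite mulr_gt0 ?geo_def // exprn_gt0 // cosh_gt0.
Qed.

Lemma gx_shift t0 t : gx t0 = gx t * cos (t - t0) - gx' t * sin (t - t0).
Proof.
rewrite /gx /gx' cosB sinB.
have := cos2Dsin2 t; move: (cos t) (sin t) (cos t0) (sin t0) => k s k0 s0 e.
transitivity ((A * k0 + B * s0) * (k ^+ 2 + s ^+ 2)); [by rewrite e mulr1|ring].
Qed.

Lemma geo_calB t0 t : calB (geo t0) (geo t) =
  cosh (geo t0).2 * cosh (geo t).2 * gx' t * sin (t - t0).
Proof.
rewrite /calB !sinh_geo; have -> : (geo t).1 - (geo t0).1 = t - t0 by [].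
rewrite (gx_shift t0 t); ring.
Qed.

Lemma geo_calA t0 t : calA (geo t0) (geo t) = cosh (geo t0).2 * sin (t - t0).
Proof. by []. Qed.

(** The velocity is parallel to the gradient of the calibration, which is the equality case of
    [reversed_schwarz]. *)
Lemma geo_collinear t0 t :
  calA (geo t0) (geo t) * model_vr geo t =
  calB (geo t0) (geo t) * (cosh (geo t).2 * model_vt geo t).
Proof. by rewrite geo_calA geo_calB geo_vr geo_vt; ring. Qed.

Lemma geo_mC t0 t : 0 < t - t0 < pi -> -1 < mC (geo t0) (geo t) < 1.
Proof.
move=> h; have s0 : 0 < sin (t - t0) by rewrite sin_gt0_pi.
have : 0 < 1 - mC (geo t0) (geo t) ^+ 2.
  rewrite mC_gram geo_calA geo_calB.
  rewrite (_ : _ - _ = (cosh (geo t0).2 * sin (t - t0)) ^+ 2 * (1 - cosh (geo t).2 ^+ 2 * gx' t ^+ 2)); last by ring.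
  by rewrite mulr_gt0 ?geo_def // exprn_gt0 // mulr_gt0 // cosh_gt0.
by move=> k; apply/andP; split; nra.
Qed.

Lemma geo_causal s t : s < t -> model_causal_from_to s t geo (geo s) (geo t).
Proof.
move=> st; split => //.
- by move=> u; split; [have [] := der_geo1 u|have [] := der_geo2 u].
- split.
    by have -> : model_vt geo = cst 1; [apply/funext => u; exact: geo_vt|exact: cst_continuous].
  have -> : model_vr geo = (fun u => gx' u * cosh (geo u).2 ^+ 2).
    by apply/funext => u; exact: geo_vr.
  move=> u; have h := ct_cosh (dv_continuous (der_geo2 u)).
  suff : continuous_at u (fun u => gx' u * cosh (geo u).2 ^+ 2) by [].
  by rewrite /gx'; ct_real.
- by move=> u _; rewrite geo_vt ltr01 ltW // geo_speed2_gt0.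
Qed.

Lemma geo_length_base t0 s t : t0 < s -> s < t -> t - t0 < pi ->
  model_length s t geo = (acos (mC (geo t0) (geo t)) - acos (mC (geo t0) (geo s)))%:E.
Proof.
move=> t0s st tpi; have H := geo_causal st.
rewrite /model_length.
apply: (@integral_der _ (fun u => acos (mC (geo t0) (geo u)))) => // u /andP[su ut].
  have uI : 0 < u - t0 < pi by apply/andP; split; lra.
  have h := geo_mC uI; case/andP: (h) => h1 h2.
  apply: der_eq.
    exact: (@dv_acos R (fun u => mC (geo t0) (geo u)) u _ h (der_mC (geo t0) (der_model_vt u H) (der_model_vr u H))).
  have g0 : 0 < 1 - mC (geo t0) (geo u) ^+ 2 by nra.
  have := geo_collinear t0 u; have a0 : 0 < calA (geo t0) (geo u).
    by rewrite geo_calA mulr_gt0 ?cosh_gt0 // sin_gt0_pi.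
  have T0 : 0 < cosh (geo u).2 * model_vt geo u by rewrite geo_vt mulr1 cosh_gt0.
  have sp := geo_speed2_gt0 u; rewrite /model_speed2 -exprMn in sp *.
  rewrite mC_gram in g0 *; rewrite mulrNN.
  move: a0 T0 sp g0; move: (calA _ _) (calB _ _) (cosh _ * _) (model_vr _ _) => al be T r.
  move=> a0 T0 sp g0 e.
  have h0 : 0 <= al * T - be * r.
    rewrite -(pmulr_rge0 _ T0) (_ : T * _ = al * T ^+ 2 - (be * T) * r); last by ring.
    by rewrite -e (_ : _ - _ = al * (T ^+ 2 - r ^+ 2)) ?mulr_ge0 ?ltW //; ring.
  have n0 : Num.sqrt (al ^+ 2 - be ^+ 2) != 0 by rewrite gt_eqF // sqrtr_gt0.
  apply: (mulfI n0); rewrite mulrA divff // mul1r -sqrtrM ?(ltW g0) //.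
  rewrite -[LHS]ger0_norm // -sqrtr_sqr; congr Num.sqrt.
  rewrite [RHS](_ : _ = (al * T - be * r) ^+ 2 - (al * r - be * T) ^+ 2); last by ring.
  by rewrite e subrr expr0n subr0.
exact: continuous_model_speed H.
Qed.

(** The calibration is singular at its base point, so [geo_length_base] starts from an earlier point
    of the same geodesic, which then tends to [geo s]. *)
Lemma geo_length_ge s t : s < t -> t - s < pi ->
  ((acos (mC (geo s) (geo t)))%:E <= model_length s t geo)%E.
Proof.
move=> st tpi; apply/lee_addgt0Pr => e e0.
have cG z : continuous_at s (fun u => mC (geo u) z).
  have h2 := dv_continuous (der_geo2 s).
  have h1 := dv_continuous (der_geo1 s).
  have h3 := ct_cosh h2; have h4 := ct_sinh h2.
  by rewrite /mC; ct_real.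
have e20 : 0 < e / 2 by lra.
have stI : 0 < t - s < pi by rewrite subr_gt0 st.
case/andP: (geo_mC stI) => h1 h2.
have n1 := @near_acos_gt (fun u => mC (geo u) (geo t)) s (e / 2) (cG _) _ e20.
rewrite h1 (ltW h2) in n1; have {}n1 := n1 isT.
have n2 := @near_acos_lt (fun u => mC (geo u) (geo s)) s (e / 2) (cG _) _ e20.
rewrite mCxx lexx acos1 add0r in n2.
have {}n2 : \forall u \near s, mC (geo u) (geo s) <= 1 -> acos (mC (geo u) (geo s)) < e / 2.
  by apply: n2; rewrite andbT; lra.
have {n1}m1 := near_left n1; have {n2}m2 := near_left n2.
have [u [us ut k1 k2]] : exists u, [/\ u < s, t - pi < u,
    mC (geo u) (geo t) <= 1 -> acos (mC (geo s) (geo t)) - e / 2 < acos (mC (geo u) (geo t)) &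
    mC (geo u) (geo s) <= 1 -> acos (mC (geo u) (geo s)) < e / 2].
  near s^'- => u; exists u; split; near: u => //.
  - exact: nbhs_left_lt.
  - by apply: nbhs_left_gt; lra.
rewrite (@geo_length_base u) //; last by lra.
rewrite -EFinD lee_fin.
have /k1 : mC (geo u) (geo t) <= 1.
  by have /andP[_ /ltW] : -1 < mC (geo u) (geo t) < 1 by apply: geo_mC; apply/andP; split; lra.
have /k2 : mC (geo u) (geo s) <= 1.
  by have /andP[_ /ltW] : -1 < mC (geo u) (geo s) < 1 by apply: geo_mC; apply/andP; split; lra.
lra.
Unshelve. all: end_near. Qed.

End Geodesic.

(** Cramer's rule for the plane through the origin and the two points. After clearing denominators,
    [A ^ 2 + B ^ 2 < 1] is the Gram condition [mC p q ^ 2 < 1]. *)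
Lemma exists_geo p q : 0 < q.1 - p.1 < pi -> -1 < mC p q < 1 ->
  exists A B, [/\ A ^+ 2 + B ^+ 2 < 1, geo A B p.1 = p & geo A B q.1 = q].
Proof.
move=> h1 h2; have s0 : 0 < sin (q.1 - p.1) by rewrite sin_gt0_pi.
have sn : sin (q.1 - p.1) != 0 by rewrite gt_eqF.
pose xp := sinh p.2 / cosh p.2; pose xq := sinh q.2 / cosh q.2.
exists ((xp * sin q.1 - xq * sin p.1) / sin (q.1 - p.1)),
  ((xq * cos p.1 - xp * cos q.1) / sin (q.1 - p.1)).
split.
- have : mC p q ^+ 2 < 1 by case/andP: h2 => *; nra.
  have cp := cosh_gt0 p.2; have cq := cosh_gt0 q.2.
  have e1 : cosh p.2 ^+ 2 * (1 - xp ^+ 2) = 1.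
    by rewrite -[RHS](coshD_sinhB p.2) /xp; field; rewrite gt_eqF.
  have e2 : cosh q.2 ^+ 2 * (1 - xq ^+ 2) = 1.
    by rewrite -[RHS](coshD_sinhB q.2) /xq; field; rewrite gt_eqF.
  have -> : mC p q = cosh p.2 * cosh q.2 * (cos (q.1 - p.1) - xp * xq).
    by rewrite /mC /xp /xq; field; rewrite !gt_eqF.
  have one : 1 = (cosh p.2 * cosh q.2) ^+ 2 * ((1 - xp ^+ 2) * (1 - xq ^+ 2)).
    by rewrite exprMn mulrACA e1 e2 mulr1.
  rewrite exprMn => h; rewrite [ltRHS]one ltr_pM2l ?exprn_gt0 ?coshM_gt0 // in h.
  rewrite !expr_div_n -mulrDl ltr_pdivrMr ?exprn_gt0 // mul1r.
  have e3 : (xp * sin q.1 - xq * sin p.1) ^+ 2 + (xq * cos p.1 - xp * cos q.1) ^+ 2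
    = xp ^+ 2 + xq ^+ 2 - 2 * xp * xq * cos (q.1 - p.1).
    rewrite cosB; have := cos2Dsin2 p.1; have := cos2Dsin2 q.1.
    move: (cos p.1) (sin p.1) (cos q.1) (sin q.1) => k s k' s' f1 f2.
    transitivity (xp ^+ 2 * (k' ^+ 2 + s' ^+ 2) + xq ^+ 2 * (k ^+ 2 + s ^+ 2) - 2 * xp * xq * (k' * k + s' * s)); first by ring.
    by rewrite f1 f2 !mulr1.
  rewrite e3; have := cos2Dsin2 (q.1 - p.1); move: h; clear.
  move: (cos _) (sin _) => k s h e; nra.
- transitivity (p.1, p.2); last by case: (p).
  rewrite /geo /gx; congr pair.
  rewrite -[RHS]atanh_tanh; congr atanh; rewrite -/xp; move: sn; rewrite sinB => sn.
  by field.
- transitivity (q.1, q.2); last by case: (q).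
  rewrite /geo /gx; congr pair.
  rewrite -[RHS]atanh_tanh; congr atanh; rewrite -/xq; move: sn; rewrite sinB => sn.
  by field.
Qed.

Lemma model_tau_ge0 p q : (0 <= model_tau p q)%E.
Proof. by apply: ereal_sup_ubound; left. Qed.

Lemma model_tau_ge a b c p q : model_causal_from_to a b c p q ->
  (model_length a b c <= model_tau p q)%E.
Proof. by move=> H; apply: ereal_sup_ubound; right; exists a, b, c. Qed.

Lemma mC_lt1_lt p q : mle p q -> mC p q < 1 -> 0 < q.1 - p.1.
Proof.
move=> h1 h2; rewrite lt_neqAle (le_trans _ h1) ?normr_ge0 // andbT.
apply: contraTN h2 => /eqP e; rewrite -leNgt -subr_ge0 mC_sub1.
move: h1; rewrite /mle -e normr_le0 => /eqP ->.
by rewrite subrr mulr0.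
Qed.

Lemma model_tau_acos p q : mle p q -> mN p q -> model_tau p q = (acos (mC p q))%:E.
Proof.
move=> h1 h2; have k1 := mC_gtN1 h1 h2; have k2 := mC_le1 h1 h2.
have a0 : 0 <= acos (mC p q) by rewrite acos_ge0 // (ltW k1).
apply/eqP; rewrite eq_le; apply/andP; split.
  apply: ge_ereal_sup => _ [->|[a [b [c [H ->]]]]]; first by rewrite lee_fin.
  by have := model_length_le H (mle_refl p) h2; rewrite mCxx acos1 subr0.
move: k2; rewrite (le_eqVlt (mC p q)) => /orP[/eqP ->|k2].
  by rewrite acos1; exact: model_tau_ge0.
have d0 := mC_lt1_lt h1 k2; have dpi := mN_ltpi h2.
have [A [B [AB e1 e2]]] : exists A B, [/\ A ^+ 2 + B ^+ 2 < 1, geo A B p.1 = p & geo A B q.1 = q].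
  by apply: exists_geo; rewrite ?d0 ?dpi ?k1 ?k2.
have pq : p.1 < q.1 by rewrite -subr_gt0.
have := geo_length_ge AB pq dpi; rewrite e1 e2 => /le_trans; apply.
by apply: model_tau_ge; rewrite -{2}e1 -{2}e2; exact: geo_causal.
Qed.

End ModelGeodesics.

(** * Extension of geodesics in the conformal strip *)

Section Blending.
Variable R : realType.
Implicit Types (p q m x y : R * R) (a b s t e : R) (c : R -> R * R).

(** A cutoff of class C^1: the curves of the model are C^1, so an extension has to leave the
    geodesic smoothly instead of being concatenated. *)
Lemma der_max0_sqr s : der (fun s : R => Num.max s 0 ^+ 2) s (2 * Num.max s 0).
Proof.
have [s0|s0|->] := ltgtP s 0.
- rewrite mulr0; apply: near_eq_is_derive (dv_cst 0 s).
  have := near_lt (@ct_id R s) (@ct_cst R R 0 s) s0.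
  by apply: filterS => u u0; rewrite max_r ?ltW // expr0n.
- have d : der (fun s => s ^+ 2) s (2 * s).
    by apply: der_eq; [dv_real|rewrite /= /id; ring].
  apply: near_eq_is_derive d.
  have := near_lt (@ct_cst R R 0 s) (@ct_id R s) s0.
  by apply: filterS => u u0; rewrite max_l ?ltW.
- rewrite mulr0; apply/is_derive1_caratheodory.
  exists (fun z => Num.max z 0); split.
  + move=> z; rewrite maxxx expr0n subr0 subr0 expr2.
    by case: (leP 0 z) => z0; rewrite ?mul0r.
  + have : continuous_at (0 : R) (fun z : R => Num.max z 0).
      by apply: ct_max; [exact: ct_id|exact: ct_cst].
    by [].
  + by rewrite maxxx.
Qed.

Lemma cos_gt0_strip (th : R) : `|th| < pi / 2 -> 0 < cos th.
Proof. by rewrite ltr_norml => h; exact: cos_gt0_pihalf. Qed.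

Lemma sin_strip (th : R) : `|th| < pi / 2 -> -1 < sin th < 1.
Proof.
move=> /cos_gt0_strip c0; have := cos2Dsin2 th => h.
by apply/andP; split; nra.
Qed.

Lemma cosh_atanh_sin (th : R) : `|th| < pi / 2 -> cos th * cosh (atanh (sin th)) = 1.
Proof.
move=> h; have c0 := cos_gt0_strip h; have := cosh_atanh (sin_strip h).
have -> : 1 - sin th ^+ 2 = cos th ^+ 2 by rewrite -(cos2Dsin2 th) addrK.
rewrite -exprMn mulrC => e.
have k0 : 0 < cos th * cosh (atanh (sin th)) by rewrite mulr_gt0 // cosh_gt0.
by apply/eqP; rewrite -(@eqrXn2 _ 2) ?ltW // e expr1n.
Qed.

Lemma thr_atanh_sin (th : R) : `|th| < pi / 2 -> thr (atanh (sin th)) = th.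
Proof.
move=> h; have c0 := cos_gt0_strip h; have k := cosh_atanh_sin h.
have -> : thr (atanh (sin th)) = atan (tan th).
  rewrite /thr (sinh_atanh (sin_strip h)) /tan; congr atan; congr (_ * _).
  by apply: (mulfI (lt0r_neq0 c0)); rewrite k divff // gt_eqF.
by rewrite tanK // in_itv /= -ltr_norml.
Qed.

Lemma atanh_sin_thr (r : R) : atanh (sin (thr r)) = r.
Proof. by rewrite sin_thr atanh_tanh. Qed.

Lemma thr_norm (r : R) : `|thr r| < pi / 2.
Proof. by rewrite ltr_norml thr_bound. Qed.

Definition conf (T Th : R -> R) s : R * R := (T s, atanh (sin (Th s))).

Lemma der_conf2 T Th s (dTh : R) : `|Th s| < pi / 2 -> der Th s dTh ->
  der (fun s => (conf T Th s).2) s (dTh * cosh (conf T Th s).2).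
Proof.
move=> h d; have k := cosh_atanh_sin h.
have d2 : der (fun s => sin (Th s)) s (cos (Th s) * dTh) by exact: dv_sin.
apply: der_eq; first exact: (@dv_atanh R (fun s => sin (Th s)) _ _ (sin_strip h) d2).
rewrite /conf /=; set C := cosh _ in k *; transitivity (dTh * C * (cos (Th s) * C)); [ring|by rewrite k mulr1].
Qed.

Section Conf.
Variables (T Th dT dTh : R -> R).
Hypothesis (strip : forall s, `|Th s| < pi / 2).
Hypothesis (der_T : forall s, der T s (dT s)) (der_Th : forall s, der Th s (dTh s)).
Hypothesis (cdT : continuous dT) (cdTh : continuous dTh).

Lemma conf_vt s : model_vt (conf T Th) s = dT s.
Proof. exact: der_val (der_T s). Qed.

Lemma conf_vr s : model_vr (conf T Th) s = dTh s * cosh (conf T Th s).2.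
Proof. exact: der_val (der_conf2 T (strip s) (der_Th s)). Qed.

Lemma conf_speed2 s :
  model_speed2 (conf T Th) s = cosh (conf T Th s).2 ^+ 2 * (dT s ^+ 2 - dTh s ^+ 2).
Proof. by rewrite /model_speed2 conf_vt conf_vr; ring. Qed.

Lemma conf_causal a b : a < b ->
  (forall s, a <= s <= b -> 0 < dT s /\ `|dTh s| <= dT s) ->
  model_causal_from_to a b (conf T Th) (conf T Th a) (conf T Th b).
Proof.
move=> ab H; split => //.
- move=> s; split; first by have [] := der_T s.
  by have [] := der_conf2 T (strip s) (der_Th s).
- split.
    by have -> : model_vt (conf T Th) = dT by apply/funext => s; exact: conf_vt.
  have -> : model_vr (conf T Th) = (fun s => dTh s * cosh (conf T Th s).2).
    by apply/funext => s; exact: conf_vr.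
  move=> s; have h := ct_cosh (dv_continuous (der_conf2 T (strip s) (der_Th s))).
  have h' : continuous_at s dTh by exact: cdTh.
  suff : continuous_at s (fun s => dTh s * cosh (conf T Th s).2) by [].
  by ct_real.
- move=> s; rewrite in_itv /= => /H[h1 h2]; rewrite conf_vt conf_speed2; split => //.
  rewrite mulr_ge0 ?sqr_ge0 // subr_ge0 -real_normK ?num_real //.
  by rewrite ler_pXn2r ?nnegrE // ltW.
Qed.

End Conf.

(* Extending a geodesic beyond [tc] to any point in the causal future of its
   end point costs no length before [tc]: move along the segments towards a
   point slightly beyond [q], in conformal coordinates. *)
Lemma geo_extension (A B : R) t0 tc b q : A ^+ 2 + B ^+ 2 < 1 -> t0 < tc -> tc < b ->
  mle (geo A B b) q -> b < q.1 ->
  (model_length t0 tc (geo A B) <= model_tau (geo A B t0) q)%E.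
Proof.
move=> AB t0c tcb mq bq.
pose G s := thr (geo A B s).2; pose dG s := gx' A B s * cosh (geo A B s).2.
have dG1 s : `|dG s| <= 1.
  have c0 := cosh_gt0 (geo A B s).2.
  rewrite -(@ler_pXn2r _ 2) ?nnegrE // expr1n real_normK ?num_real //.
  rewrite /dG exprMn (mulrC (gx' A B s ^+ 2)) -subr_ge0.
  exact: ltW (geo_def AB s).
have derG s : der G s (dG s).
  apply: der_eq; first exact: dv_thr (der_geo2 AB s).
  by rewrite /dG; field; rewrite gt_eqF // cosh_gt0.
pose thq := thr q.2.
(* The target [(T', Th')] overshoots [q] by the ratio [ka], small enough to keep [Th'] in the strip;
   the [+ 1] keeps the denominator positive. *)
pose ka := (pi / 2 - `|thq|) / (2 * (`|thq - G b| + 1)).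
have ka0 : 0 < ka.
  by rewrite divr_gt0 ?subr_gt0 ?thr_norm // mulr_gt0 // ltr_wpDl.
pose T' := q.1 + ka * (q.1 - b); pose Th' := thq + ka * (thq - G b).
have Th's : `|Th'| < pi / 2.
  apply: le_lt_trans (ler_normD _ _) _; rewrite normrM (ger0_norm (ltW ka0)).
  have h : ka * `|thq - G b| <= (pi / 2 - `|thq|) / 2.
    have n0 : 0 < `|thq - G b| + 1 by rewrite ltr_wpDl.
    have -> : (pi / 2 - `|thq|) / 2 = ka * (`|thq - G b| + 1).
      by rewrite /ka; field; rewrite gt_eqF.
    by rewrite ler_pM2l // lerDl.
  have := thr_norm q.2; rewrite -/thq; move: h; lra.
(* Chosen to make [f b = (1 + ka)^-1], the weight at which the blend passes through [q]. *)
pose k := ka * (b - tc) ^+ 2.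
have k0 : 0 < k by rewrite mulr_gt0 // exprn_gt0 // subr_gt0.
pose w s : R := Num.max (s - tc) 0 ^+ 2; pose dw s : R := 2 * Num.max (s - tc) 0.
have w0 s : 0 <= w s by rewrite sqr_ge0.
have dw0 s : 0 <= dw s by rewrite mulr_ge0 // le_max lexx orbT.
have derw s : der w s (dw s).
  have d1 : der (fun s => s - tc) s 1 by apply: der_eq; [dv_real|rewrite /= ?subr0 ?addr0].
  by apply: der_eq; [exact: (@dv_comp R (fun s : R => Num.max s 0 ^+ 2) (fun s => s - tc) s _ _ (der_max0_sqr (s - tc)) d1)|rewrite mulr1].
have kw0 s : 0 < k + w s by rewrite ltr_wpDr.
(* The weight vanishes up to [tc] and never reaches 1, so the time component of the geodesic
   survives and keeps [dT] positive. *)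
pose f s := w s / (k + w s); pose df s := dw s * k / (k + w s) ^+ 2.
have f0 s : 0 <= f s by rewrite divr_ge0 // ltW.
have f1 s : f s < 1 by rewrite ltr_pdivrMr // mul1r ltrDr.
have df0 s : 0 <= df s by rewrite divr_ge0 ?sqr_ge0 // mulr_ge0 // ltW.
have derf s : der f s (df s).
  have dws := derw s.
  have d1 : der (fun s => k + w s) s (0 + dw s) by dv_real.
  have d2 := @dvV R (fun s => k + w s) s _ (lt0r_neq0 (kw0 s)) d1.
  apply: der_eq; first exact: dvM dws d2.
  by rewrite /df /=; field; rewrite gt_eqF.
pose T s := (1 - f s) * s + f s * T'.
pose Th s := (1 - f s) * G s + f s * Th'.
pose dT s := (1 - f s) + df s * (T' - s).
pose dTh s := (1 - f s) * dG s + df s * (Th' - G s).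
have derT s : der T s (dT s).
  by have d := derf s; rewrite /T /dT; apply: der_eq; [dv_real|rewrite /= /id; ring].
have derTh s : der Th s (dTh s).
  by have d := derf s; have d' := derG s; rewrite /Th /dTh; apply: der_eq; [dv_real|rewrite /= /id; ring].
have strip s : `|Th s| < pi / 2.
  apply: le_lt_trans (ler_normD _ _) _.
  rewrite (normrM (1 - f s)) (normrM (f s)) (ger0_norm (f0 s)).
  rewrite (@ger0_norm _ (1 - f s)) ?subr_ge0 ?(ltW (f1 s)) //.
  have g1 : `|G s| < pi / 2 by exact: thr_norm.
  have : (1 - f s) * `|G s| < (1 - f s) * (pi / 2) by rewrite ltr_pM2l ?subr_gt0.
  have : f s * `|Th'| <= f s * (pi / 2) by rewrite ler_wpM2l // ltW.
  lra.
have cf : continuous f by move=> s; exact: dv_continuous (derf s).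
have cw : continuous w by move=> s; exact: dv_continuous (derw s).
have cG : continuous G by move=> s; exact: dv_continuous (derG s).
have cdf : continuous df.
  move=> s; have h1 : continuous_at s w by exact: cw.
  suff : continuous_at s (fun s => dw s * k / (k + w s) ^+ 2) by [].
  have h2 : continuous_at s (fun s => ((k + w s) ^+ 2)^-1).
    apply: ct_inv; first by rewrite gt_eqF // exprn_gt0.
    by ct_real.
  by rewrite /dw; ct_real.
have cdG : continuous dG.
  move=> s; have h := ct_cosh (dv_continuous (der_geo2 AB s)).
  suff : continuous_at s (fun s => gx' A B s * cosh (geo A B s).2) by [].
  by rewrite /gx'; ct_real.
have cdT : continuous dT.
  move=> s; have h1 : continuous_at s f by exact: cf.
  have h2 : continuous_at s df by exact: cdf.
  suff : continuous_at s (fun s => (1 - f s) + df s * (T' - s)) by [].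
  by ct_real.
have cdTh : continuous dTh.
  move=> s; have h1 : continuous_at s f by exact: cf.
  have h2 : continuous_at s df by exact: cdf.
  have h3 : continuous_at s G by exact: cG.
  have h4 : continuous_at s dG by exact: cdG.
  suff : continuous_at s (fun s => (1 - f s) * dG s + df s * (Th' - G s)) by [].
  by ct_real.
have early s : s <= tc -> [/\ f s = 0, df s = 0, dT s = 1 & dTh s = dG s].
  move=> stc; have m0 : Num.max (s - tc) 0 = 0 by rewrite max_r // subr_le0.
  have fs : f s = 0 by rewrite /f /w m0 expr0n mul0r.
  have dfs : df s = 0 by rewrite /df /dw m0 mulr0 !mul0r.
  by split => //; rewrite /dT /dTh fs dfs subr0 mul0r addr0 ?mul1r.
have ab : t0 < b by exact: lt_trans tcb.
have mG s t : s <= t -> `|G t - G s| <= t - s.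
  rewrite le_eqVlt => /orP[/eqP ->|st]; first by rewrite !subrr normr0.
  by have := model_curve_mle (geo_causal AB st) (lexx s) (ltW st) (lexx t).
have caus s : t0 <= s <= b -> 0 < dT s /\ `|dTh s| <= dT s.
  move=> /andP[_ sb].
  have far : `|Th' - G s| <= T' - s.
    have -> : Th' - G s = (1 + ka) * (thq - G b) + (G b - G s) by rewrite /Th'; ring.
    have -> : T' - s = (1 + ka) * (q.1 - b) + (b - s) by rewrite /T'; ring.
    apply: le_trans (ler_normD _ _) _; apply: lerD; last exact: mG.
    by rewrite normrM ger0_norm ?ler_wpM2l //; lra.
  have far0 : 0 <= T' - s by apply: le_trans far.
  have h1 : 0 < 1 - f s by rewrite subr_gt0.
  split; first by rewrite ltr_wpDr // mulr_ge0.
  apply: le_trans (ler_normD _ _) _; rewrite (normrM (1 - f s)) (normrM (df s)).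
  rewrite (ger0_norm (df0 s)) (gtr0_norm h1).
  by apply: lerD; [rewrite ler_piMr // ltW|rewrite ler_wpM2l].
have H := conf_causal strip derT derTh cdT cdTh ab caus.
have c_early s : s <= tc -> conf T Th s = geo A B s.
  move=> /early[fs _ _ _]; rewrite /conf /T /Th fs subr0 !mul1r !mul0r !addr0.
  by rewrite /G atanh_sin_thr.
rewrite c_early ?(ltW t0c) // in H.
have cb : conf T Th b = q.
  have fb : f b = (1 + ka)^-1.
    rewrite /f /w max_l ?subr_ge0 ?(ltW tcb) // /k.
    have n0 : b - tc != 0 by rewrite gt_eqF // subr_gt0.
    have n1 : 1 + ka != 0 by rewrite gt_eqF // addr_gt0.
    have n2 : ka + 1 != 0 by rewrite addrC.
    field; rewrite n1 /= (_ : ka * (b - tc) ^+ 2 + (b - tc) ^+ 2 = (ka + 1) * (b - tc) ^+ 2); last by ring.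
    by rewrite mulf_neq0 // expf_neq0.
  have n1 : 1 + ka != 0 by rewrite gt_eqF // addr_gt0.
  rewrite /conf /T /Th fb (_ : _ + _ = q.1); last by rewrite /T'; field.
  rewrite (_ : _ + _ = thq); last by rewrite /Th'; field.
  by rewrite /thq atanh_sin_thr; case: (q).
rewrite cb in H; apply: le_trans (model_tau_ge H).
have sp_early s : s <= tc -> model_speed2 (conf T Th) s = model_speed2 (geo A B) s.
  move=> stc; have [_ _ dTs dThs] := early s stc.
  rewrite (conf_speed2 strip derT derTh) dTs dThs c_early // geo_speed2 // /dG; ring.
have m1 : measurable_fun `[t0, b] (fun s => (Num.sqrt (model_speed2 (conf T Th) s))%:E).
  apply/measurable_EFinP; apply: measurable_continuous_at => s _.
  exact: continuous_model_speed H.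
rewrite /model_length; apply: (@le_trans _ _ (\int[lebesgue_measure]_(s in `[t0, tc]) (Num.sqrt (model_speed2 (conf T Th) s))%:E)%E).
  rewrite le_eqVlt; apply/orP; left; apply/eqP; apply: eq_integral => s.
  by rewrite inE /= in_itv /= => /andP[_ stc]; rewrite sp_early.
apply: ge0_subset_integral => //.
move=> s /=; rewrite !in_itv /= => /andP[-> stc] /=.
by rewrite (le_trans stc) // ltW.
Qed.

End Blending.

(** * Pairs of points with model separation at least [pi] *)

Section Antipodal.
Variable R : realType.
Implicit Types (p q m x y : R * R) (a b s t e : R) (c : R -> R * R).

Lemma thr_sum_norm p q : mle p q -> ~ mN p q -> `|thr q.2 - thr p.2| < q.1 - p.1.
Proof.
move=> h1 h2; rewrite lt_neqAle h1 andbT; apply/negP => /eqP e; apply: h2.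
rewrite /mN -e; have /andP[p1 p2] := thr_bound p.2; have /andP[q1 q2] := thr_bound q.2.
by case: (ler0P (thr q.2 - thr p.2)) => _; case: (ler0P (thr p.2 + thr q.2)) => _; lra.
Qed.

Lemma acos_gt_cos (x e : R) : -1 <= x <= 1 -> 0 <= e <= pi -> x < cos e -> e < acos x.
Proof.
move=> hx he; rewrite -{1}(acosK hx) ltr_cos ?in_itv //=.
by rewrite acos_ge0 ?acos_lepi.
Qed.

(* On the segment from [p] to [q] in conformal coordinates, the points where
   [mN p] holds accumulate at a point whose product with [p] is [-1]: the
   geodesics from [p] towards them have length close to [pi]. *)
Lemma model_tau_ge_pi p q : mle p q -> ~ mN p q -> (pi%:E <= model_tau p q)%E.
Proof.
move=> h1 h2; have h3 := thr_sum_norm h1 h2.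
pose D := q.1 - p.1; pose de := thr q.2 - thr p.2; pose thp := thr p.2.
have D0 : 0 < D by apply: le_lt_trans h3.
have tp := thr_norm p.2; have tq := thr_norm q.2.
(* The quantity of [mN p], evaluated along the segment at parameter [s]; it increases because
   [|de| < D], and reaches [pi] at [s1]. *)
pose h s := s * D + `|2 * thp + s * de|.
have ch s : continuous_at s h by rewrite /h; ct_real.
have hmon s t : s < t -> h s < h t.
  move=> st; have : `|2 * thp + s * de| <= `|2 * thp + t * de| + (t - s) * `|de|.
    rewrite (_ : 2 * thp + s * de = (2 * thp + t * de) - (t - s) * de); last by ring.
    apply: le_trans (ler_normB _ _) _.
    by rewrite (normrM (t - s)) (@ger0_norm _ (t - s)) // subr_ge0 ltW.
  have : (t - s) * `|de| < (t - s) * D by rewrite ltr_pM2l // subr_gt0.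
  rewrite /h; lra.
have hh0 : h 0 < pi by rewrite /h !mul0r add0r addr0 normrM ger0_norm //; lra.
have hh1 : pi <= h 1.
  rewrite /h !mul1r leNgt; apply/negP => k; apply: h2; rewrite /mN.
  by move: k; rewrite (_ : 2 * thp + de = thr p.2 + thr q.2) // /thp /de; ring.
have [s1 s1I hs1] : exists2 s1 : R, s1 \in `[0, 1] & h s1 = pi.
  apply: IVT => //; first by apply: continuous_at_within => s _; exact: ch.
  by rewrite ge_min le_max (ltW hh0) hh1 orbT.
move: s1I; rewrite in_itv /= => /andP[s10 s11].
have s1_gt0 : 0 < s1.
  by rewrite lt_neqAle s10 andbT; apply: contraTneq hh0 => ->; rewrite hs1 ltxx.
pose th s := thp + s * de.
have th_strip s : 0 <= s <= 1 -> `|th s| < pi / 2.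
  move=> /andP[s0 s1']; rewrite (_ : th s = (1 - s) * thp + s * thr q.2); last by rewrite /th /de /thp; ring.
  pose M := Num.max `|thp| `|thr q.2|; have MM : M < pi / 2 by rewrite gt_max tp.
  have m1 : `|thp| <= M by rewrite le_max lexx.
  have m2 : `|thr q.2| <= M by rewrite le_max lexx orbT.
  apply: le_lt_trans MM; apply: le_trans (ler_normD _ _) _.
  rewrite (normrM (1 - s)) (normrM s) (ger0_norm s0) (@ger0_norm _ (1 - s)) ?subr_ge0 //.
  by move: m1 m2; move: (`|thp|) (`|thr q.2|) M => *; nra.
have pD s : p.1 + s * D - p.1 = s * D by ring.
pose mm s := (p.1 + s * D, atanh (sin (th s))).
have mm_thr s : 0 <= s <= 1 -> thr (mm s).2 = th s.
  by move=> /th_strip; exact: thr_atanh_sin.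
have mm_N s : 0 <= s -> s < s1 -> mN p (mm s).
  move=> s0 ss1; have s1' : s <= 1 by rewrite (le_trans (ltW ss1)).
  rewrite /mN mm_thr ?s0 //=; have := hmon _ _ ss1; rewrite hs1 /h.
  rewrite (_ : thr p.2 + th s = 2 * thp + s * de); last by rewrite /th /thp; ring.
  by rewrite pD.
have mm_lt s : 0 < s -> s <= 1 -> `|thr (mm s).2 - thr p.2| < (mm s).1 - p.1.
  move=> s0 s1'; rewrite mm_thr ?(ltW s0) //= (_ : th s - thr p.2 = s * de); last by rewrite /th /thp; ring.
  by rewrite pD normrM gtr0_norm // ltr_pM2l.
pose F s := mC p (mm s).
have F1 : F s1 = -1.
  apply/eqP; rewrite -subr_eq0 opprK mC_add1 mm_thr ?s10 //=.
  rewrite pD (_ : s1 * D = pi - `|thr p.2 + th s1|); last first.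
    by rewrite -hs1 /h (_ : thr p.2 + th s1 = 2 * thp + s1 * de) ?addrK // /th /thp; ring.
  rewrite cosB cospi sinpi mul0r addr0 mulN1r.
  have -> : cos `|thr p.2 + th s1| = cos (thr p.2 + th s1).
    by case: (ler0P (thr p.2 + th s1)) => _ //; rewrite cosN.
  by rewrite addNr mulr0.
have cF : continuous_at s1 F.
  have d1 : der (fun s => sin (th s)) s1 (cos (th s1) * de).
    by apply: dv_sin; rewrite /th; apply: der_eq; [dv_real|rewrite /= /id; ring].
  have st1 : `|th s1| < pi / 2 by apply: th_strip; rewrite s10.
  have c1 := dv_continuous (@dv_atanh R (fun s => sin (th s)) s1 _ (sin_strip st1) d1).
  have c2 := ct_cosh c1; have c3 := ct_sinh c1.
  by rewrite /F /mC /mm /=; ct_real.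
have pi1 : (1 : R) < pi by have := @pi_ge2 R; lra.
apply/lee_addgt0Pr => e e0.
(* Half of [e] for each of two losses; the cap 1 keeps [pi - e2] between 0 and [pi]. *)
pose e2 := Num.min (e / 2) 1.
have e20 : 0 < e2 by rewrite lt_min; apply/andP; split; lra.
have e2pi : e2 <= 1 by rewrite ge_min lexx orbT.
have e2e : e2 <= e / 2 by rewrite ge_min lexx.
have [s [s0 ss1 Fs]] : exists s, [/\ 0 < s, s < s1 & F s < cos (pi - e2)].
  have n1 : \forall s \near s1, F s < cos (pi - e2).
    apply: (cvgr_lt _ cF); rewrite F1 -cospi ltr_cos ?in_itv /=; lra.
  have {}n1 := near_left n1; near s1^'- => s; exists s; split; near: s => //.
    exact: nbhs_left_gt.
  exact: nbhs_left_lt.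
have s_1 : s < 1 by apply: lt_le_trans s11.
have Ns := mm_N s (ltW s0) ss1; have lts := mm_lt s s0 (ltW s_1).
have k1 := mC_gtN1 (ltW lts) Ns; have k2 := mC_lt1 lts Ns.
have acF : pi - e2 < acos (F s).
  by apply: acos_gt_cos => //; rewrite ?(ltW k1) ?(ltW k2) //; lra.
have dpi := mN_ltpi Ns; have d0 : 0 < (mm s).1 - p.1 by apply: le_lt_trans lts.
have [A [B [AB ep em]]] : exists A B, [/\ A ^+ 2 + B ^+ 2 < 1, geo A B p.1 = p & geo A B (mm s).1 = mm s].
  by apply: exists_geo; rewrite ?d0 ?dpi ?k1 ?k2.
(* The geodesic is left strictly before [mm s], which gives [geo_extension] room to turn towards
   [q]. *)
have [t [tp1 tm tF]] : exists t, [/\ p.1 < t, t < (mm s).1 &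
    acos (F s) - e2 < acos (mC p (geo A B t))].
  have cG : continuous_at (mm s).1 (fun u => mC p (geo A B u)).
    have c2 := dv_continuous (der_geo2 AB (mm s).1).
    have c1 := dv_continuous (der_geo1 A B (mm s).1).
    have c3 := ct_cosh c2; have c4 := ct_sinh c2.
    by rewrite /mC; ct_real.
  have n1 := @near_acos_gt _ (fun u => mC p (geo A B u)) (mm s).1 e2 cG _ e20.
  rewrite em k1 (ltW k2) in n1; have {n1}n1 := near_left (n1 isT).
  have [t [t1 t2 t3]] : exists t, [/\ p.1 < t, t < (mm s).1 &
      mC p (geo A B t) <= 1 -> acos (F s) - e2 < acos (mC p (geo A B t))].
    near (mm s).1^'- => t; exists t; split; near: t => //.
      by apply: nbhs_left_gt; rewrite -subr_gt0.
    exact: nbhs_left_lt.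
  exists t; split => //; apply: t3; rewrite -{1}ep.
  have tI : 0 < t - p.1 < pi by rewrite subr_gt0 t1; lra.
  by have /andP[_ /ltW] := geo_mC AB tI.
have mq : mle (mm s) q.
  rewrite /mle mm_thr ?(ltW s0) ?(ltW s_1) //=.
  rewrite (_ : thr q.2 - th s = (1 - s) * de); last by rewrite /th /de /thp; ring.
  rewrite (_ : q.1 - (p.1 + s * D) = (1 - s) * D); last by rewrite /D; ring.
  have s_1' : 0 < 1 - s by rewrite subr_gt0.
  by rewrite normrM gtr0_norm // ler_pM2l // ltW.
have mq1 : (mm s).1 < q.1.
  rewrite -subr_gt0 /= (_ : q.1 - (p.1 + s * D) = (1 - s) * D); last by rewrite /D; ring.
  by rewrite mulr_gt0 // subr_gt0.
rewrite -em in mq.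
have ext := geo_extension AB tp1 tm mq mq1; rewrite ep in ext.
have tpi : t - p.1 < pi by move: dpi tm; lra.
have := geo_length_ge AB tp1 tpi; rewrite ep => /le_trans/(_ ext) fin.
apply: (@le_trans _ _ ((acos (mC p (geo A B t)))%:E + e%:E)%E); last exact: leeD2r.
by rewrite -EFinD lee_fin; lra.
Unshelve. all: end_near. Qed.

Lemma model_tau_eq0 p q : ~ mcurve p q -> model_tau p q = 0%E.
Proof.
move=> n; apply/eqP; rewrite eq_le model_tau_ge0 andbT.
apply: ge_ereal_sup => l [-> //|[a [b [c [H _]]]]].
by exfalso; apply: n; exists a, b, c.
Qed.

Lemma model_tau_causal p q : (0 < model_tau p q)%E -> (model_tau p q < pi%:E)%E ->
  [/\ mcurve p q, mle p q & mN p q].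
Proof.
move=> h1 h2; have cpq : mcurve p q.
  by apply: contrapT => /model_tau_eq0 e; rewrite e ltxx in h1.
have [m _] := mcurve_mle cpq; split => //; apply: contrapT => n.
by have := model_tau_ge_pi m n; rewrite leNgt h2.
Qed.

End Antipodal.

(** * Sides of model triangles *)

Section ModelSides.
Variable R : realType.
Implicit Types (p q m x y v : R * R) (a b s t l : R) (c : R -> R * R).

Lemma model_length_ge0 a b c : (0 <= model_length a b c)%E.
Proof. by apply: integral_ge0 => s _; rewrite lee_fin sqrtr_ge0. Qed.

(** The calibration based at [x] bounds the length of every curve from [m] to [y], hence also their
    supremum, the separation. *)
Lemma acos_mC_triangle x m y : mle x m -> mcurve m y -> mN x y ->
  acos (mC x m) + acos (mC m y) <= acos (mC x y).
Proof.
move=> xm my xy; have [my' _] := mcurve_mle my; have N := mN_left xm xy.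
rewrite addrC -lerBrDr -lee_fin -(model_tau_acos my' N).
have L a b c (H : model_causal_from_to a b c m y) := model_length_le H xm xy.
apply: ge_ereal_sup => l [->|[a [b [c [H ->]]]]]; last exact: L H.
have [a [b [c H]]] := my; exact: le_trans (model_length_ge0 a b c) (L _ _ _ H).
Qed.

Lemma model_length_split a b c p q s : model_causal_from_to a b c p q ->
  a < s -> s < b ->
  (model_length a b c <= model_length a s c + model_length s b c)%E.
Proof.
move=> H as_ sb.
have m1 (A : set R) : measurable_fun A (fun s => (Num.sqrt (model_speed2 c s))%:E).
  apply/measurable_EFinP; apply: measurable_funTS.
  by apply: continuous_measurable_fun => u; exact: continuous_model_speed H.
have g0 u : (0%:E <= (Num.sqrt (model_speed2 c u))%:E)%E by rewrite lee_fin sqrtr_ge0.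
rewrite /model_length (@itv_bndbnd_setU _ _ _ (BRight s)); last 2 first.
- by rewrite bnd_simp ltW.
- by rewrite bnd_simp ltW.
rewrite ge0_integral_setU //; last first.
  apply/disj_set2P; rewrite -subset0 => u /= []; rewrite !in_itv /= => /andP[_ us].
  by rewrite ltNge us.
- exact: m1.
apply: leeD => //; apply: ge0_subset_integral => //; first exact: m1.
move=> u /=.
by rewrite !in_itv /= => /andP[/ltW -> ->].
Qed.

Lemma on_model_side_acos p q m : (0 < model_tau p q)%E -> (model_tau p q < pi%:E)%E ->
  on_model_side p q m ->
  [/\ mle p m, mle m q & acos (mC p m) + acos (mC m q) = acos (mC p q)].
Proof.
move=> t0 tpi [a [b [c [H L [s sI <-]]]]].
have [_ pq N] := model_tau_causal t0 tpi; have [ab _ _ _ [ca cb]] := H.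
move: sI; rewrite in_itv /= => /andP[]; rewrite le_eqVlt => /orP[/eqP <- _|as_].
  by rewrite ca mCxx acos1 add0r; split => //; exact: mle_refl.
rewrite le_eqVlt => /orP[/eqP ->|sb].
  by rewrite cb mCxx acos1 addr0; split => //; exact: mle_refl.
have H1 := model_curve_sub H (lexx a) as_ (ltW sb).
have H2 := model_curve_sub H (ltW as_) sb (lexx b).
rewrite ca in H1; rewrite cb in H2.
have pm : mle p (c s) by apply: (mcurve_mle _).1; exists a, s, c.
have mq_curve : mcurve (c s) q by exists s, b, c.
have [mq _] := mcurve_mle mq_curve.
split => //; apply/eqP; rewrite eq_le acos_mC_triangle //=.
rewrite -lee_fin EFinD -(model_tau_acos pm (mN_right mq N)).
rewrite -(model_tau_acos mq (mN_left pm N)) -(model_tau_acos pq N) -L.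
apply: le_trans (model_length_split H as_ sb) _.
by apply: leeD; exact: model_tau_ge.
Qed.

(** The mixed Gram determinant of the triples [(w, p, q)] and [(v, p, q)] is the product of their
    determinants times the determinant -1 of the form [g]. *)
Lemma mixed_gram_det (w1 w2 w3 v1 v2 v3 p1 p2 p3 q1 q2 q3 : R) :
  let g a1 a2 a3 b1 b2 b3 := a1 * b1 + a2 * b2 - a3 * b3 in
  let d a1 a2 a3 := a1 * (p2 * q3 - p3 * q2) - a2 * (p1 * q3 - p3 * q1)
                    + a3 * (p1 * q2 - p2 * q1) in
  g w1 w2 w3 v1 v2 v3 * (g p1 p2 p3 p1 p2 p3 * g q1 q2 q3 q1 q2 q3 - g p1 p2 p3 q1 q2 q3 ^+ 2)
  - g w1 w2 w3 p1 p2 p3 * (g p1 p2 p3 v1 v2 v3 * g q1 q2 q3 q1 q2 q3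
      - g p1 p2 p3 q1 q2 q3 * g q1 q2 q3 v1 v2 v3)
  + g w1 w2 w3 q1 q2 q3 * (g p1 p2 p3 v1 v2 v3 * g p1 p2 p3 q1 q2 q3
      - g p1 p2 p3 p1 p2 p3 * g q1 q2 q3 v1 v2 v3)
  = - (d w1 w2 w3 * d v1 v2 v3).
Proof. by move=> g d; rewrite /g /d; ring. Qed.

(* In the quadric, [m] lies on the plane through [p] and [q]: the vector
   [sin l m - sin (l - s) p - sin s q] is null and orthogonal to [p] and [q],
   which span a definite plane, hence it vanishes. *)
Lemma mC_side p m q l s : sin l != 0 -> mC p q = cos l -> mC p m = cos s ->
  mC m q = cos (l - s) ->
  forall v, mC m v * sin l = sin (l - s) * mC p v + sin s * mC q v.
Proof.
move=> sl epq epm emq v.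
pose X p := cosh p.2 * cos p.1; pose Y p := cosh p.2 * sin p.1; pose Z p := sinh p.2.
have CE x y : mC x y = X x * X y + Y x * Y y - Z x * Z y.
  by rewrite /mC /X /Y /Z cosB; ring.
pose W (F : R * R -> R) := F m * sin l - sin (l - s) * F p - sin s * F q.
pose g x := W X * X x + W Y * Y x - W Z * Z x.
have gE x : g x = mC m x * sin l - sin (l - s) * mC p x - sin s * mC q x.
  by rewrite /g /W !CE; ring.
have gp : g p = 0.
  by rewrite gE (mC_sym m) (mC_sym q) epm epq mCxx sinB; ring.
have gq : g q = 0.
  rewrite gE emq epq mCxx; transitivity (sin (l - (l - s)) - sin s).
    by rewrite (sinB l (l - s)); ring.
  by rewrite subKr subrr.
have gm : g m = 0.
  rewrite gE mCxx (mC_sym q m) emq epm.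
  transitivity (sin l - sin (l - s + s)); first by rewrite (sinD (l - s) s); ring.
  by rewrite subrK subrr.
have gW : W X * W X + W Y * W Y - W Z * W Z = 0.
  transitivity (g m * sin l - sin (l - s) * g p - sin s * g q); first by rewrite /g /W; ring.
  by rewrite gp gq gm mul0r !mulr0 !subr0.
have K (v1 v2 v3 : R) := @mixed_gram_det (W X) (W Y) (W Z) v1 v2 v3 (X p) (Y p) (Z p) (X q) (Y q) (Z q).
rewrite /= -!CE !mCxx epq in K.
have K' (v1 v2 v3 : R) := K v1 v2 v3.
rewrite -/(g p) -/(g q) gp gq in K'.
(* With the null vector in place of [v], its determinant with [p] and [q] vanishes; for general [v]
   it is then orthogonal to [v]. *)
have k1 := K' (W X) (W Y) (W Z); rewrite gW !mul0r subr0 addr0 in k1.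
have d0 : W X * (Y p * Z q - Z p * Y q) - W Y * (X p * Z q - Z p * X q)
          + W Z * (X p * Y q - Y p * X q) = 0.
  by apply/eqP; rewrite -sqrf_eq0 expr2 -oppr_eq0 -k1.
have k2 := K' (X v) (Y v) (Z v); rewrite d0 -/(g v) !mul0r subr0 addr0 oppr0 in k2.
have : g v = 0.
  have nz : 1 * 1 - cos l ^+ 2 != 0.
    by rewrite mulr1 -(cos2Dsin2 l) addrAC subrr add0r expf_neq0.
  by apply: (mulIf nz); rewrite k2 mul0r.
by rewrite gE => /eqP; rewrite -addrA -opprD subr_eq0 => /eqP.
Qed.

End ModelSides.

(** * The curvature bound *)

Section CurvatureBound.
Variable R : realType.
Local Notation X := (glued R).
Implicit Types (p q m v x y z : plane R) (a b s t l e : R) (g : R -> X).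

Lemma acos_le_cos (u e : R) : -1 <= u <= 1 -> 0 <= e <= pi -> cos e <= u -> acos u <= e.
Proof.
move=> hu he; rewrite !leNgt; apply: contraNN => h.
by rewrite -[ltLHS](acosK hu) ltr_cos ?in_itv //= acos_ge0 ?acos_lepi.
Qed.

Lemma model_pair (p' q' : R * R) l : model_tau p' q' = l%:E -> 0 < l < pi ->
  [/\ mle p' q', mN p' q', mC p' q' = cos l, acos (mC p' q') = l & p'.1 < q'.1].
Proof.
move=> e /andP[l0 lpi]; have [] := @model_tau_causal R p' q'; rewrite ?e ?lte_fin //.
move=> cv pq N; have [_ lt_pq] := mcurve_mle cv; split => //.
- have := model_tau_acos pq N; rewrite e => -[->]; rewrite acosK // in_itv /=.
  by rewrite (ltW (mC_gtN1 pq N)) mC_le1.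
- by have := model_tau_acos pq N; rewrite e => -[].
Qed.

Lemma mC_itv (p' q' : R * R) : mle p' q' -> mN p' q' -> -1 <= mC p' q' <= 1.
Proof. by move=> h1 h2; rewrite (ltW (mC_gtN1 h1 h2)) mC_le1. Qed.

Lemma model_side (p' q' m' : R * R) l s : model_tau p' q' = l%:E -> 0 < l < pi ->
  on_model_side p' q' m' -> model_tau p' m' = s%:E ->
  [/\ mle p' m', mle m' q', mC p' m' = cos s, mC m' q' = cos (l - s) &
      acos (mC p' m') = s].
Proof.
move=> e hl; have [pq N ec ea _] := model_pair e hl.
case/andP: hl => l0 lpi; move=> /on_model_side_acos[]; rewrite ?e ?lte_fin //.
move=> pm mq sum es; have Npm := mN_right mq N; have Nmq := mN_left pm N.
have es' : acos (mC p' m') = s by have := model_tau_acos pm Npm; rewrite es => -[].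
split => //; first by rewrite -es' acosK // in_itv /= mC_itv.
by rewrite -ea -sum es' addrC addKr acosK // in_itv /= mC_itv.
Qed.

(** In the model, [mC_side] interpolates the form along the side by the same combination of sines
    that bounds [cos e * sin l] in [cos_sqrt_stewart_le]. With [tsq] one statement serves all three
    positions of the opposite vertex. *)
Lemma side_acos_le p q m v a b e (p' q' m' v' : R * R) :
  plt p q -> ptau p q < pi -> ple p m -> ple m q ->
  ptau p m + ptau m q = ptau p q -> pcomp p v -> pcomp q v ->
  tsq p v = a ^+ 2 -> tsq q v = b ^+ 2 -> tsq m v = e ^+ 2 ->
  0 <= a <= pi -> 0 <= b <= pi -> 0 <= e <= pi ->
  (2 * a * ptau p q) ^+ 2 <= (b ^+ 2 - a ^+ 2 - ptau p q ^+ 2) ^+ 2 ->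
  mC p' q' = cos (ptau p q) -> mC p' m' = cos (ptau p m) ->
  mC m' q' = cos (ptau p q - ptau p m) -> mC p' v' = cos a -> mC q' v' = cos b ->
  -1 <= mC m' v' <= 1 -> acos (mC m' v') <= e.
Proof.
move=> pq lpi pm mq add cp cq ea eb ee ha hb he disc Cpq Cpm Cmq Cpv Cqv hC.
have l0 : 0 < ptau p q by rewrite ptau_gt0.
pose lam := ptau p m / ptau p q.
have lamE : lam * ptau p q = ptau p m by rewrite divfK // gt_eqF.
have lam01 : 0 <= lam <= 1.
  by rewrite divr_ge0 ?ptau_ge0 //= ler_pdivrMr // mul1r -add lerDl ptau_ge0.
have hl : 0 < ptau p q < pi by rewrite l0.
apply: acos_le_cos => //; have sl : 0 < sin (ptau p q) by rewrite sin_gt0_pi.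
have D := tsq_side_le pq pm mq add cp cq (esym lamE); rewrite ea eb ee in D.
have := cos_sqrt_stewart_le hl ha hb disc lam01 he D.
have slz : sin (ptau p q) != 0 by rewrite gt_eqF.
rewrite lamE -Cpv -Cqv -(mC_side slz Cpq Cpm Cmq).
by rewrite ler_pM2r.
Qed.

(** The length is at most the sum of the two separations at any intermediate point, so full length
    forces equality in the reverse triangle inequality. *)
Lemma maximizer_side (U : set X) x y a b g s : maximizing_in U x y a b g ->
  s \in `[a, b] ->
  [/\ ple x (g s), ple (g s) y & ptau x (g s) + ptau (g s) y = ptau x y].
Proof.
move=> [H _ L] sI; have [h1 h2] := causal_from_to_between H sI; split => //.
apply/eqP; rewrite eq_le ptau_triangle //= -lee_fin.
have <- : tau_length g a b = (ptau x y)%:E by [].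
have ab := causal_from_to_lt H; case: H => _ <- <-.
move: sI; rewrite in_itv /= => /andP[]; rewrite le_eqVlt => /orP[/eqP <- _|as_].
  by rewrite ptauxx add0r; exact: tau_length_le.
rewrite le_eqVlt => /orP[/eqP ->|sb]; first by rewrite ptauxx addr0; exact: tau_length_le.
by rewrite EFinD; exact: tau_length_le_cat.
Qed.

Lemma ct_glued_tau (z : plane R * plane R) :
  continuous_at z (fun w : plane R * plane R => (ptau w.1 w.2)%:E).
Proof. by apply: cvg_EFin; [exact: nearW|exact: ct_ptau]. Qed.

Lemma triangle_discriminant_ge a b l : 0 <= a -> 0 <= l -> a + l <= b ->
  (2 * a * l) ^+ 2 <= (b ^+ 2 - a ^+ 2 - l ^+ 2) ^+ 2.
Proof.
move=> a0 l0 h; have k : 2 * a * l <= b ^+ 2 - a ^+ 2 - l ^+ 2.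
  have : (a + l) ^+ 2 <= b ^+ 2 by rewrite ler_pXn2r ?nnegrE //; lra.
  rewrite sqrrD; lra.
by rewrite ler_pXn2r ?nnegrE ?(le_trans _ k) // !mulr_ge0.
Qed.

(** The reverse triangle inequality as a sign of the discriminant in [cosq_stewart_le]. This form
    serves the side from [y] to [z]; for the other two sides [triangle_discriminant_le] is used. *)
Lemma triangle_discriminant_le a b l : 0 <= a -> 0 <= l -> 0 <= b -> b <= `|a - l| ->
  (2 * a * l) ^+ 2 <= (b ^+ 2 - a ^+ 2 - l ^+ 2) ^+ 2.
Proof.
move=> a0 l0 b0 h; rewrite -[leRHS]sqrrN.
have k : 2 * a * l <= - (b ^+ 2 - a ^+ 2 - l ^+ 2).
  have : b ^+ 2 <= (a - l) ^+ 2.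
    by rewrite -[leRHS]real_normK ?num_real // ler_pXn2r ?nnegrE.
  rewrite sqrrB; lra.
by rewrite ler_pXn2r ?nnegrE ?(le_trans _ k) // !mulr_ge0.
Qed.

Section Triangle.
Variables (x y z : X) (x' y' z' : R * R).
Hypotheses (xy : plt x y) (yz : plt y z) (xz_pi : ptau x z < pi).
Hypotheses (exy : model_tau x' y' = (ptau x y)%:E)
  (eyz : model_tau y' z' = (ptau y z)%:E) (exz : model_tau x' z' = (ptau x z)%:E).

Let xz : plt x z. Proof. exact: ple_plt_trans (plt_ple xy) yz. Qed.
Let tri : ptau x y + ptau y z <= ptau x z.
Proof. exact: ptau_triangle (plt_ple xy) (plt_ple yz). Qed.
Let hxz : 0 < ptau x z < pi. Proof. by rewrite ptau_gt0 xz. Qed.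
Let hxy : 0 < ptau x y < pi.
Proof.
rewrite ptau_gt0 xy; apply: le_lt_trans xz_pi; apply: le_trans tri.
by rewrite lerDl ptau_ge0.
Qed.
Let hyz : 0 < ptau y z < pi.
Proof.
rewrite ptau_gt0 yz; apply: le_lt_trans xz_pi; apply: le_trans tri.
by rewrite lerDr ptau_ge0.
Qed.

Let ltW2 (u : R) : 0 < u < pi -> 0 <= u <= pi.
Proof. by move=> /andP[/ltW -> /ltW ->]. Qed.

Lemma first_side_comparison (U : set X) a b g : maximizing_in U x y a b g ->
  side_comparison x z a b g x' y' z'.
Proof.
move=> G s m' sI side es; have [xm my add] := maximizer_side G sI.
move: es xm my add; rewrite /=; move: (g s) => m es xm my add.
have [mxy Nxy Cxy Axy ltxy] := model_pair exy hxy.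
have [myz Nyz Cyz Ayz ltyz] := model_pair eyz hyz.
have [mxz Nxz Cxz Axz ltxz] := model_pair exz hxz.
have [mxm mmy Cxm Cmy Axm] := model_side exy hxy side es.
have mz : ple m z := ple_trans my (plt_ple yz).
have mmz : mle m' z' := mle_trans mmy myz.
have Nmz : mN m' z' := mN_left mxm Nxz.
split.
  rewrite (model_tau_acos mmz Nmz) lee_fin.
  have mz_pi : 0 <= ptau m z <= pi.
    rewrite ptau_ge0 /= (le_trans _ (ltW xz_pi)) //.
    by apply: le_trans (ptau_triangle xm mz); rewrite lerDr ptau_ge0.
  have cx : pcomp x z by rewrite /pcomp (plt_ple xz).
  have cy : pcomp y z by rewrite /pcomp (plt_ple yz).
  have disc : (2 * ptau x z * ptau x y) ^+ 2 <=
      (ptau y z ^+ 2 - ptau x z ^+ 2 - ptau x y ^+ 2) ^+ 2.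
    apply: triangle_discriminant_le; rewrite ?ptau_ge0 //.
    by apply: le_trans (ler_norm _); rewrite lerBrDl.
  have [_ xy_pi] := andP hxy.
  exact: (side_acos_le xy xy_pi xm my add cx cy (tsq_le (plt_ple xz))
    (tsq_le (plt_ple yz)) (tsq_le mz) (ltW2 hxz) (ltW2 hyz) mz_pi disc
    Cxy Cxm Cmy Cxz Cyz (mC_itv mmz Nmz)).
rewrite model_tau_eq0 ?lee_fin ?ptau_ge0 // => /mcurve_mle[_].
rewrite ltNge => /negP; apply; apply: (@le_trans _ _ y'.1); last exact: ltW.
by rewrite -subr_ge0; apply: le_trans mmy; exact: normr_ge0.
Qed.

Lemma second_side_comparison (U : set X) a b g : maximizing_in U y z a b g ->
  side_comparison y x a b g y' z' x'.
Proof.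
move=> G s m' sI side es; have [ym mz add] := maximizer_side G sI.
move: es ym mz add; rewrite /=; move: (g s) => m es ym mz add.
have [mxy Nxy Cxy Axy ltxy] := model_pair exy hxy.
have [myz Nyz Cyz Ayz ltyz] := model_pair eyz hyz.
have [mxz Nxz Cxz Axz ltxz] := model_pair exz hxz.
have [mym mmz Cym Cmz Aym] := model_side eyz hyz side es.
have xm : ple x m := ple_trans (plt_ple xy) ym.
have mxm : mle x' m' := mle_trans mxy mym.
have Nxm : mN x' m' := mN_right mmz Nxz.
split.
  rewrite model_tau_eq0 ?lee_fin ?ptau_ge0 // => /mcurve_mle[_].
  rewrite ltNge => /negP; apply; apply: (@le_trans _ _ y'.1); first exact: ltW.
  by rewrite -subr_ge0; apply: le_trans mym; exact: normr_ge0.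
have hC := mC_itv mxm Nxm.
rewrite (model_tau_acos mxm Nxm) lee_fin; rewrite mC_sym in hC *.
have xm_pi : 0 <= ptau x m <= pi.
  rewrite ptau_ge0 /= (le_trans _ (ltW xz_pi)) //.
  by apply: le_trans (ptau_triangle xm mz); rewrite lerDl ptau_ge0.
have cy : pcomp y x by rewrite /pcomp (plt_ple xy) orbT.
have cz : pcomp z x by rewrite /pcomp (plt_ple xz) orbT.
have disc : (2 * ptau x y * ptau y z) ^+ 2 <=
    (ptau x z ^+ 2 - ptau x y ^+ 2 - ptau y z ^+ 2) ^+ 2.
  by apply: triangle_discriminant_ge; rewrite ?ptau_ge0.
have [_ yz_pi] := andP hyz.
have ey := tsq_le (plt_ple xy); have ez := tsq_le (plt_ple xz); have em := tsq_le xm.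
rewrite tsqC in ey; rewrite tsqC in ez; rewrite tsqC in em.
rewrite mC_sym in Cxy; rewrite mC_sym in Cxz.
exact: (side_acos_le yz yz_pi ym mz add cy cz ey ez em (ltW2 hxy) (ltW2 hxz)
  xm_pi disc Cyz Cym Cmz Cxy Cxz hC).
Qed.

(* A wrong order of [m] and [y] in the glued plane contradicts the reverse
   triangle inequality in the model plane. *)
Lemma third_side_comparison (U : set X) a b g : maximizing_in U x z a b g ->
  side_comparison x y a b g x' z' y'.
Proof.
move=> G s m' sI side es; have [xm mz add] := maximizer_side G sI.
move: es xm mz add; rewrite /=; move: (g s) => m es xm mz add.
have [mxy Nxy Cxy Axy ltxy] := model_pair exy hxy.
have [myz Nyz Cyz Ayz ltyz] := model_pair eyz hyz.
have [mxz Nxz Cxz Axz ltxz] := model_pair exz hxz.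
have [mxm mmz Cxm Cmz Axm] := model_side exz hxz side es.
have Nxm : mN x' m' := mN_right mmz Nxz.
(* The order of [m] and [y] is unknown here, so the bound is proved for the symmetric [tsq m y] and
   used for both orders. *)
have key e : 0 <= e <= pi -> tsq m y = e ^+ 2 -> -1 <= mC m' y' <= 1 ->
    acos (mC m' y') <= e.
  move=> he Ee hC; rewrite mC_sym in Cyz.
  have cx : pcomp x y by rewrite /pcomp (plt_ple xy).
  have cz : pcomp z y by rewrite /pcomp (plt_ple yz) orbT.
  have disc : (2 * ptau x y * ptau x z) ^+ 2 <=
      (ptau y z ^+ 2 - ptau x y ^+ 2 - ptau x z ^+ 2) ^+ 2.
    apply: triangle_discriminant_le; rewrite ?ptau_ge0 //.
    by rewrite distrC; apply: le_trans (ler_norm _); rewrite lerBrDl.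
  have ez := tsq_le (plt_ple yz); rewrite tsqC in ez.
  exact: (side_acos_le xz xz_pi xm mz add cx cz (tsq_le (plt_ple xy)) ez Ee
    (ltW2 hxy) (ltW2 hyz) he disc Cxz Cxm Cmz Cxy Cyz hC).
have [_ xy_pi] := andP hxy; have [_ yz_pi] := andP hyz.
split.
  have [cmy|/model_tau_eq0 ->] := pselect (mcurve m' y'); last by rewrite lee_fin ptau_ge0.
  have [mmy _] := mcurve_mle cmy; have Nmy : mN m' y' := mN_left mxm Nxy.
  have hC := mC_itv mmy Nmy.
  have nym : ~~ plt y m.
    rewrite -ptau_gt0 -leNgt; case: (boolP (plt y m)) => [ym|/ptau_eq0 -> //].
    have h1 := ptau_triangle (plt_ple xy) (plt_ple ym).
    have := acos_mC_triangle mxm cmy Nxy; rewrite Axm Axy => h2.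
    have h3 := acos_ge0 hC.
    rewrite -(lerD2l (ptau x y)) addr0; apply: le_trans h1 _; apply: le_trans h2.
    by rewrite lerDl.
  rewrite (model_tau_acos mmy Nmy) lee_fin; apply: key => //; last first.
    by rewrite /tsq (ptau_eq0 nym) expr0n addr0.
  rewrite ptau_ge0 /=; case: (boolP (plt m y)) => [my|/ptau_eq0 ->]; last exact: pi_ge0.
  apply: le_trans (ltW xy_pi); apply: le_trans (ptau_triangle xm (plt_ple my)).
  by rewrite lerDr ptau_ge0.
have [cym|/model_tau_eq0 ->] := pselect (mcurve y' m'); last by rewrite lee_fin ptau_ge0.
have [mym _] := mcurve_mle cym; have Nym : mN y' m' := mN_left mxy Nxm.
have hC := mC_itv mym Nym.
have nmy : ~~ plt m y.
  rewrite -ptau_gt0 -leNgt; case: (boolP (plt m y)) => [my|/ptau_eq0 -> //].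
  have h1 := ptau_triangle xm (plt_ple my).
  have := acos_mC_triangle mxy cym Nxm; rewrite Axm Axy => h2.
  have h3 := acos_ge0 hC.
  rewrite -(lerD2l (ptau x m)) addr0; apply: le_trans h1 _; apply: le_trans h2.
  by rewrite lerDl.
rewrite (model_tau_acos mym Nym) lee_fin; rewrite mC_sym in hC *; apply: key => //.
  rewrite ptau_ge0 /=; case: (boolP (plt y m)) => [ym|/ptau_eq0 ->]; last exact: pi_ge0.
  apply: le_trans (ltW yz_pi); apply: le_trans (ptau_triangle (plt_ple ym) mz).
  by rewrite lerDl ptau_ge0.
by rewrite tsqC /tsq (ptau_eq0 nmy) expr0n addr0.
Qed.

End Triangle.

Lemma glued_triangle_comparison : triangle_comparison (setT : set X).
Proof.
move=> x y z _ _ _ xy yz xz_pi a1 b1 g1 a2 b2 g2 a3 b3 g3 G1 G2 G3 x' y' z' exy eyz exz.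
have xz_pi' : ptau x z < pi by rewrite -lte_fin.
split.
- exact: (first_side_comparison xy yz xz_pi' exy eyz exz G1).
- exact: (second_side_comparison xy yz xz_pi' exy eyz exz G2).
- exact: (third_side_comparison xy yz xz_pi' exy eyz exz G3).
Qed.

Lemma glued_curvature : timelike_curvature_le_m1 X.
Proof.
move=> x; exists setT; split; first exact: filterT.
- apply: open_subspaceW; rewrite openE => z /=; rewrite lte_fin => zpi.
  have := near_lt (@ct_ptau R z) (@ct_cst R (plane R * plane R)%type pi z) zpi.
  by apply: filterS => w /=; rewrite lte_fin.
- by apply: continuous_subspaceT => z; exact: ct_glued_tau.
- move=> y z _ _ yz _; have [g [H L _ _]] := exists_maximizer (plt_ple yz) (plt_neq yz).
  by exists 0, 1, g.
- exact: glued_triangle_comparison.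
Qed.

End CurvatureBound.

Theorem mainTheorem1 (R : realType) :
  exists X : lorentzPreLengthSpace R,
    [/\ globally_hyperbolic X, regularly_localizable X,
        lorentzian_length_space X, timelike_curvature_le_m1 X &
        exists g : R -> X,
          [/\ causal_curve `[0, +oo[ g, achronal `[0, +oo[ g,
              geodesically_approximable `[0, +oo[ g &
              exists (a : R) (sg : R -> X),
                [/\ 0 < a, reparametrization `[0, a[ sg `[0, +oo[ g &
                    geodesically_approximable `[0, a[ sg]]].
Proof.
exists (glued R); split.
- exact: glued_hyperbolic.
- exact: glued_regularly_localizable.
- exact: glued_length_space.
- exact: glued_curvature.
exists (upper_ray 0); split.
- exact: upper_ray_causal.
- exact: upper_ray_achronal.
- exact: upper_ray_approximable.
exists 1, (lower_ray 0); split; first exact: ltr01.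
- exact: lower_ray_reparametrization.
- exact: lower_ray_approximable.
Qed.
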